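(* Let $0<s<1$ and $p\in(1,\infty)$ with $sp>1$. Let $1\le q\le p^*_s:=\frac{np}{n-sp}$ if $sp<n$, and $1\le q<\infty$ if $sp\ge n$. Then there exists a constant $C=C(n,s,p,q)>0$ such that the following holds. Let $B=B_r(x_0)\subset\mathbb{R}^n$ be an open ball of radius $r>0$, let $u\in W^{s,p}(B)$ be an $(s,p)$-quasi continuous function in $B$, and let $E\subset B$ be any open set as in the definition of $(s,p)$-quasi continuity of $u$ (i.e. for some $\epsilon>0$, $E$ is open, $\mathrm{Cap}_{s,p}(E,B)<\epsilon$ and $u|_{B\setminus E}$ is continuous). Put $Z(u;E^c)=\{x\in B: u(x)=0\}\cap E^c$ (a relatively closed subset of $B$). Then $$\left(\frac{1}{|B|}\int_{B}|u(x)|^{q}\,dx\right)^{\frac1q}\le C\left(\frac{1}{\mathrm{Cap}_{s,p}\left(Z(u;E^c)\cap \frac12\overline{B},\,B\right)}\int_{B}\int_{B}\frac{|u(x)-u(y)|^p}{|x-y|^{n+sp}}\,dx\,dy\right)^{\frac1p}.$$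
   Context: Notation: $B_r(x_0)$ is the open ball of center $x_0$ and radius $r$; $\frac12\overline{B}=\overline{B_{r/2}(x_0)}$; $|B|$ is Lebesgue measure; $E^c$ is the complement of $E$ in $B$. For an open set $\Omega\subseteq\mathbb{R}^n$, $[u]_{s,p,\Omega}^p=\int_\Omega\int_\Omega\frac{|u(x)-u(y)|^p}{|x-y|^{n+sp}}\,dx\,dy$ and $W^{s,p}(\Omega)=\{u\in L^p(\Omega):[u]_{s,p,\Omega}<\infty\}$. Variational $(s,p)$-Sobolev capacity: for compact $K\subset\Omega$, $\mathrm{Cap}_{s,p}(K,\Omega)=\inf\{[u]_{s,p,\Omega}^p: u\in C_c^\infty(\Omega),\ u\ge 1\text{ on }K\}$; for open $A\subset\Omega$, $\mathrm{Cap}_{s,p}(A,\Omega)=\sup\{\mathrm{Cap}_{s,p}(K,\Omega):K\subset A,\ K\text{ compact}\}$; for arbitrary $F\subset\Omega$, $\mathrm{Cap}_{s,p}(F,\Omega)=\inf\{\mathrm{Cap}_{s,p}(A,\Omega):F\subset A\subset\Omega,\ A\text{ open}\}$. A function $u:\Omega\to\mathbb{R}$ is $(s,p)$-quasi continuous in $\Omega$ if for every $\epsilon>0$ there is an open set $E\subset\Omega$ with $\mathrm{Cap}_{s,p}(E,\Omega)<\epsilon$ such that $u|_{\Omega\setminus E}$ is continuous. Here $\Omega=B$. Convention: if the capacity in the denominator is $0$, the right-hand side is understood as $+\infty$ (the inequality is then trivial). *)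

(* Defs.v *)
From HB Require Import structures.
From mathcomp Require Import all_boot all_order all_algebra.
From mathcomp Require Import all_classical all_reals all_analysis.

Set Implicit Arguments.
Unset Strict Implicit.
Unset Printing Implicit Defensive.

Import Order.TTheory GRing.Theory Num.Theory.
Import numFieldNormedType.Exports.

Local Open Scope classical_set_scope.
Local Open Scope ring_scope.

(** MathComp-Analysis only has Lebesgue measure on the line.  The n-fold product
   measure is built on Borel sets of n-tuples; the outer measure it induces is
   transported to ['rV[R]_n] (which carries the topology), and Caratheodory's
   construction then gives Lebesgue measure on all Lebesgue-measurable sets. *)

Section tuple_product.
Context d (T : measurableType d) (R : realType).
Variable m : {sigma_finite_measure set T -> \bar R}.

Definition tuple_cons n (x : T * n.-tuple T) : n.+1.-tuple T :=
  [tuple of x.1 :: x.2].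

Definition tuple_uncons n (t : n.+1.-tuple T) : T * n.-tuple T :=
  (thead t, [tuple of behead t]).

Lemma tuple_consK n : cancel (@tuple_cons n) (@tuple_uncons n).
Proof. by move=> [x t]; congr pair; apply/val_inj. Qed.

Lemma measurable_tuple_cons n : measurable_fun setT (@tuple_cons n).
Proof. exact: measurable_cons. Qed.

Lemma measurable_tuple_uncons n : measurable_fun setT (@tuple_uncons n).
Proof.
apply: measurable_fun_pair; last exact: measurable_behead.
exact: (measurable_tnth ord0).
Qed.

Section step.
Context {n : nat}.
Variable mu : {sigma_finite_measure set (n.-tuple T) -> \bar R}.

Definition tuple_product : set (n.+1.-tuple T) -> \bar R :=
  pushforward (m \x mu)%E (@tuple_cons n).

Let mpre A : measurable A -> measurable (@tuple_cons n @^-1` A).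
Proof.
by move=> mA; rewrite -[X in measurable X]setTI; exact: measurable_tuple_cons.
Qed.

Let tuple_product0 : tuple_product set0 = 0%E.
Proof. by rewrite /tuple_product /pushforward preimage_set0 measure0. Qed.

Let tuple_product_ge0 A : (0 <= tuple_product A)%E.
Proof. by rewrite /tuple_product /pushforward; exact: measure_ge0. Qed.

Let tuple_product_sigma_additive : semi_sigma_additive tuple_product.
Proof.
move=> F mF tF mUF; rewrite /tuple_product /pushforward preimage_bigcup.
apply: measure_semi_sigma_additive.
- by move=> k; exact: mpre.
- apply/trivIsetP => /= i j _ _ ij; rewrite -preimage_setI.
  by move/trivIsetP : tF => /(_ _ _ _ _ ij) ->//; rewrite preimage_set0.
- by rewrite -preimage_bigcup; exact: mpre.
Qed.

HB.instance Definition _ := isMeasure.Build _ _ _ tuple_product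
  tuple_product0 tuple_product_ge0 tuple_product_sigma_additive.

Let tuple_product_sigma_finite : sigma_finite setT tuple_product.
Proof.
have /sigma_finiteP[F [TF ndF Foo]] := sigma_finiteT m.
have /sigma_finiteP[G [TG ndG Goo]] := sigma_finiteT mu.
have pre k : tuple_product (@tuple_uncons n @^-1` (F k `*` G k)) =
    (m (F k) * mu (G k))%E.
  rewrite /tuple_product /pushforward -comp_preimage.
  rewrite (_ : _ \o _ = id) ?preimage_id; last exact/funext/tuple_consK.
  by apply: product_measure1E; [have [] := Foo k|have [] := Goo k].
exists (fun k => @tuple_uncons n @^-1` (F k `*` G k)).
  rewrite -preimage_bigcup [X in _ @^-1` X](_ : _ = setT) ?preimage_setT//.
  rewrite -subTset => -[x y] _.
  have : [set: T] x by []. rewrite TF => -[i _ Fix].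
  have : [set: n.-tuple T] y by []. rewrite TG => -[j _ Gjy].
  exists (maxn i j) => //; split.
  - by move: x Fix; exact/subsetPset/ndF/leq_maxl.
  - by move: y Gjy; exact/subsetPset/ndG/leq_maxr.
move=> k; have [? ?] := Foo k; have [? ?] := Goo k; split; last first.
  by rewrite [ltLHS]pre lte_mul_pinfty// ge0_fin_numE.
rewrite -[X in measurable X]setTI; apply: measurable_tuple_uncons => //.
exact: measurableX.
Qed.

HB.instance Definition _ := Measure_isSigmaFinite.Build _ _ _ tuple_product
  tuple_product_sigma_finite.
End step.

Fixpoint tuple_measure (n : nat) :
    {sigma_finite_measure set (n.-tuple T) -> \bar R} :=
  match n with
  | 0 => \d_([tuple] : 0.-tuple T)
  | n'.+1 => tuple_product (tuple_measure n')
  end.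

End tuple_product.

Section lebesgue_rV.
Context (R : realType) (n : nat).
Implicit Types A : set 'rV[R]_n.

Definition tuple_of_rV (v : 'rV[R]_n) : n.-tuple (measurableTypeR R) :=
  [tuple v ord0 i | i < n].

Definition lebesgue_outer A : \bar R :=
  mu_ext (tuple_measure (@lebesgue_measure R) n) (tuple_of_rV @` A).

Let lebesgue_outer0 : lebesgue_outer set0 = 0%E.
Proof. by rewrite /lebesgue_outer image_set0; exact: outer_measure0. Qed.

Let lebesgue_outer_ge0 A : (0 <= lebesgue_outer A)%E.
Proof. exact: outer_measure_ge0. Qed.

Let le_lebesgue_outer : {homo lebesgue_outer : A B / A `<=` B >-> (A <= B)%E}.
Proof. by move=> A B AB; apply: le_outer_measure; exact: image_subset. Qed.

Let lebesgue_outer_sigma_subadditive : sigma_subadditive lebesgue_outer.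
Proof.
move=> F; rewrite /lebesgue_outer image_bigcup.
exact: outer_measure_sigma_subadditive.
Qed.

HB.instance Definition _ := isOuterMeasure.Build R 'rV[R]_n lebesgue_outer
  lebesgue_outer0 lebesgue_outer_ge0 le_lebesgue_outer
  lebesgue_outer_sigma_subadditive.

(** [Rn R n] is ['rV[R]_n] with the Lebesgue-measurable sets as sigma-algebra. *)
Definition Rn := caratheodory_type lebesgue_outer.
HB.instance Definition _ := Measurable.on Rn.
HB.instance Definition _ := Pointed.on Rn.

Definition lebesgue_rV : set Rn -> \bar R := lebesgue_outer.

HB.instance Definition _ := isMeasure.Build _ Rn R lebesgue_rV
  lebesgue_outer0 lebesgue_outer_ge0
  (@caratheodory_measure_sigma_additive R 'rV[R]_n lebesgue_outer).

End lebesgue_rV.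
Arguments lebesgue_rV {R n}.

Section lebesgue_box.
Context {R : realType}.

Lemma tuple_lebesgue_box n (a b : 'I_n -> R) : (forall i, a i <= b i) ->
  let box := [set t : n.-tuple (measurableTypeR R) |
    forall i, (tnth t i : R) \in `[a i, b i]] in
  measurable box /\
  tuple_measure lebesgue_measure n box = (\prod_(i < n) (b i - a i))%:E.
Proof.
elim: n a b => [|n IHn] a b ab /=.
  rewrite (_ : mkset _ = setT); last by apply/seteqP; split => // t _ [].
  by rewrite big_ord0; split => //=; rewrite diracE in_setT.
have [mbox mubox] := IHn (a \o lift ord0) (b \o lift ord0) (fun i => ab _).
set B := mkset _ in mbox mubox; set B1 := mkset _.
have BE : @tuple_cons _ (measurableTypeR R) n @^-1` B1 = `[a ord0, b ord0]%classic `*` B.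
  apply/seteqP; split => [[x t]/= h|[x t] [/= h0 h] i].
    split; first by have := h ord0.
    by move=> i /=; have := h (lift ord0 i); rewrite tnthS.
  by have [j ->|->] := unliftP ord0 i; [rewrite tnthS; exact: h|exact: h0].
have B1E : B1 = @tuple_uncons _ (measurableTypeR R) n @^-1`
    (`[a ord0, b ord0]%classic `*` B).
  rewrite -BE -comp_preimage (_ : _ \o _ = id) ?preimage_id//.
  by apply/funext => t /=; rewrite [RHS]tuple_eta; apply/val_inj.
split.
  rewrite B1E -[X in measurable X]setTI.
  apply: (@measurable_tuple_uncons _ (measurableTypeR R) n) => //.
  by apply: measurableX => //; exact: measurable_itv.
rewrite /= /tuple_product /pushforward BE product_measure1E//.
rewrite [X in (_ * X)%E]mubox big_ord_recl EFinM. congr (_ * _)%E.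
apply: (etrans (lebesgue_measure_itv `[a ord0, b ord0])); rewrite /= lte_fin.
by have [->|ne] := eqVneq (a ord0) (b ord0);
  [rewrite ltxx subrr | rewrite lt_neqAle ne ab EFinB].
Qed.

Lemma lebesgue_rV_box n (a b : 'I_n -> R) : (forall i, a i <= b i) ->
  lebesgue_rV [set v : 'rV[R]_n | forall i, v ord0 i \in `[a i, b i]] =
  (\prod_(i < n) (b i - a i))%:E.
Proof.
move=> ab; have [mB muB] := tuple_lebesgue_box ab.
rewrite -muB -(measurable_mu_extE _ mB).
rewrite /lebesgue_rV /lebesgue_outer [X in mu_ext _ X](_ : _ = mkset (fun t =>
  forall i, (tnth t i : R) \in `[a i, b i]))//.
apply/seteqP; split => [_ [v hv <-] i/=|t ht]; first by rewrite tnth_mktuple.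
exists (\row_i tnth t i) => [i|]; first by rewrite mxE; exact: ht.
by apply: eq_from_tnth => i; rewrite tnth_mktuple mxE.
Qed.

End lebesgue_box.

(** The library norm on ['rV[R]_n] is the sup norm; it is used below only through
   its topology. *)

Section euclid.
Context {R : realType} {n : nat}.
Implicit Types x y : 'rV[R]_n.

Definition edist x y : R := Num.sqrt (\sum_(i < n) (x ord0 i - y ord0 i) ^+ 2).

Definition eball (x0 : 'rV[R]_n) (r : R) : set 'rV[R]_n :=
  [set x | edist x x0 < r].

End euclid.

Section sobolev.
Context {R : realType} {n : nat}.
Implicit Types (s p : R) (Om : set 'rV[R]_n) (u : 'rV[R]_n -> R).

(** The [p]-th power [[u]_{s,p,Om}^p] of the seminorm.  On the (null) diagonal
   the integrand is [0] as [0^-1 = 0]. *)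
Definition gagliardo s p Om u : \bar R :=
  \int[lebesgue_rV]_(x in Om) \int[lebesgue_rV]_(y in Om)
    (`|u x - u y| `^ p / edist x y `^ (n%:R + s * p))%:E.

(** Functions on [Om] are represented by total functions whose values outside
   [Om] are irrelevant. *)
Definition frac_sobolev s p Om : set ('rV[R]_n -> R) :=
  [set u | [/\ measurable_fun (Om : set (Rn R n)) (u : Rn R n -> R),
    (\int[lebesgue_rV]_(x in Om) (`|u x| `^ p)%:E < +oo)%E &
    (gagliardo s p Om u < +oo)%E]].

Fixpoint Ck (k : nat) u : Prop :=
  continuous u /\
  if k is k'.+1 then
    forall i : 'I_n, (forall x, derivable u x (delta_mx ord0 i)) /\
      Ck k' (fun x => 'D_(delta_mx ord0 i) u x)
  else True.

(** Elements of [C_c^oo(Om)] are identified with their extension by zero. *)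
Definition Cc_infty Om : set ('rV[R]_n -> R) :=
  [set u | [/\ forall k, Ck k u, compact (closure [set x | u x != 0]) &
    closure [set x | u x != 0] `<=` Om]].

Definition cap_compact s p Om (K : set 'rV[R]_n) : \bar R :=
  ereal_inf [set gagliardo s p Om u | u in
    [set u | Cc_infty Om u /\ forall x, K x -> 1 <= u x]].

Definition cap_open s p Om (A : set 'rV[R]_n) : \bar R :=
  ereal_sup [set cap_compact s p Om K | K in
    [set K | K `<=` A /\ compact K]].

Definition cap_outer s p Om (F : set 'rV[R]_n) : \bar R :=
  ereal_inf [set cap_open s p Om A | A in
    [set A | [/\ F `<=` A, A `<=` Om & open A]]].

(** Meaningful for [F `<=` Om] only.  The three clauses agree where they
   overlap, so their order is immaterial. *)
Definition cap s p (F Om : set 'rV[R]_n) : \bar R :=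
  if `[< compact F >] then cap_compact s p Om F
  else if `[< open F >] then cap_open s p Om F
  else cap_outer s p Om F.

Definition exceptional_set s p Om u (eps : R) (E : set 'rV[R]_n) : Prop :=
  [/\ open E, E `<=` Om, (cap s p E Om < eps%:E)%E &
    {within Om `\` E, continuous u}].

Definition quasi_continuous s p Om u : Prop :=
  forall eps : R, 0 < eps -> exists E, exceptional_set s p Om u eps E.

(** [zero_set Om u E] is [Z(u;E^c)], the complement being taken in [Om]. *)
Definition zero_set Om u (E : set 'rV[R]_n) : set 'rV[R]_n :=
  [set x | Om x /\ u x = 0] `&` (Om `\` E).

End sobolev.

(* Main.v *)
Require Import Defs.
From HB Require Import structures.
From mathcomp Require Import all_boot all_order all_algebra.
From mathcomp Require Import all_classical all_reals all_analysis.
From mathcomp Require Import measurable_realfun.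
From mathcomp Require Import ring lra.

Import Order.TTheory GRing.Theory Num.Theory.
Import numFieldNormedType.Exports.

Local Open Scope classical_set_scope.
Local Open Scope ring_scope.
Local Notation edist := Defs.edist.

(** The inequality splits into a bound for [u - c] and a bound for a constant
   [c].

   A Poincare inequality ([poincare]) and a fractional Sobolev inequality on balls
   ([sobolev]) give a constant [c] such that [u - c] is bounded in [L^p] and [L^q] by
   the energy of [u] ([poincare_sobolev]).  The Sobolev inequality is obtained
   directly from the double integral: around a point where a function vanishing on
   half of the ball takes a large value [t], the points where it is below [t / 2] must
   fill most of a ball whose volume is controlled by Chebyshev's inequality, and they
   contribute a definite amount of energy.

   The constant is bounded by testing a capacity.  If [u] were continuous and zero on
   the compact set [K], then [1 - u / c] would be [1] on [K] and, after a cutoff and a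
   mollification ([cutoff_smoothing]), admissible up to a factor for the capacity of
   [K]; its energy is at most a constant times [|c|^(-p)] times the energy of [u].
   Hence [|c|^p Cap(K)] is at most a constant times the energy
   ([mean_value_capacity]).

   The function [u] is only quasi continuous: near [K] it is close to [0] outside an
   open set [E] of small capacity.  So [1 - u / c] is replaced by its maximum with a
   function of small norm that equals [1] on all of [E].  Such a function is the
   increasing limit of almost minimisers for compact sets exhausting [E]; strong
   subadditivity of the energy makes the errors summable ([competitor_bigcup]).  The
   capacity controls only the energy of the minimisers; their [L^p] norm is controlled
   by a Friedrichs inequality ([friedrichs]), which holds because [K] has positive
   capacity, the only case of interest.

   Mollification does not increase the energy by Jensen's inequality and Tonelli's
   theorem ([energy_average]).  The latter requires joint measurability of
   [v (x + h)], which holds for Borel functions; hence the Borel representatives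
   ([borel_representative]). *)

(** * Lebesgue measure on row vectors *)

Lemma preimage_preimage_eq {T U V W : Type} (f : T -> U) (g : U -> W) (f' : T -> V)
    (g' : V -> W) (A : set W) : (forall t, g (f t) = g' (f' t)) ->
  f @^-1` (g @^-1` A) = f' @^-1` (g' @^-1` A).
Proof. by move=> E; apply/seteqP; split => t /=; rewrite E. Qed.

Lemma le_of_eq {d} {T : porderType d} (x y : T) : x = y -> (x <= y)%O.
Proof. by move=> ->. Qed.

Lemma measurable_superlevel {d} {T : measurableType d} {R : realType} (f : T -> R)
    (c : R) : measurable_fun setT f -> measurable [set x | c < f x].
Proof.
move=> mf; rewrite (_ : [set x | _] = setT `&` f @^-1` `]c, +oo[).
  by apply: mf => //; exact: measurable_itv.
by apply/seteqP; split => x /=; rewrite in_itv/= andbT// => -[].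
Qed.

Section lebesgue_rV_facts.
Context {R : realType}.
Local Notation mR := (measurableTypeR R).

Lemma lebesgue_measure_shift (h : R) (A : set mR) : measurable A ->
  lebesgue_measure ((fun x : mR => (x + h : mR)) @^-1` A) = lebesgue_measure A.
Proof.
move=> mA; have mh : measurable_fun setT (fun x : mR => (x + h : mR)).
  by apply: measurable_funD => //; exact: measurable_cst.
rewrite -[LHS]/(pushforward lebesgue_measure (fun x : mR => (x + h : mR)) A).
apply/esym/lebesgue_measure_unique => //= _ [[a b]] _ <-.
rewrite /pushforward (_ : _ @^-1` _ = `](a - h), (b - h)]%classic); last first.
  by apply/seteqP; split => x /=; rewrite !in_itv/= ltrBlDr lerBrDr.
rewrite !lebesgue_measure_itv/= !lte_fin ltrBrDr subrK.
by case: ifP => // _; rewrite -!EFinB; congr EFin; ring.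
Qed.

Definition tuple_shift {n} (h : 'I_n -> R) (t : n.-tuple mR) : n.-tuple mR :=
  [tuple (tnth t i + h i : R) | i < n].

Lemma measurable_tuple_shift {n} (h : 'I_n -> R) :
  measurable_fun setT (tuple_shift h).
Proof.
apply/measurable_fun_tnthP => i.
rewrite (_ : _ \o _ = (fun t : n.-tuple mR => (tnth t i + h i : mR))); last first.
  by apply/funext => t /=; rewrite tnth_mktuple.
by apply: measurable_funD => //; exact: measurable_tnth.
Qed.

(** By uniqueness of product measures, one coordinate at a time. *)
Lemma tuple_measure_shift n (h : 'I_n -> R) (A : set (n.-tuple mR)) :
  measurable A ->
  tuple_measure lebesgue_measure n (tuple_shift h @^-1` A) =
  tuple_measure lebesgue_measure n A.
Proof.
elim: n h A => [|n IHn] h A mA.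
  congr (tuple_measure _ _ _).
  by apply/seteqP; split => t /=; rewrite (tuple0 (tuple_shift h t)) (tuple0 t).
pose h0 (x : mR) : mR := x + h ord0.
pose h' : n.-tuple mR -> n.-tuple mR := tuple_shift (fun i : 'I_n => h (lift ord0 i)).
pose S (z : mR * n.-tuple mR) := (h0 z.1, h' z.2).
have mh0 : measurable_fun setT h0.
  by apply: measurable_funD => //; exact: measurable_cst.
have mS : measurable_fun setT S.
  apply: measurable_fun_pair.
    by apply: measurableT_comp.
  by apply: measurableT_comp => //; exact: measurable_tuple_shift.
pose m := tuple_measure (@lebesgue_measure R) n.
have mpre : measurable (@tuple_cons _ mR n @^-1` A).
  by rewrite -[X in measurable X]setTI; exact: measurable_tuple_cons.
rewrite /= /tuple_product /pushforward.
rewrite (_ : @tuple_cons _ mR n @^-1` (tuple_shift h @^-1` A) =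
             S @^-1` (@tuple_cons _ mR n @^-1` A)); last first.
  apply: preimage_preimage_eq => -[x t] /=.
  apply: eq_from_tnth => i; rewrite tnth_mktuple.
  have [j ->|->] := unliftP ord0 i; rewrite ?tnthS ?tnth0//.
  by rewrite tnth_mktuple.
rewrite -[LHS]/(pushforward (lebesgue_measure \x m)%E S _).
apply/esym/(@product_measure_unique _ _ _ _ _ _ _ (pushforward (lebesgue_measure \x m)%E S)) => //.
move=> X Y mX mY; rewrite /pushforward.
transitivity ((lebesgue_measure \x m)%E ((h0 @^-1` X) `*` (h' @^-1` Y))) => //.
rewrite product_measure1E.
- by congr (_ * _)%E; [exact: lebesgue_measure_shift | exact: IHn].
- by rewrite -[X in measurable X]setTI; exact: mh0.
- by rewrite -[X in measurable X]setTI; exact: measurable_tuple_shift.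
Qed.

Context {n : nat}.
Local Notation mu := (@lebesgue_rV R n).
Local Notation Tm := (n.-tuple mR).

Definition rV_of_tuple (t : Tm) : 'rV[R]_n := \row_i (tnth t i : R).

Lemma tuple_of_rVK : cancel (@tuple_of_rV R n) rV_of_tuple.
Proof. by move=> v; apply/rowP => i; rewrite mxE tnth_mktuple. Qed.

Lemma rV_of_tupleK : cancel rV_of_tuple (@tuple_of_rV R n).
Proof. by move=> t; apply: eq_from_tnth => i; rewrite tnth_mktuple mxE. Qed.

Lemma image_tuple_of_rV (A : set 'rV[R]_n) :
  @tuple_of_rV R n @` A = rV_of_tuple @^-1` A.
Proof.
apply/seteqP; split => [_ [v Av <-]/=|t At]; first by rewrite tuple_of_rVK.
by exists (rV_of_tuple t) => //; rewrite rV_of_tupleK.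
Qed.

(** Borel sets of tuples satisfy Caratheodory's condition for the outer
   measure they induce. *)
Lemma measurable_tuple_of_rV :
  measurable_fun [set: Rn R n] (@tuple_of_rV R n : Rn R n -> Tm).
Proof.
move=> _ A mA; rewrite setTI.
suff : (@lebesgue_outer R n).-caratheodory (@tuple_of_rV R n @^-1` A) by [].
move=> X.
have -> : lebesgue_outer X = mu_ext (tuple_measure lebesgue_measure n) (rV_of_tuple @^-1` X).
  by rewrite -image_tuple_of_rV.
have -> : lebesgue_outer (X `&` @tuple_of_rV R n @^-1` A) =
  mu_ext (tuple_measure lebesgue_measure n) ((rV_of_tuple @^-1` X) `&` A).
  rewrite /lebesgue_outer image_tuple_of_rV preimage_setI -comp_preimage.
  by congr (mu_ext _ (_ `&` _)); apply/seteqP; split => t /=; rewrite rV_of_tupleK.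
have -> : lebesgue_outer (X `&` ~` (@tuple_of_rV R n @^-1` A)) =
  mu_ext (tuple_measure lebesgue_measure n) ((rV_of_tuple @^-1` X) `&` ~` A).
  rewrite /lebesgue_outer image_tuple_of_rV preimage_setI preimage_setC -comp_preimage.
  by congr (mu_ext _ (_ `&` _)); apply/seteqP; split => t /=; rewrite rV_of_tupleK.
exact: (caratheodory_measurable_mu_ext _ mA).
Qed.

Lemma lebesgue_rV_preimage (A : set Tm) : measurable A ->
  mu (@tuple_of_rV R n @^-1` A) = tuple_measure lebesgue_measure n A.
Proof.
move=> mA; rewrite /lebesgue_rV /lebesgue_outer image_tuple_of_rV.
rewrite -comp_preimage (_ : _ \o _ = id); last first.
  by apply/funext => t; exact: rV_of_tupleK.
by rewrite preimage_id measurable_mu_extE.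
Qed.

Lemma measurable_coord (i : 'I_n) :
  measurable_fun [set: Rn R n] (fun x : Rn R n => (x : 'rV[R]_n) ord0 i).
Proof.
rewrite (_ : (fun x : Rn R n => _) = (@tnth n mR ^~ i) \o (@tuple_of_rV R n)); last first.
  by apply/funext => x /=; rewrite tnth_mktuple.
by apply: (measurableT_comp (measurable_tnth i)); exact: measurable_tuple_of_rV.
Qed.

Definition cbox (a b : 'I_n -> R) : set 'rV[R]_n :=
  [set v | forall i, v ord0 i \in `[a i, b i]].

Lemma measurable_cbox (a b : 'I_n -> R) : measurable (cbox a b : set (Rn R n)).
Proof.
rewrite (_ : cbox a b = \bigcap_(i in [set: 'I_n])
   ((fun x : Rn R n => (x : 'rV[R]_n) ord0 i) @^-1` `[a i, b i])); last first.
  by apply/seteqP; split => v /= h i; [move=> _ |]; exact: h.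
apply: fin_bigcap_measurable => // i _.
by rewrite -[X in measurable X]setTI; apply: measurable_coord => //; exact: measurable_itv.
Qed.

Lemma lebesgue_rV_sigma_finite : sigma_finite setT mu.
Proof.
exists (fun k => cbox (fun=> - k%:R) (fun=> k%:R)).
  apply/esym; rewrite -subTset => v _.
  pose M := \sum_(i < n) `|v ord0 i|.
  exists (Num.truncn M).+1 => //= i.
  have : `|v ord0 i| <= (Num.truncn M).+1%:R.
    apply: (@le_trans _ _ M); last by rewrite ltW// truncnS_gt.
    by rewrite /M (bigD1 i)//= lerDl sumr_ge0.
  by rewrite ler_norml in_itv.
move=> k; split; first exact: measurable_cbox.
by rewrite [ltLHS]lebesgue_rV_box ?ltry// => i; rewrite (le_trans _ (ler0n R k))// oppr_le0.
Qed.

HB.instance Definition _ := Measure_isSigmaFinite.Build _ _ _ mu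
  lebesgue_rV_sigma_finite.

Definition rat_cbox (q : {ffun 'I_n -> rat} * {ffun 'I_n -> rat}) : set 'rV[R]_n :=
  cbox (fun i => ratr (q.1 i)) (fun i => ratr (q.2 i)).

(** Enumerates the closed boxes with rational corners that lie in [A], with
   the empty set at the other indices. They exhibit an open set as a countable
   union of compact sets, which serves both measurability and the exhaustion
   used for capacities. *)
Definition inner_box (A : set 'rV[R]_n) (k : nat) : set 'rV[R]_n :=
  if unpickle k is Some q then
    if `[< rat_cbox q `<=` A >] then rat_cbox q else set0
  else set0.

Lemma compact_cbox (a b : 'I_n -> R) : compact (cbox a b).
Proof. by apply: (@rV_compact R n (fun i => `[a i, b i]%classic)) => i; exact: segment_compact. Qed.

Lemma compact_inner_box A k : compact (inner_box A k).
Proof.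
rewrite /inner_box; case: unpickle => [q|]; last exact: compact0.
by case: asboolP => _; [exact: compact_cbox | exact: compact0].
Qed.

Lemma measurable_inner_box A k : measurable (inner_box A k : set (Rn R n)).
Proof.
rewrite /inner_box; case: unpickle => [q|//].
by case: asboolP => _ //; exact: measurable_cbox.
Qed.

Lemma bigcup_inner_box (A : set 'rV[R]_n) : open A -> \bigcup_k inner_box A k = A.
Proof.
move=> oA; apply/seteqP; split => [x [k _]|x Ax].
  rewrite /inner_box; case: unpickle => [q|//].
  by case: asboolP => // qA; exact: qA.
have [e /= e0 xeA] : exists2 e : R, 0 < e & ball x e `<=` A.
  by apply/nbhs_ballP; move: oA; rewrite openE; exact.
have ha i : exists q : rat, ratr q \in `]x ord0 i - e, x ord0 i[.
  by apply: rat_in_itvoo; rewrite ltrBlDr ltrDl.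
have hb i : exists q : rat, ratr q \in `]x ord0 i, x ord0 i + e[.
  by apply: rat_in_itvoo; rewrite ltrDl.
pose a := [ffun i => projT1 (cid (ha i))].
pose b := [ffun i => projT1 (cid (hb i))].
have aP i : ratr (a i) \in `]x ord0 i - e, x ord0 i[.
  by rewrite ffunE; case: cid.
have bP i : ratr (b i) \in `]x ord0 i, x ord0 i + e[.
  by rewrite ffunE; case: cid.
have abA : rat_cbox (a, b) `<=` A.
  move=> y /= yab; apply: xeA; split => // i j; rewrite (ord1 i) /ball/=.
  move: (yab j) (aP j) (bP j); rewrite !in_itv/= => /andP[y1 y2] /andP[a1 a2] /andP[b1 b2].
  by rewrite ltr_distlC; apply/andP; split; lra.
exists (pickle (a, b)) => //; rewrite /inner_box pickleK.
case: asboolP => // _ i /=.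
move: (aP i) (bP i); rewrite !in_itv/= => /andP[a1 a2] /andP[b1 b2].
by rewrite (ltW a2) (ltW b1).
Qed.

Lemma open_measurable_rV (A : set 'rV[R]_n) : open A -> measurable (A : set (Rn R n)).
Proof.
move=> /bigcup_inner_box <-; apply: bigcupT_measurable => k.
exact: measurable_inner_box.
Qed.

Lemma continuous_measurable_rV (f : 'rV[R]_n -> R) : continuous f ->
  measurable_fun [set: Rn R n] (f : Rn R n -> R).
Proof.
move=> cf; apply: (measurability _ (RGenOInfty.measurableE R)).
move=> _ [_ [a ->] <-]; rewrite setTI; apply: open_measurable_rV.
by move/continuousP : cf; apply; exact: interval_open.
Qed.

(** ** Translation invariance *)

Lemma mu_ext_shift_le (h : 'I_n -> R) (X : set Tm) :
  (mu_ext (tuple_measure lebesgue_measure n) (tuple_shift h @^-1` X) <=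
   mu_ext (tuple_measure lebesgue_measure n) X)%E.
Proof.
apply: le_ereal_inf_tmp => _ [F [mF XF] <-].
apply: ereal_inf_lbound; exists (fun k => tuple_shift h @^-1` F k).
  split; first by move=> k; rewrite -[X in measurable X]setTI; exact: measurable_tuple_shift.
  by rewrite -preimage_bigcup; exact: preimage_subset.
by apply: eq_eseriesr => k _; exact: tuple_measure_shift.
Qed.

Lemma mu_ext_shift (h : 'I_n -> R) (X : set Tm) :
  mu_ext (tuple_measure lebesgue_measure n) (tuple_shift h @^-1` X) =
  mu_ext (tuple_measure lebesgue_measure n) X.
Proof.
apply/eqP; rewrite eq_le mu_ext_shift_le/=.
have := mu_ext_shift_le (fun i => - h i) (tuple_shift h @^-1` X).
rewrite -comp_preimage (_ : _ \o _ = id) ?preimage_id//.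
by apply/funext => t; apply: eq_from_tnth => i; rewrite !tnth_mktuple subrK.
Qed.

Definition rV_shift (h : 'rV[R]_n) (x : Rn R n) : Rn R n := ((x : 'rV[R]_n) + h)%R.

Lemma lebesgue_outer_shift (h : 'rV[R]_n) (A : set 'rV[R]_n) :
  lebesgue_outer (rV_shift h @^-1` A) = lebesgue_outer A.
Proof.
rewrite /lebesgue_outer !image_tuple_of_rV -[RHS](mu_ext_shift (h ord0)).
have E t : rV_of_tuple (tuple_shift (h ord0) t) = rV_shift h (rV_of_tuple t).
  by apply: (@rowP R n (rV_of_tuple _) _).1 => i; rewrite !mxE tnth_mktuple.
by congr (mu_ext _ _); apply/seteqP; split => t /=; rewrite E.
Qed.

(** Caratheodory's condition is invariant under translation because the outer
   measure is. *)
Lemma measurable_rV_shift (h : 'rV[R]_n) :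
  measurable_fun [set: Rn R n] (rV_shift h).
Proof.
move=> _ A mA; rewrite setTI.
suff : (@lebesgue_outer R n).-caratheodory (rV_shift h @^-1` A) by [].
have {}mA : (@lebesgue_outer R n).-caratheodory A by [].
move=> X; have := mA (rV_shift (- h) @^-1` X).
have hK : (fun x => rV_shift (- h) (rV_shift h x)) = id.
  by apply/funext => x; rewrite /rV_shift addrK.
rewrite lebesgue_outer_shift => ->.
by congr (_ + _)%E; rewrite -(lebesgue_outer_shift h) preimage_setI -comp_preimage
  (_ : _ \o _ = id) ?preimage_id//.
Qed.

Lemma lebesgue_rV_shift (h : 'rV[R]_n) (A : set (Rn R n)) :
  mu (rV_shift h @^-1` A) = mu A.
Proof. exact: lebesgue_outer_shift. Qed.

Lemma ge0_integral_shift (h : 'rV[R]_n) (f : Rn R n -> \bar R) :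
  measurable_fun setT f -> (forall x, 0 <= f x)%E ->
  (\int[mu]_x f (rV_shift h x) = \int[mu]_x f x)%E.
Proof.
move=> mf f0.
have mh := measurable_rV_shift h.
have := @ge0_integral_pushforward _ _ _ _ R (rV_shift h) mh mu setT f.
rewrite preimage_setT => H; rewrite -[LHS]H//.
apply: eq_measure_integral => A mA _; exact: lebesgue_rV_shift.
Qed.

Lemma integral_shift (h : 'rV[R]_n) (f : Rn R n -> \bar R) :
  measurable_fun setT f ->
  (\int[mu]_x f (rV_shift h x) = \int[mu]_x f x)%E.
Proof.
move=> mf; rewrite integralE [RHS]integralE; congr (_ - _)%E.
  apply: (etrans _ (ge0_integral_shift h (f^\+)%E _ _)) => //; first by apply: eq_integral => x _; rewrite ?funeposE ?funenegE.
  exact: measurable_funepos.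
apply: (etrans _ (ge0_integral_shift h (f^\-)%E _ _)) => //; first by apply: eq_integral => x _; rewrite ?funeposE ?funenegE.
exact: measurable_funeneg.
Qed.

(** ** Borel representatives *)

(** The hull is the intersection over [k] of countable Borel covers whose
   total mass exceeds that of [A] by at most [1 / (k + 1)]. *)
Lemma borel_hull_fin (A : set 'rV[R]_n) : (lebesgue_outer A < +oo)%E ->
  exists B : set Tm, [/\ measurable B, A `<=` @tuple_of_rV R n @^-1` B &
    lebesgue_outer A = mu (@tuple_of_rV R n @^-1` B)].
Proof.
move=> Afin.
have Ann : (0 <= lebesgue_outer A)%E by exact: outer_measure_ge0.
have Afn : lebesgue_outer A \is a fin_num by rewrite ge0_fin_numE.
have cov (k : nat) : exists F : (set Tm)^nat,
    measurable_cover (rV_of_tuple @^-1` A) F /\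
    (\sum_(0 <= j <oo) tuple_measure lebesgue_measure n (F j) <
     lebesgue_outer A + (k.+1%:R^-1)%:E)%E.
  have k0 : 0 < k.+1%:R^-1 :> R by rewrite invr_gt0.
  have := Afn; rewrite {1}/lebesgue_outer image_tuple_of_rV.
  move=> /lb_ereal_inf_adherent => /(_ _ k0)[_ [F FA <-] HF].
  by exists F; split => //; rewrite /lebesgue_outer image_tuple_of_rV.
pose F k := projT1 (cid (cov k)).
have mF k j : measurable (F k j) by rewrite /F; case: cid => G /= [[]].
have FA k : rV_of_tuple @^-1` A `<=` \bigcup_j F k j.
  by rewrite /F; case: cid => G /= [[]].
have Fle k : (\sum_(0 <= j <oo) tuple_measure lebesgue_measure n (F k j) <
     lebesgue_outer A + (k.+1%:R^-1)%:E)%E.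
  by rewrite /F; case: cid => G /= [].
pose B := \bigcap_k \bigcup_j F k j.
have mB : measurable B.
  by apply: bigcapT_measurable => k; apply: bigcupT_measurable.
have AB : A `<=` @tuple_of_rV R n @^-1` B.
  by move=> x Ax k _; apply: FA => /=; rewrite tuple_of_rVK.
exists B; split => //; apply/eqP; rewrite eq_le; apply/andP; split.
  exact: (le_outer_measure (@lebesgue_outer R n)).
apply/lee_addgt0Pr => e e0.
near \oo => k.
rewrite lebesgue_rV_preimage//.
apply: (@le_trans _ _ (tuple_measure lebesgue_measure n (\bigcup_j F k j))).
  apply: le_measure; rewrite ?inE//; first by apply: bigcupT_measurable.
  by apply: bigcap_inf.
apply: (@le_trans _ _ (\sum_(0 <= j <oo) tuple_measure lebesgue_measure n (F k j))%E).
  by apply: measure_sigma_subadditive => //; apply: bigcupT_measurable.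
apply: (le_trans (ltW (Fle k))); rewrite leeD2l// lee_fin ltW//.
near: k; exact: (near_infty_natSinv_lt (PosNum e0)).
Unshelve. all: by end_near. Qed.

Lemma borel_hull (A : set (Rn R n)) : measurable A ->
  exists B : set Tm, [/\ measurable B, A `<=` @tuple_of_rV R n @^-1` B &
    mu ((@tuple_of_rV R n @^-1` B) `\` A) = 0%E].
Proof.
move=> mA; have [S ST Sfin] := lebesgue_rV_sigma_finite.
have hull k : exists B : set Tm, [/\ measurable B,
    A `&` S k `<=` @tuple_of_rV R n @^-1` B &
    mu ((@tuple_of_rV R n @^-1` B) `\` (A `&` S k)) = 0%E].
  have [mS Sk] := Sfin k.
  have mASk : measurable (A `&` S k) by exact: measurableI.
  have ASk : (mu (A `&` S k) < +oo)%E.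
    by apply: le_lt_trans Sk; apply: le_measure; rewrite ?inE//; exact: subIsetr.
  have [B [mB AB AE]] := @borel_hull_fin (A `&` S k) ASk.
  exists B; split => //.
  have mB' : measurable (@tuple_of_rV R n @^-1` B : set (Rn R n)).
    by rewrite -[X in measurable X]setTI; exact: measurable_tuple_of_rV.
  rewrite measureD//; last by rewrite -[ltLHS]AE.
  rewrite setIidr//; rewrite -[X in (X - _)%E]AE; apply: subee.
  by rewrite AE ge0_fin_numE// -AE.
pose B k := projT1 (cid (hull k)).
have mB k : measurable (B k) by rewrite /B; case: cid => ? /= [].
have AB k : A `&` S k `<=` @tuple_of_rV R n @^-1` (B k).
  by rewrite /B; case: cid => ? /= [].
have BA k : mu ((@tuple_of_rV R n @^-1` (B k)) `\` (A `&` S k)) = 0%E.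
  by rewrite /B; case: cid => ? /= [].
have mpre k : measurable (@tuple_of_rV R n @^-1` (B k) : set (Rn R n)).
  by rewrite -[X in measurable X]setTI; exact: measurable_tuple_of_rV.
exists (\bigcup_k B k); split.
- exact: bigcupT_measurable.
- move=> x Ax; have : [set: Rn R n] x by []. rewrite ST => -[k _ Skx].
  by exists k => //; apply: AB.
- have : mu.-negligible (\bigcup_k ((@tuple_of_rV R n @^-1` (B k)) `\` (A `&` S k))).
    apply: negligible_bigcup => k; exists ((@tuple_of_rV R n @^-1` (B k)) `\` (A `&` S k)).
    split => //; last exact: BA.
    by apply: measurableD => //; apply: measurableI => //; exact: (Sfin k).1.
  move=> /negligibleS H.
  have {}H : mu.-negligible ((@tuple_of_rV R n @^-1` \bigcup_k B k) `\` A).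
    by apply: H => x [[k _ Bk] nA]; exists k => //; split => // -[].
  apply/negligibleP => //; apply: measurableD => //.
  by rewrite preimage_bigcup; exact: bigcupT_measurable.
Qed.

(** This is what makes [(x, h) |-> v (x + h)] jointly measurable up to null
   sets: addition of vectors is measurable into the Borel sets only. The null
   set [N] collects the points where the Borel hull of a rational superlevel
   set of [v] is too large. *)
Lemma borel_representative (v : Rn R n -> R) : measurable_fun setT v ->
  exists g : Tm -> R, measurable_fun setT g /\
    {ae mu, forall x, v x = g (tuple_of_rV x)}.
Proof.
move=> mv.
pose A (q : rat) : set (Rn R n) := [set x | ratr q < v x].
have mA q : measurable (A q) by exact: measurable_superlevel.
pose B q := projT1 (cid (borel_hull (A q) (mA q))).
have mB q : measurable (B q) by rewrite /B; case: cid => ? /= [].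
have AB q : A q `<=` @tuple_of_rV R n @^-1` (B q) by rewrite /B; case: cid => ? /= [].
have BA q : mu ((@tuple_of_rV R n @^-1` (B q)) `\` A q) = 0%E.
  by rewrite /B; case: cid => ? /= [].
have mpre (X : set Tm) : measurable X -> measurable (@tuple_of_rV R n @^-1` X : set (Rn R n)).
  by move=> mX; rewrite -[X in measurable X]setTI; exact: measurable_tuple_of_rV.
pose N0 : set (Rn R n) := \bigcup_(q in [set: rat]) ((@tuple_of_rV R n @^-1` (B q)) `\` A q).
have mN0 : measurable N0.
  by apply: bigcupT_measurable_rat => q; apply: measurableD => //; exact: mpre.
have N00 : mu N0 = 0%E.
  apply/negligibleP => //.
  have : mu.-negligible (\bigcup_k (if unpickle k is Some q then
      (@tuple_of_rV R n @^-1` (B q)) `\` A q else set0)).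
    apply: negligible_bigcup => k; case: unpickle => [q|]; last exact: negligible_set0.
    exists ((@tuple_of_rV R n @^-1` (B q)) `\` A q); split => //; last exact: BA.
    by apply: measurableD => //; exact: mpre.
  move=> /negligibleS H; apply: H => x [q _ Hq]; exists (pickle q); first exact: I.
  by rewrite pickleK; exact: Hq.
have [N [mN N0N NN0]] := borel_hull N0 mN0.
have muN : mu (@tuple_of_rV R n @^-1` N) = 0%E.
  rewrite -(setDKU N0N) measureU//; first by rewrite [X in (X + _)%E]NN0 [X in (_ + X)%E]N00 adde0.
    by apply: measurableD => //; exact: mpre.
  by rewrite setDKI.
pose g t := if t \in N then 0 else v (rV_of_tuple t).
exists g; split; last first.
  exists (@tuple_of_rV R n @^-1` N); split => //; first exact: mpre.
  move=> x /=; apply: contra_notP => Nx; rewrite /g memNset//.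
  by rewrite tuple_of_rVK.
have gq (q : rat) : measurable [set t | ratr q < g t].
  rewrite (_ : [set t | _] = (B q `\` N) `|` (N `&` [set t | ratr q < (0 : R)])).
    apply: measurableU; first exact: measurableD.
    have [q0|q0] := boolP (ratr q < (0 : R)).
      by rewrite (_ : mkset _ = setT) ?setIT//; apply/seteqP; split.
    by rewrite (_ : mkset _ = set0) ?setI0//; apply/seteqP; split => // t /=.
  apply/seteqP; split => t /=; rewrite /g.
    case: (boolP (t \in N)) => [/set_mem Nt q0|/negP Nt qv]; first by right.
    left; split; last by move=> /mem_set.
    by have := AB q (rV_of_tuple t) qv; rewrite /= rV_of_tupleK.
  case=> [[Bt Nt]|[/mem_set -> //]].
  rewrite memNset//; apply: contrapT => nv; apply: Nt.
  have := N0N (rV_of_tuple t); rewrite /= rV_of_tupleK; apply.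
  by exists q => //; split => //=; rewrite rV_of_tupleK.
apply: (measurability _ (RGenOInfty.measurableE R)).
move=> _ [_ [y ->] <-]; rewrite setTI.
rewrite (_ : g @^-1` _ = \bigcup_(q in [set: rat]) (if y <= ratr q then [set t | ratr q < g t] else set0)).
  by apply: bigcupT_measurable_rat => q; case: ifP.
apply/seteqP; split => t /=; rewrite in_itv/= andbT.
  move=> /rat_in_itvoo[q]; rewrite in_itv/= => /andP[yq qg].
  by exists q => //; rewrite (ltW yq).
by move=> [q _]; case: ifP => // yq /=; exact: le_lt_trans.
Qed.

End lebesgue_rV_facts.

(** * Euclidean balls *)

Lemma measurable_funV_ge0 {d} {T : measurableType d} {R : realType} (D : set T)
    (f : T -> R) : (forall x, 0 <= f x) -> measurable_fun D f ->
  measurable_fun D (fun x => (f x)^-1).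
Proof.
move=> f0 mf; rewrite (_ : (fun x => _) = (@powR R ^~ (-1)) \o f); last first.
  by apply/funext => x /=; rewrite powR_inv1.
by apply: (measurableT_comp (measurable_powR _)).
Qed.

Section euclid_facts.
Context {R : realType} {n : nat}.
Implicit Types x y z v : 'rV[R]_n.

Lemma cauchy_schwarz (a b : 'I_n -> R) :
  (\sum_i a i * b i) ^+ 2 <= (\sum_i a i ^+ 2) * (\sum_i b i ^+ 2).
Proof.
set A := \sum_i a i ^+ 2; set B := \sum_i b i ^+ 2; set C := \sum_i a i * b i.
have B0 : 0 <= B by apply: sumr_ge0 => i _; exact: sqr_ge0.
have [Bz|Bn] := eqVneq B 0.
  have b0 i : b i = 0.
    move/eqP : Bz; rewrite /B psumr_eq0; last by move=> j _; exact: sqr_ge0.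
    by move=> /allP/(_ i); rewrite mem_index_enum sqrf_eq0 => /(_ isT)/eqP.
  rewrite /C big1 => [|i _]; last by rewrite b0 mulr0.
  by rewrite expr0n/= Bz mulr0.
have B1 : 0 < B by rewrite lt_neqAle eq_sym Bn.
have : 0 <= \sum_i (B * a i - C * b i) ^+ 2 by apply: sumr_ge0 => i _; exact: sqr_ge0.
rewrite (_ : \sum_i _ = B * (A * B - C ^+ 2)); first by rewrite pmulr_rge0// subr_ge0.
rewrite (eq_bigr (fun i => B ^+ 2 * a i ^+ 2 + ((- (B * C * 2)) * (a i * b i) + C ^+ 2 * b i ^+ 2))).
  rewrite !big_split/= -!mulr_sumr -/A -/B -/C; ring.
by move=> i _; ring.
Qed.

Lemma euclid_ge0 x y : 0 <= edist x y. Proof. exact: sqrtr_ge0. Qed.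

Lemma sum_sqr_ge0 (a : 'I_n -> R) : 0 <= \sum_i a i ^+ 2.
Proof. by apply: sumr_ge0 => i _; exact: sqr_ge0. Qed.

Lemma edist_sqr x y : edist x y ^+ 2 = \sum_i (x ord0 i - y ord0 i) ^+ 2.
Proof. by rewrite sqr_sqrtr// sum_sqr_ge0. Qed.

Lemma euclid_sym x y : edist x y = edist y x.
Proof. by congr Num.sqrt; apply: eq_bigr => i _; rewrite -sqrrN opprB. Qed.

Lemma edistxx x : edist x x = 0.
Proof. by rewrite /edist big1 ?sqrtr0// => i _; rewrite subrr expr0n. Qed.

Lemma euclid_triangle y x z : edist x z <= edist x y + edist y z.
Proof.
rewrite -(ler_pXn2r (n := 2))// ?nnegrE ?addr_ge0 ?euclid_ge0// sqrrD !edist_sqr.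
have := cauchy_schwarz (fun i => x ord0 i - y ord0 i) (fun i => y ord0 i - z ord0 i).
rewrite -!edist_sqr -exprMn => CS.
have {}CS : \sum_i (x ord0 i - y ord0 i) * (y ord0 i - z ord0 i) <= edist x y * edist y z.
  apply: le_trans (ler_norm _) _.
  by rewrite -(ler_pXn2r (n := 2))// ?nnegrE ?mulr_ge0 ?euclid_ge0// real_normK ?num_real.
rewrite [X in X <= _]edist_sqr.
rewrite (eq_bigr (fun i => (x ord0 i - y ord0 i) ^+ 2 +
   (((x ord0 i - y ord0 i) * (y ord0 i - z ord0 i)) *+ 2 + (y ord0 i - z ord0 i) ^+ 2))).
  rewrite !big_split/= -!edist_sqr addrA lerD2r lerD2l.
  by rewrite mulr2n lerD.
by move=> i _; ring.
Qed.

Lemma coord_le_edist x y i : `|x ord0 i - y ord0 i| <= edist x y.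
Proof.
rewrite -sqrtr_sqr ler_sqrt ?sum_sqr_ge0//.
by rewrite (bigD1 i)//= lerDl; apply: sumr_ge0 => j _; exact: sqr_ge0.
Qed.

Lemma edist_le_sum x y : edist x y <= \sum_i `|x ord0 i - y ord0 i|.
Proof.
rewrite -(ler_pXn2r (n := 2))// ?nnegrE ?euclid_ge0 ?sumr_ge0// edist_sqr.
pose K (b a : R) := 0 <= b /\ a <= b ^+ 2.
suff : K (\sum_i `|x ord0 i - y ord0 i|) (\sum_i (x ord0 i - y ord0 i) ^+ 2) by case.
elim/big_rec2 : _ => [|i b a _ [b0 ab]]; first by split; rewrite ?expr0n.
split; first by rewrite addr_ge0.
rewrite [leRHS]sqrrD real_normK ?num_real// -addrA lerD2l (le_trans ab)// lerDr.
by rewrite mulrn_wge0 ?mulr_ge0.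
Qed.

Lemma edist_shift h x y : edist (x + h) (y + h) = edist x y.
Proof.
by congr Num.sqrt; apply: eq_bigr => i _; rewrite !mxE opprD addrACA subrr addr0.
Qed.

Lemma edist_subr x y : edist x y = edist (x - y) 0.
Proof. by rewrite -(edist_shift y (x - y)) subrK add0r. Qed.

Lemma edistZ (a : R) v : edist (a *: v) 0 = `|a| * edist v 0.
Proof.
rewrite /edist -sqrtr_sqr -sqrtrM ?sqr_ge0//; congr Num.sqrt.
by rewrite mulr_sumr; apply: eq_bigr => i _; rewrite !mxE !subr0 exprMn.
Qed.

Lemma edist_eq0 x y : (edist x y == 0) = (x == y).
Proof.
apply/eqP/eqP => [xy0|->]; last exact: edistxx.
apply/rowP => i; apply/eqP; rewrite -subr_eq0 -normr_le0 -xy0.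
exact: coord_le_edist.
Qed.

Lemma edist_gt0 x y : (0 < edist x y) = (x != y).
Proof. by rewrite lt_neqAle euclid_ge0 andbT eq_sym edist_eq0. Qed.

Lemma norm_le_edist x y (e : R) : (forall i, `|x ord0 i - y ord0 i| <= e) ->
  edist x y <= n%:R * e.
Proof.
move=> h; apply: (le_trans (edist_le_sum x y)).
apply: (@le_trans _ _ (\sum_(i < n) e)); first exact: ler_sum.
by rewrite sumr_const card_ord mulr_natl.
Qed.

Lemma continuous_edist y : continuous (fun x => edist x y).
Proof.
move=> x; have F : ProperFilter (nbhs x) := @nbhs_pfilter ('rV[R]_n : topologicalType) x.
apply/cvgrPdist_lt => e e0; near=> z.
have xz : edist x z < e.
  apply: (@le_lt_trans _ _ (n%:R * (e / n.+1%:R))).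
    apply: norm_le_edist => i; apply: ltW.
    have : ball (x : 'rV[R]_n) (e / n.+1%:R) z.
      by near: z; apply: (@nbhsx_ballx R 'rV[R]_n x); rewrite divr_gt0.
    by case=> _ /(_ ord0 i).
  by rewrite mulrCA gtr_pMr// ltr_pdivrMr// mul1r ltr_nat.
apply: le_lt_trans xz; have := euclid_triangle z x y; have := euclid_triangle x z y.
by rewrite (euclid_sym z x) ler_norml => ? ?; apply/andP; split; lra.
Unshelve. all: by end_near. Qed.

Lemma open_eball x (r : R) : open (eball x r).
Proof.
rewrite (_ : eball x r = (fun y => edist y x) @^-1` `]-oo, r[); last first.
  by apply/seteqP; split => y /=; rewrite in_itv.
by move/continuousP : (continuous_edist x); apply; exact: interval_open.
Qed.

Definition cball x (r : R) : set 'rV[R]_n := [set y | edist y x <= r].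

Lemma closed_cball x (r : R) : closed (cball x r).
Proof.
rewrite (_ : cball x r = (fun y => edist y x) @^-1` `]-oo, r]); last first.
  by apply/seteqP; split => y /=; rewrite in_itv.
by apply: closed_comp; [move=> y _; exact: continuous_edist | exact: interval_closed].
Qed.

Lemma eball_sub_cbox x (r : R) :
  cball x r `<=` cbox (fun i => x ord0 i - r) (fun i => x ord0 i + r).
Proof.
move=> y xy i; rewrite in_itv/= -ler_distlC.
by apply: le_trans xy; rewrite euclid_sym; exact: coord_le_edist.
Qed.

Lemma compact_cball x (r : R) : compact (cball x r).
Proof.
apply: (subclosed_compact (closed_cball x r)); last exact: eball_sub_cbox.
exact: compact_cbox.
Qed.

Lemma sub_eball x (r1 r2 : R) : r1 <= r2 -> eball x r1 `<=` eball x r2.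
Proof. by move=> r12 y /= /lt_le_trans; apply. Qed.

Lemma closure_eball_sub x (r : R) : closure (eball x r) `<=` cball x r.
Proof.
apply: (@subset_trans _ (closure (cball x r))).
  by apply: closure_subset => y /=; exact: ltW.
by rewrite -(closure_id _).1//; exact: closed_cball.
Qed.

Local Notation mu := (@lebesgue_rV R n).

Lemma measurable_eball x (r : R) : measurable (eball x r : set (Rn R n)).
Proof. by apply: open_measurable_rV; exact: open_eball. Qed.

Lemma measurable_edist x : measurable_fun [set: Rn R n] (fun y : Rn R n => edist y x).
Proof. by apply: continuous_measurable_rV; exact: continuous_edist. Qed.

Lemma measurable_edist2 :
  measurable_fun [set: Rn R n * Rn R n] (fun z : Rn R n * Rn R n => edist z.1 z.2).
Proof.
rewrite /edist; apply: (measurableT_comp (f := @Num.sqrt R)).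
  by apply: continuous_measurable_fun; exact: sqrt_continuous.
apply: measurable_sum => i; apply: measurable_funX; apply: measurable_funB.
  exact: (measurableT_comp (measurable_coord i)).
exact: (measurableT_comp (measurable_coord i)).
Qed.

Lemma eball_volume_ge x (r : R) : (0 < n)%N -> 0 < r ->
  (((r / n%:R) ^+ n)%:E <= mu (eball x r))%E.
Proof.
move=> n0 r0; pose a := r / n%:R / 2.
have n0' : 0 < n%:R :> R by rewrite ltr0n.
have a0 : 0 < a by rewrite !divr_gt0.
rewrite (_ : _%:E = mu (cbox (fun i => x ord0 i - a) (fun i => x ord0 i + a))).
  apply: le_measure; rewrite ?inE; [exact: measurable_cbox|exact: measurable_eball|].
  move=> y yx; rewrite /eball/=.
  apply: (@le_lt_trans _ _ (n%:R * a)).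
    by apply: norm_le_edist => i; rewrite distrC ler_distlC; have := yx i; rewrite in_itv.
  by rewrite /a mulrA mulrCA mulfV ?gt_eqF// mulr1 ltr_pdivrMr// mulr_natr mulr2n ltrDl.
rewrite [RHS]lebesgue_rV_box => [|i]; last by lra.
congr EFin; rewrite -[LHS](_ : \prod_(i < n) (r / n%:R) = _).
  by apply: eq_bigr => i _; rewrite /a; field; rewrite gt_eqF.
by rewrite prodr_const card_ord.
Qed.

Lemma eball_volume_le x (r : R) : 0 <= r ->
  (mu (eball x r) <= ((2 * r) ^+ n)%:E)%E.
Proof.
move=> r0.
rewrite (_ : _%:E = mu (cbox (fun i => x ord0 i - r) (fun i => x ord0 i + r))).
  apply: le_measure; rewrite ?inE; [exact: measurable_eball|exact: measurable_cbox|].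
  by move=> y xy; apply: eball_sub_cbox; exact: ltW.
rewrite [RHS]lebesgue_rV_box => [|i]; last by lra.
congr EFin; rewrite -[LHS](_ : \prod_(i < n) (2 * r) = _).
  by apply: eq_bigr => i _; ring.
by rewrite prodr_const card_ord.
Qed.

(** Moving [x] towards [x0] by the fraction [rho / (2 r)] of the way gives the
   centre of a ball of radius [rho / 2] that lies in both balls. *)
Lemma eball_density x0 (r : R) x (rho : R) : (0 < n)%N -> eball x0 r x ->
  0 < rho -> rho <= 2 * r ->
  (((rho / 2 / n%:R) ^+ n)%:E <= mu (eball x0 r `&` eball x rho))%E.
Proof.
move=> n0 xB rho0 rhor.
have r0 : 0 < r by lra.
pose t := rho / (2 * r).
have t0 : 0 < t by rewrite divr_gt0// mulr_gt0.
have t1 : t <= 1 by rewrite ler_pdivrMr ?mul1r// mulr_gt0.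
have tr : t * r = rho / 2 by rewrite /t; field; rewrite gt_eqF.
pose z := x + t *: (x0 - x).
apply: (le_trans (eball_volume_ge z (rho / 2) n0 _)); first by lra.
apply: le_measure; rewrite ?inE; [exact: measurable_eball| |].
  by apply: measurableI; exact: measurable_eball.
have zx : edist z x = t * edist x x0.
  by rewrite edist_subr /z addrAC subrr add0r edistZ gtr0_norm// -edist_subr euclid_sym.
have zx0 : edist z x0 = (1 - t) * edist x x0.
  rewrite edist_subr (_ : z - x0 = (1 - t) *: (x - x0)).
    by rewrite edistZ ger0_norm ?subr_ge0// -edist_subr.
  by rewrite /z scalerBl scale1r -addrA [_ - x0]addrC addrA -scalerN opprB.
rewrite /eball/= in xB *; move=> y /= yz; split => /=.
  apply: le_lt_trans (euclid_triangle z _ _) _; rewrite zx0.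
  have : (1 - t) * edist x x0 <= (1 - t) * r by rewrite ler_wpM2l ?subr_ge0// ltW.
  by lra.
apply: le_lt_trans (euclid_triangle z _ _) _; rewrite zx.
have : t * edist x x0 <= t * r by rewrite ler_wpM2l ?ltW.
by lra.
Qed.

(** The kernel is summed over dyadic shells; writing it as a quotient makes it
   vanish at the centre. *)
Lemma integral_kernel_ball : (0 < n)%N -> forall al : R, 0 < al ->
  exists2 C : R, 0 < C & forall x (r : R), 0 < r ->
  (\int[mu]_(y in eball x r) (edist y x `^ al / edist y x ^+ n)%:E <=
    (C * r `^ al)%:E)%E.
Proof.
move=> n0 al al0.
pose th : R := 2^-1 `^ al.
have th0 : 0 < th by rewrite powR_gt0.
have th1 : th < 1.
  suff : 2^-1 `^ al < 1 `^ al :> R by rewrite powR1.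
  by apply: gt0_ltr_powR; rewrite ?nnegrE ?invf_lt1 ?ltr1n.
exists (4 ^+ n / (1 - th)); first by rewrite divr_gt0 ?exprn_gt0 ?subr_gt0.
move=> x r r0.
pose dy k : R := r * 2^-1 ^+ k.
have dy0 k : 0 < dy k by rewrite mulr_gt0 ?exprn_gt0 ?invr_gt0.
pose c k : R := dy k `^ al * (dy k.+1 ^+ n)^-1.
have c0 k : 0 <= c k by rewrite mulr_ge0 ?powR_ge0 ?invr_ge0 ?exprn_ge0 ?ltW.
pose g k (y : Rn R n) : \bar R := ((c k)%:E * (\1_(eball x (dy k) : set (Rn R n)) y)%:E)%E.
have g0 k y : (0 <= g k y)%E by rewrite mule_ge0 ?lee_fin.
have mind k : measurable_fun (eball x r : set (Rn R n))
    (fun y => (\1_(eball x (dy k) : set (Rn R n)) y)%:E : \bar R).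
  by apply/measurable_EFinP; apply: measurable_indic; exact: measurable_eball.
have mg k : measurable_fun (eball x r : set (Rn R n)) (g k).
  by apply: emeasurable_funM => //; exact: measurable_cst.
apply: (@le_trans _ _ (\int[mu]_(y in eball x r) (\sum_(k <oo) g k y))%E).
  apply: ge0_le_integral.
  - exact: measurable_eball.
  - by move=> y _; rewrite lee_fin divr_ge0 ?powR_ge0 ?exprn_ge0 ?euclid_ge0.
  - apply/measurable_EFinP; apply: measurable_funM.
      by apply: (measurableT_comp (measurable_powR _)); apply: measurable_funTS;
        exact: measurable_edist.
    apply: measurable_funV_ge0; first by move=> y; rewrite exprn_ge0 ?euclid_ge0.
    by apply: measurable_funX; apply: measurable_funTS; exact: measurable_edist.
  - by apply: ge0_emeasurable_sum => k; [move=> y *; exact: g0 | move=> *; exact: mg].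
  move=> y yr; set d := edist y x.
  have [d0|dn0] := eqVneq d 0.
    rewrite d0 powR0 ?gt_eqF// mul0r; exact: nneseries_ge0.
  have d0 : 0 < d by rewrite lt_neqAle eq_sym dn0 euclid_ge0.
  have exk : exists k, dy k.+1 <= d.
    have [m hm] : exists m, r / d <= m%:R.
      by exists (Num.truncn (r / d)).+1; rewrite ltW// truncnS_gt.
    exists m; rewrite /dy exprVn ler_pdivrMr ?exprn_gt0//.
    rewrite mulrC -ler_pdivrMr// (le_trans hm)// -natrX ler_nat.
    by rewrite (leq_trans _ (leq_pexp2l _ (leqnSn m)))// ltnW// ltn_expl.
  have [k kd kmin] := find_ex_minn exk.
  have dk : d < dy k.
    case: k kd kmin => [|k] kd kmin; first by rewrite /dy expr0 mulr1.
    by rewrite ltNge; apply/negP => /kmin; rewrite ltnn.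
  apply: (@le_trans _ _ (g k y)); last first.
    apply: (@le_trans _ _ (\sum_(0 <= i < k.+1) g i y)%E); last exact: nneseries_lim_ge.
    by rewrite big_nat_recr//= leeDr// sume_ge0.
  rewrite /g indicE mem_set// mule1 lee_fin /c.
  apply: ler_pM; rewrite ?powR_ge0 ?invr_ge0 ?exprn_ge0 ?euclid_ge0//.
    by apply: ge0_ler_powR; rewrite ?nnegrE ltW.
  rewrite lef_pV2 ?posrE ?exprn_gt0//.
  by apply: lerXn2r => //; rewrite nnegrE; apply: ltW; rewrite ?dy0.
rewrite integral_nneseries//; last exact: measurable_eball.
apply: (@le_trans _ _ (\sum_(k <oo) (4 ^+ n * r `^ al * th ^+ k)%:E)%E).
  apply: lee_nneseries; first by move=> *; apply: integral_ge0 => *; exact: g0.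
  move=> k _.
  have mD := measurable_eball x r; have mDk := measurable_eball x (dy k).
  rewrite /g ge0_integralZl; try first [exact: mD | exact: mind | by move=> *; rewrite lee_fin | by rewrite lee_fin c0].
  rewrite integral_indic; try first [exact: mD | exact: mDk].
  apply: (@le_trans _ _ ((c k)%:E * ((2 * dy k) ^+ n)%:E)%E).
    apply: lee_wpmul2l; first by rewrite lee_fin.
    apply: le_trans (eball_volume_le x _ (ltW (dy0 k))).
    by apply: le_measure; rewrite ?inE; [apply: measurableI; exact: measurable_eball|
      exact: measurable_eball|exact: subIsetl].
  rewrite lee_fin /c; apply: le_of_eq.
  rewrite /dy powRM ?(ltW r0) ?exprn_ge0// -(powR_mulrn k (_ : 0 <= 2^-1))//.
  rewrite -powRrM mulrC [k%:R * al]mulrC powRrM powR_mulrn ?powR_ge0// -/th.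
  rewrite exprS !exprMn.
  rewrite (powR_mulrn k (ltW th0)).
  have -> : 4 ^+ n = 2 ^+ n * 2 ^+ n :> R by rewrite -exprMn; congr (_ ^+ _); ring.
  have r' : r ^+ n != 0 by rewrite expf_neq0 ?gt_eqF.
  have h1 : 2^-1 ^+ k ^+ n != 0 :> R by rewrite !expf_neq0 ?invr_eq0 ?pnatr_eq0.
  have h2 : 2 ^+ n != 0 :> R by rewrite expf_neq0 ?pnatr_eq0.
  by rewrite (exprVn 2 n); field; rewrite r' h1 h2.
apply: lime_le.
  apply: is_cvg_nneseries => k _; rewrite lee_fin.
  by rewrite !mulr_ge0 ?exprn_ge0 ?powR_ge0// ltW.
apply: nearW => N; rewrite sumEFin lee_fin mulrAC.
apply: geometric_le_lim => //; first by rewrite mulr_ge0 ?exprn_ge0 ?powR_ge0.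
by rewrite gtr0_norm.
Qed.

End euclid_facts.

(** * A smooth bump function on the line *)

Section bump.
Context {R : realType}.

(** Quadratic remainder bounds survive integration against an integrable
   function, so with this criterion no theorem on differentiation under the
   integral sign is needed. *)
Lemma quadratic_is_derive (V : normedModType R) (f : V -> R) (a v : V) (L M : R) :
  (forall h, `|f (h *: v + a) - f a - h * L| <= M * h ^+ 2) -> is_derive a v f L.
Proof.
move=> H; have M0 : 0 <= M by have := H 1; rewrite expr1n mulr1; exact: le_trans.
have cv : h^-1 *: (f (h *: v + a) - f a) @[h --> (0 : R)^'] --> L.
  apply/cvgrPdist_lt => e e0; near=> h.
  have h0 : h != 0 by near: h; exact: nbhs_dnbhs_neq.
  have he : `|h| < e / (M + 1).
    near: h; apply: dnbhs0_lt; rewrite divr_gt0//; lra.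
  have -> : L - h^-1 *: (f (h *: v + a) - f a) = - h^-1 * (f (h *: v + a) - f a - h * L).
    by rewrite [_ *: _]mulrC; field.
  rewrite normrM normrN normfV mulrC ltr_pdivrMr ?normr_gt0//.
  apply: (le_lt_trans (H h)); rewrite -real_normK ?num_real// expr2 mulrA.
  rewrite ltr_pM2r ?normr_gt0//.
  apply: (@le_lt_trans _ _ ((M + 1) * `|h|)); first by rewrite ler_wpM2r//; lra.
  by rewrite mulrC -ltr_pdivlMr//; lra.
by apply: DeriveDef; [exact: cvgP cv | exact: cvg_lim cv].
Unshelve. all: by end_near. Qed.

Lemma expRN_pow_le (k : nat) (x : R) : 0 <= x -> x ^+ k * expR (- x) <= k%:R ^+ k.
Proof.
move=> x0; case: k => [|k]; first by rewrite !expr0 mul1r -expR0 ler_expR oppr_le0.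
have k0 : 0 < k.+1%:R :> R by rewrite ltr0n.
rewrite expRN ler_pdivrMr ?expR_gt0//.
rewrite (_ : expR x = expR (x / k.+1%:R) ^+ k.+1); last first.
  by rewrite -expRM_natl; congr expR; field; rewrite gt_eqF.
rewrite -exprMn; apply: lerXn2r; rewrite ?nnegrE ?mulr_ge0 ?expR_ge0//.
rewrite mulrC -ler_pdivrMr//; apply: le_trans (expR_ge1Dx _).
by rewrite lerDr ler01.
Qed.

Lemma horner_expRN_bound (P : {poly R}) :
  exists2 M : R, 0 <= M & forall x, 0 <= x -> `|P.[x] * expR (- x)| <= M.
Proof.
exists (\sum_(i < size P) `|P`_i| * i%:R ^+ i).
  by apply: sumr_ge0 => i _; rewrite mulr_ge0 ?exprn_ge0.
move=> x x0; rewrite horner_coef mulr_suml.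
apply: (le_trans (ler_norm_sum _ _ _)); apply: ler_sum => i _.
rewrite !normrM -mulrA ler_wpM2l// normrX (ger0_norm x0).
by rewrite (ger0_norm (expR_ge0 _)); exact: expRN_pow_le.
Qed.

(** The function [P(1/t) exp(-1/t)] for positive [t], extended by [0]. The
   family is closed under differentiation, which acts on [P] as [flat_next].
   *)
Definition flat (P : {poly R}) (t : R) : R :=
  if 0 < t then P.[t^-1] * expR (- t^-1) else 0.

Definition flat_next (P : {poly R}) : {poly R} := 'X^2 * (P - P^`()).

Lemma flat_quadratic (P : {poly R}) :
  exists2 M : R, 0 <= M & forall t, `|flat P t| <= M * t ^+ 2.
Proof.
have [M M0 HM] := horner_expRN_bound ('X^2 * P).
exists M => // t; rewrite /flat; case: ifPn => [t0|_]; last first.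
  by rewrite normr0 mulr_ge0 ?sqr_ge0.
have tn : t != 0 by rewrite gt_eqF.
have := HM t^-1; rewrite invr_ge0 (ltW t0) => /(_ isT).
rewrite hornerM hornerXn -mulrA normrM (ger0_norm (_ : 0 <= t^-1 ^+ 2)); last first.
  by rewrite sqr_ge0.
by rewrite exprVn mulrC ler_pdivrMr// exprn_gt0.
Qed.

Lemma is_derive_flat (P : {poly R}) (t : R) :
  is_derive t 1 (flat P) (flat (flat_next P) t).
Proof.
have [t0|t0|->] := ltgtP t 0.
- rewrite [X in is_derive _ _ _ X]/flat ltNge (ltW t0)/=.
  apply: (@near_eq_is_derive _ _ _ (cst 0)).
    near=> z; rewrite /flat ltNge (_ : z <= 0)//.
    by apply: ltW; near: z; exact: lt_nbhsl.
- have E : {near t, (fun t => P.[t^-1] * expR (- t^-1)) =1 flat P}.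
    near=> z; rewrite /flat (_ : 0 < z)//; near: z; apply: open_nbhs_nbhs.
    by split; [exact: (@open_gt R 0) | exact: t0].
  apply: (near_eq_is_derive E).
  have tn : t != 0 by rewrite gt_eqF.
  have dV : is_derive t 1 (fun t : R => t^-1) (- t ^- 2).
    have := @is_deriveV _ id t 1 1 tn (is_derive_id t 1).
    by rewrite [_ *: _]mulr1.
  have dP : is_derive t 1 (fun t : R => P.[t^-1]) (P^`().[t^-1] * - t ^- 2).
    exact: (@is_derive1_comp R (horner P) (fun t => t^-1) t _ _ (is_derive_poly P _) dV).
  have dVN : is_derive t 1 (fun t : R => - t^-1) (t ^- 2).
    by have := is_deriveN dV; rewrite opprK.
  have dE : is_derive t 1 (fun t : R => expR (- t^-1)) (expR (- t^-1) * t ^- 2).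
    exact: (@is_derive1_comp R expR (fun t => - t^-1) t _ _ (is_derive_expR _) dVN).
  apply: (is_derive_eq (is_deriveM dP dE)).
  rewrite /flat t0 /flat_next hornerM hornerXn hornerD hornerN.
  by rewrite /GRing.scale/= exprVn; ring.
- have -> : flat (flat_next P) 0 = 0 by rewrite /flat ltxx.
  have [M M0 HM] := flat_quadratic P.
  apply: (@quadratic_is_derive R _ _ _ _ M) => h.
  have -> : flat P 0 = 0 by rewrite /flat ltxx.
  by rewrite mulr0 !subr0 addr0 [_ *: _]mulr1.
Unshelve. all: by end_near. Qed.

(** Quantifying the successive derivatives existentially makes the closure
   properties below plain inductions. *)
Fixpoint smoothk (k : nat) (f : R -> R) : Prop :=
  if k is k'.+1 then
    exists2 f', (forall t, is_derive (t : R) (1 : R) f (f' t)) & smoothk k' f'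
  else True.

Lemma smoothkS k f : smoothk k.+1 f -> smoothk k f.
Proof.
elim: k f => [//|k IHk] f [f' ff' sf']; exists f' => //; exact: IHk.
Qed.

Lemma smoothkD k f g : smoothk k f -> smoothk k g -> smoothk k (fun t => f t + g t).
Proof.
elim: k f g => [//|k IHk] f g [f' ff' sf'] [g' gg' sg'].
by exists (fun t => f' t + g' t); [move=> t; exact: is_deriveD | exact: IHk].
Qed.

Lemma smoothkZ k (c : R) f : smoothk k f -> smoothk k (fun t => c * f t).
Proof.
elim: k f => [//|k IHk] f [f' ff' sf'].
by exists (fun t => c * f' t); [move=> t; exact: (is_deriveZ c) | exact: IHk].
Qed.

Lemma smoothkM k f g : smoothk k f -> smoothk k g -> smoothk k (fun t => f t * g t).
Proof.
elim: k f g => [//|k IHk] f g sf sg.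
have sf1 := smoothkS _ _ sf; have sg1 := smoothkS _ _ sg.
case: sf => f' ff' sf'; case: sg => g' gg' sg'.
exists (fun t => f t * g' t + g t * f' t); first by move=> t; exact: is_deriveM.
by apply: smoothkD; exact: IHk.
Qed.

Lemma smoothk_affine k (a b : R) f : smoothk k f -> smoothk k (fun t => f (a * t + b)).
Proof.
elim: k f => [//|k IHk] f [f' ff' sf'].
exists (fun t => a * f' (a * t + b)); last by apply: smoothkZ; exact: IHk.
move=> t; have da : is_derive t 1 (fun t : R => a * t + b) a.
  have := is_deriveD (is_deriveZ a (is_derive_id t (1 : R))) (is_derive_cst b t (1 : R)).
  by rewrite addr0 [_ *: _]mulr1.
have := @is_derive1_comp R f (fun t => a * t + b) t _ _ (ff' _) da.
by rewrite mulrC.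
Qed.

Lemma smoothk_flat k P : smoothk k (flat P).
Proof.
elim: k P => [//|k IHk] P; exists (flat (flat_next P)) => // t.
exact: is_derive_flat.
Qed.

Definition smooth_bump (e : R) (t : R) : R := flat 1 (e - t) * flat 1 (e + t).

Lemma smoothk_bump k e : smoothk k (smooth_bump e).
Proof.
rewrite (_ : smooth_bump e = fun t => flat 1 (-1 * t + e) * flat 1 (1 * t + e)).
  by apply: smoothkM; apply: smoothk_affine; exact: smoothk_flat.
by apply/funext => t; rewrite /smooth_bump mulN1r mul1r addrC (addrC t).
Qed.

Lemma flat1_ge0 t : 0 <= flat 1 t.
Proof. by rewrite /flat; case: ifP => // _; rewrite hornerC mul1r expR_ge0. Qed.

Lemma flat1_gt0 t : 0 < t -> 0 < flat 1 t.
Proof. by move=> t0; rewrite /flat t0 hornerC mul1r expR_gt0. Qed.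

Lemma bump_ge0 e t : 0 <= smooth_bump e t.
Proof. by rewrite mulr_ge0 ?flat1_ge0. Qed.

Lemma bump_gt0 e t : `|t| < e -> 0 < smooth_bump e t.
Proof.
rewrite ltr_norml => /andP[h1 h2].
by rewrite mulr_gt0 ?flat1_gt0//; lra.
Qed.

Lemma bump_eq0 e t : e <= `|t| -> smooth_bump e t = 0.
Proof.
rewrite ler_normr /smooth_bump /flat => /orP[h|h].
  by rewrite subr_gt0 ltNge h/= mul0r.
by rewrite [X in _ * X]ifF ?mulr0//; apply/negbTE; rewrite -leNgt; lra.
Qed.

Lemma smooth_derive1n f : (forall k, smoothk k f) -> forall j,
  (forall t, is_derive (t : R) (1 : R) (derive1n j f) (derive1n j.+1 f t)) /\
  forall k, smoothk k (derive1n j f).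
Proof.
have step g : (forall k, smoothk k g) ->
    (forall t, is_derive (t : R) (1 : R) g ((derive1 g) t)) /\ forall k, smoothk k (derive1 g).
  move=> sg; have gE g' : (forall t, is_derive (t : R) (1 : R) g (g' t)) -> g' = (derive1 g).
    by move=> gg'; apply/funext => t; rewrite derive1E; have gt := gg' t; rewrite derive_val.
  split; first by have [g' gg' _] := sg 1; rewrite -(gE _ gg').
  by move=> k; have [g' gg' sg'] := sg k.+1; rewrite -(gE _ gg').
move=> sf; elim=> [|j [_ IHj]]; first by split => //; exact: (step f sf).1.
have [h1 h2] := step _ IHj.
by split; [exact: (step _ h2).1 | exact: h2].
Qed.

Lemma mvt_bound (f f' : R -> R) (M : R) : (forall t, is_derive (t : R) (1 : R) f (f' t)) ->
  (forall t, `|f' t| <= M) -> forall a b, `|f b - f a| <= M * `|b - a|.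
Proof.
move=> df fM a b; wlog ab : a b / a <= b.
  move=> H; have [/H//|/ltW ba] := leP a b.
  by rewrite distrC (distrC b); exact: H.
have [|c _ ->] := @MVT_segment R f f' a b ab (fun x _ => df x).
  apply: derivable_within_continuous => x _.
  by have := df x; case.
by rewrite normrM ler_wpM2r.
Qed.

Lemma taylor_bound (f f' f'' : R -> R) (M : R) :
  (forall t, is_derive (t : R) (1 : R) f (f' t)) ->
  (forall t, is_derive (t : R) (1 : R) f' (f'' t)) ->
  (forall t, `|f'' t| <= M) ->
  forall t h, `|f (t + h) - f t - h * f' t| <= M * h ^+ 2.
Proof.
move=> df df' f''M t h.
have M0 : 0 <= M by apply: le_trans (f''M 0).
have lip a b : a <= b -> forall c, c \in `[a, b] -> forall x, x \in `[a, b] ->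
    `|f' c - f' x| <= M * (b - a).
  move=> ab c; rewrite in_itv/= => /andP[c1 c2] x; rewrite in_itv/= => /andP[x1 x2].
  apply: (le_trans (mvt_bound _ _ _ df' f''M _ _)).
  by rewrite ler_wpM2l// ler_norml; apply/andP; split; lra.
have [h0|/ltW h0] := leP 0 h.
  have tth : t <= t + h by lra.
  have [|c cab ->] := @MVT_segment R f f' _ _ tth (fun x _ => df x).
    by apply: derivable_within_continuous => x _; have := df x; case.
  rewrite [_ - t](_ : _ = h); last ring.
  rewrite (mulrC h) -mulrBl normrM (ger0_norm h0).
  have := lip _ _ tth c cab t; rewrite in_itv/= lexx tth => /(_ isT).
  rewrite [t + h - t](_ : _ = h); last ring.
  by move=> H; rewrite expr2 mulrA ler_wpM2r.
have tth : t + h <= t by lra.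
have [|c cab E] := @MVT_segment R f f' _ _ tth (fun x _ => df x).
  by apply: derivable_within_continuous => x _; have := df x; case.
rewrite -(opprB (f t)) E [t - (t + h)](_ : _ = - h); last ring.
rewrite mulrN opprK (mulrC h) -mulrBl normrM (ler0_norm h0).
have := lip _ _ tth c cab t; rewrite in_itv/= lexx tth => /(_ isT).
rewrite [t - (t + h)](_ : _ = - h); last ring.
move=> H; rewrite (_ : M * h ^+ 2 = (M * - h) * - h); last ring.
by rewrite ler_wpM2r// oppr_ge0.
Qed.

(** The derivatives vanish outside the interval [[-e, e]], hence are bounded
   by their maximum there. *)
Lemma bump_derive_bound e j : 0 < e -> exists2 M : R, 1 <= M &
  forall t, `|derive1n j (smooth_bump e) t| <= M.
Proof.
move=> e0; have sm := smooth_derive1n _ (fun k => smoothk_bump k e).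
have z i t : e < `|t| -> derive1n i (smooth_bump e) t = 0.
  elim: i t => [|i IHi] t et; first exact/bump_eq0/ltW.
  have <- : 'D_1 (cst 0) t = 0 :> R by rewrite derive_cst.
  rewrite derive1nS derive1E; apply: near_eq_derive.
  near=> s; apply: IHi; near: s.
  move: et; rewrite ltr_normr => /orP[h|h].
    near=> x; rewrite ltr_normr; apply/orP; left; near: x.
    by apply: open_nbhs_nbhs; split; [exact: (@open_gt R e) | exact: h].
  near=> x; rewrite ltr_normr; apply/orP; right; rewrite ltrNr; near: x.
  by apply: open_nbhs_nbhs; split; [exact: (@open_lt R (- e)) | rewrite /= ltrNr].
have ct : continuous (derive1n j (smooth_bump e)).
  move=> t; apply: differentiable_continuous; apply/derivable1_diffP.
  by have := (sm j).1 t; case.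
have e2 : - e <= e by lra.
have [c _ Hc] : exists2 c, c \in `[- e, e]%R & forall t, t \in `[- e, e]%R ->
    `|derive1n j (smooth_bump e) t| <= `|derive1n j (smooth_bump e) c|.
  apply: EVT_max => //; apply: continuous_subspaceT => t.
  by apply: continuous_comp; [exact: ct | exact: norm_continuous].
exists (1 + `|derive1n j (smooth_bump e) c|); first by rewrite lerDl.
move=> t; have [et|te] := ltP e `|t|.
  by rewrite z// normr0 addr_ge0.
apply: (le_trans (Hc t _)); last by rewrite lerDr.
by rewrite in_itv/= -ler_norml.
Unshelve. all: by end_near. Qed.

End bump.

(** * Smoothing by convolution *)

Section convolution.
Context {R : realType} {n : nat}.
Local Notation mu := (@lebesgue_rV R n).
Local Notation V := 'rV[R]_n.
Implicit Types (a : 'I_n -> nat) (x y z : V).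

Lemma prod_norm_le (s : seq 'I_n) (M : R) (u : 'I_n -> R) : 1 <= M ->
  (forall i, `|u i| <= M) -> `|\prod_(i <- s) u i| <= M ^+ size s.
Proof.
move=> M1 uM; have M0 : 0 <= M by apply: le_trans M1.
elim: s => [|i s IHs]; first by rewrite big_nil normr1 expr0.
by rewrite big_cons normrM exprS ler_pM.
Qed.

Lemma prod_lipschitz (s : seq 'I_n) (M : R) (u w : 'I_n -> R) : 1 <= M ->
  (forall i, `|u i| <= M) -> (forall i, `|w i| <= M) ->
  `|\prod_(i <- s) u i - \prod_(i <- s) w i| <=
  M ^+ size s * \sum_(i <- s) `|u i - w i|.
Proof.
move=> M1 uM wM; have M0 : 0 <= M by apply: le_trans M1.
elim: s => [|i s IHs]; first by rewrite !big_nil subrr normr0 mulr0.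
rewrite !big_cons /= exprS.
set P := \prod_(j <- s) u j; set Q := \prod_(j <- s) w j; set S := \sum_(j <- s) _.
rewrite (_ : u i * P - w i * Q = (u i - w i) * P + w i * (P - Q)); last ring.
apply: (le_trans (ler_normD _ _)); rewrite !normrM mulrDr.
apply: lerD.
  rewrite mulrC ler_wpM2r//.
  apply: (le_trans (prod_norm_le _ _ _ M1 uM)).
  by rewrite ler_peMl// exprn_ge0.
by rewrite -mulrA; apply: ler_pM.
Qed.

Variable e : R.
Hypothesis e0 : 0 < e.
Local Notation b := (fun j => derive1n j (smooth_bump e)).

(** The multi-index [a] lists the orders of the partial derivatives, so that
   the family of kernels is closed under differentiation. *)
Definition bump_kernel a (z : V) : R := \prod_(i < n) b (a i) (z ord0 i).

Definition bump_index (a : 'I_n -> nat) (i : 'I_n) : 'I_n -> nat :=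
  fun j => if j == i then (a j).+1 else a j.

Lemma bump_all_bound a : exists2 M : R, 1 <= M & forall i t,
  [/\ `|b (a i) t| <= M, `|b (a i).+1 t| <= M & `|b (a i).+2 t| <= M].
Proof.
have H j := bump_derive_bound e j e0.
pose m j := projT1 (cid2 (H j)).
have m1 j : 1 <= m j by rewrite /m; case: cid2.
have mP j t : `|b j t| <= m j by rewrite /m; case: cid2.
exists (1 + \sum_i (m (a i) + m (a i).+1 + m (a i).+2)).
  by rewrite lerDl sumr_ge0// => i _; have := m1 (a i); have := m1 (a i).+1;
    have := m1 (a i).+2; lra.
move=> i t.
have : m (a i) + m (a i).+1 + m (a i).+2 <=
    \sum_j (m (a j) + m (a j).+1 + m (a j).+2).
  rewrite (bigD1 i)//= lerDl sumr_ge0// => j _.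
  by have := m1 (a j); have := m1 (a j).+1; have := m1 (a j).+2; lra.
have := m1 (a i); have := m1 (a i).+1; have := m1 (a i).+2.
have := mP (a i) t; have := mP (a i).+1 t; have := mP (a i).+2 t.
by move=> *; split; lra.
Qed.

Let sm := smooth_derive1n _ (fun k => smoothk_bump k e).

Lemma bump_kernel_bound a : exists2 M : R, 0 <= M & forall z, `|bump_kernel a z| <= M.
Proof.
have [M M1 HM] := bump_all_bound a.
exists (M ^+ size (index_enum 'I_n)).
  by apply: exprn_ge0; exact: le_trans M1.
by move=> z; apply: prod_norm_le => // i; have [] := HM i (z ord0 i).
Qed.

Lemma bump_kernel_lipschitz a : exists2 L : R, 0 <= L & forall z w,
  `|bump_kernel a z - bump_kernel a w| <= L * \sum_i `|z ord0 i - w ord0 i|.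
Proof.
have [M M1 HM] := bump_all_bound a.
have M0 : 0 <= M by exact: le_trans M1.
exists (M ^+ size (index_enum 'I_n) * M); first by rewrite mulr_ge0 ?exprn_ge0.
move=> z w; rewrite /bump_kernel.
apply: (@le_trans _ _ (M ^+ size (index_enum 'I_n) *
    \sum_i `|b (a i) (z ord0 i) - b (a i) (w ord0 i)|)).
  apply: prod_lipschitz => // i; first by have [] := HM i (z ord0 i).
  by have [] := HM i (w ord0 i).
rewrite -mulrA ler_wpM2l ?exprn_ge0// mulr_sumr; apply: ler_sum => i _.
apply: (mvt_bound _ _ _ (sm (a i)).1) => t.
by have [] := HM i t.
Qed.

Lemma bump_kernel_taylor a i : exists2 M : R, 0 <= M & forall z h,
  `|bump_kernel a (z + h *: delta_mx ord0 i) - bump_kernel a z -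
    h * bump_kernel (bump_index a i) z| <= M * h ^+ 2.
Proof.
have [M M1 HM] := bump_all_bound a.
have M0 : 0 <= M by exact: le_trans M1.
pose s := [seq j <- index_enum 'I_n | j != i].
exists (M ^+ size s * M); first by rewrite mulr_ge0 ?exprn_ge0.
move=> z h; rewrite /bump_kernel.
rewrite !(bigD1 (P := xpredT) i)//=.
have E1 : \prod_(j < n | j != i) b (a j) ((z + h *: delta_mx ord0 i) ord0 j) =
    \prod_(j < n | j != i) b (a j) (z ord0 j).
  by apply: eq_bigr => j ji; rewrite !mxE eqxx/= (negbTE ji) mulr0 addr0.
have E2 : \prod_(j < n | j != i) b (bump_index a i j) (z ord0 j) =
    \prod_(j < n | j != i) b (a j) (z ord0 j).
  by apply: eq_bigr => j ji; rewrite /bump_index (negbTE ji).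
have E3 : (z + h *: delta_mx ord0 i) ord0 i = z ord0 i + h.
  by rewrite !mxE !eqxx mulr1.
have E4 : bump_index a i i = (a i).+1 by rewrite /bump_index eqxx.
rewrite {}E1 {}E2 {}E3 {}E4.
set P := \prod_(_ < n | _) _.
have HP : `|P| <= M ^+ size s.
  rewrite /P -big_filter; apply: (prod_norm_le s M (fun j => b (a j) (z ord0 j))) => // j.
  by have [] := HM j (z ord0 j).
rewrite (_ : _ - _ = P * (b (a i) (z ord0 i + h) - b (a i) (z ord0 i) -
   h * b (a i).+1 (z ord0 i))); last ring.
rewrite normrM -mulrA; apply: ler_pM => //.
apply: (taylor_bound _ _ _ M (sm (a i)).1 (sm (a i).+1).1) => t.
by have [] := HM i t.
Qed.

Lemma measurable_bump_kernel a :
  measurable_fun [set: Rn R n] (bump_kernel a : Rn R n -> R).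
Proof.
apply: measurable_prod => i _.
apply: (measurableT_comp (f := b (a i))); last exact: measurable_coord.
apply: continuous_measurable_fun => t.
apply: differentiable_continuous; apply/derivable1_diffP.
by have := (sm (a i)).1 t; case.
Qed.

Lemma bump_kernel0_ge0 z : 0 <= bump_kernel (fun=> 0) z.
Proof. by apply: prodr_ge0 => i _; exact: bump_ge0. Qed.

Lemma bump_kernel0_eq0 z i : e <= `|z ord0 i| -> bump_kernel (fun=> 0) z = 0.
Proof.
by move=> ez; rewrite /bump_kernel (bigD1 i)//= [X in X * _](_ : _ = 0) ?mul0r//; exact: bump_eq0.
Qed.

Lemma bump_kernel0_gt0 z : (forall i, `|z ord0 i| < e) -> 0 < bump_kernel (fun=> 0) z.
Proof. by move=> ez; apply: prodr_gt0 => i _; exact: bump_gt0. Qed.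

Variable v : Rn R n -> R.
Hypothesis iv : mu.-integrable setT (EFin \o v).

Let nv : R := Rintegral mu setT (fun y => `|v y|).

Lemma Rintegral_bounded_mul (T : Rn R n -> R) (M : R) : measurable_fun setT T ->
  (forall y, `|T y| <= M) ->
  mu.-integrable setT (EFin \o (fun y => T y * v y)) /\
  `|Rintegral mu setT (fun y => T y * v y)| <= M * nv.
Proof.
move=> mT TM.
have iTv : mu.-integrable setT (EFin \o (fun y => T y * v y)).
  have := @integrableMr _ _ _ mu _ measurableT T (EFin \o v) mT _ iv.
  apply; exists M; split; first exact: num_real.
  by move=> x Mx y _; apply: (le_trans (TM y)); exact: ltW.
split => //.
have ia : mu.-integrable setT (EFin \o (fun y => `|v y|)) by exact: integrable_norm.
apply: (le_trans (le_normr_Rintegral _ iTv)) => //.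
rewrite /nv -RintegralZl//.
apply: le_Rintegral => //; first exact: (integrable_norm iTv).
  by have := integrableZl measurableT M ia.
by move=> y _ /=; rewrite normrM ler_wpM2r.
Qed.

Definition convolve (K : V -> R) (x : V) : R :=
  Rintegral mu setT (fun y : Rn R n => K ((y : V) - x) * v y).

Lemma measurable_kernel_shift a x :
  measurable_fun [set: Rn R n] (fun y : Rn R n => bump_kernel a ((y : V) - x)).
Proof.
exact: (measurableT_comp (measurable_bump_kernel a) (measurable_rV_shift (- x))).
Qed.

Lemma convolve_lipschitz a : exists2 L : R, 0 <= L & forall x x',
  `|convolve (bump_kernel a) x - convolve (bump_kernel a) x'| <=
  L * \sum_i `|x ord0 i - x' ord0 i|.
Proof.
have [L L0 HL] := bump_kernel_lipschitz a; have [M M0 HM] := bump_kernel_bound a.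
have nv0 : 0 <= nv by apply: Rintegral_ge0.
exists (L * nv); first by rewrite mulr_ge0.
move=> x x'; rewrite /convolve.
have [i1 _] := Rintegral_bounded_mul _ M (measurable_kernel_shift a x) (fun y => HM _).
have [i2 _] := Rintegral_bounded_mul _ M (measurable_kernel_shift a x') (fun y => HM _).
rewrite -RintegralB//.
under eq_Rintegral do rewrite -mulrBl.
rewrite mulrAC.
have mT : measurable_fun [set: Rn R n] (fun y : Rn R n =>
    bump_kernel a ((y : V) - x) - bump_kernel a ((y : V) - x')).
  by apply: measurable_funB; exact: measurable_kernel_shift.
apply: (Rintegral_bounded_mul _ _ mT _).2 => y.
apply: (le_trans (HL _ _)); rewrite ler_wpM2l//.
apply: ler_sum => i _; rewrite [X in `|X|](_ : _ = x' ord0 i - x ord0 i); first by rewrite distrC.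
by rewrite !mxE; ring.
Qed.

(** The sign comes from the kernel being evaluated at [y - x]. *)
Lemma convolve_is_derive a i x :
  is_derive x (delta_mx ord0 i : V) (convolve (bump_kernel a))
    (- convolve (bump_kernel (bump_index a i)) x).
Proof.
have [M M0 HM] := bump_kernel_taylor a i; have [M1 M10 HM1] := bump_kernel_bound a.
have [M2 M20 HM2] := bump_kernel_bound (bump_index a i).
apply: (@quadratic_is_derive R _ _ _ _ _ (M * nv)) => h.
rewrite /convolve.
have [i1 _] := Rintegral_bounded_mul _ _ (measurable_kernel_shift a (h *: delta_mx ord0 i + x)) (fun y => HM1 _).
have [i2 _] := Rintegral_bounded_mul _ _ (measurable_kernel_shift a x) (fun y => HM1 _).
have [i3 _] := Rintegral_bounded_mul _ _ (measurable_kernel_shift (bump_index a i) x) (fun y => HM2 _).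
rewrite mulrN opprK -RintegralZl// -RintegralB//.
have i4 : mu.-integrable setT (EFin \o (fun y : Rn R n =>
    bump_kernel a ((y : V) - (h *: delta_mx ord0 i + x)) * v y - bump_kernel a ((y : V) - x) * v y)).
  by have := integrableB measurableT i1 i2.
have i5 : mu.-integrable setT (EFin \o (fun y : Rn R n =>
    h * (bump_kernel (bump_index a i) ((y : V) - x) * v y))).
  by have := integrableZl measurableT h i3.
rewrite -RintegralD//.
pose T (y : Rn R n) : R := bump_kernel a ((y : V) - x + (- h) *: delta_mx ord0 i) -
  bump_kernel a ((y : V) - x) - (- h) * bump_kernel (bump_index a i) ((y : V) - x).
rewrite (_ : Rintegral mu setT _ = Rintegral mu setT (fun y => T y * v y)); last first.
  apply: eq_Rintegral => y _; rewrite /T (_ : (y : V) - (h *: delta_mx ord0 i + x) =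
     (y : V) - x + (- h) *: delta_mx ord0 i); last by rewrite opprD scaleNr addrA addrAC.
  by ring.
rewrite mulrAC.
apply: (Rintegral_bounded_mul _ _ _ _).2.
  apply: measurable_funB; last first.
    by apply: measurable_funM; [exact: measurable_cst | exact: measurable_kernel_shift].
  apply: measurable_funB; last exact: measurable_kernel_shift.
  rewrite (_ : (fun x0 : Rn R n => _) = (fun y : Rn R n => bump_kernel a ((y : V) - (x + h *: delta_mx ord0 i)))).
    exact: measurable_kernel_shift.
  by apply/funext => y; rewrite opprD addrA scaleNr.
by move=> y; rewrite -sqrrN; exact: HM.
Qed.

Lemma continuous_convolve a : continuous (convolve (bump_kernel a)).
Proof.
have [L L0 HL] := convolve_lipschitz a.
move=> x; have F : ProperFilter (nbhs x) := @nbhs_pfilter (V : topologicalType) x.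
apply/cvgrPdist_lt => d d0; pose c := d / (L + 1) / n.+1%:R.
have c0 : 0 < c by rewrite !divr_gt0//; lra.
near=> z.
apply: (le_lt_trans (HL _ _)).
apply: (@le_lt_trans _ _ (L * (n%:R * c))).
  rewrite ler_wpM2l//.
  apply: (@le_trans _ _ (\sum_(i < n) c)); last by rewrite sumr_const card_ord mulr_natl.
  apply: ler_sum => i _; apply: ltW.
  have : ball (x : V) c z by near: z; apply: (@nbhsx_ballx R V x); exact: c0.
  by case=> _ /(_ ord0 i).
have nn1 : n%:R / n.+1%:R <= 1 :> R by rewrite ler_pdivrMr// mul1r ler_nat.
have L1 : L / (L + 1) < 1 by rewrite ltr_pdivrMr; lra.
rewrite (_ : L * (n%:R * c) = d * ((L / (L + 1)) * (n%:R / n.+1%:R))); last first.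
  by rewrite /c; field; rewrite ?gt_eqF//; lra.
rewrite gtr_pMr//; apply: le_lt_trans L1.
by rewrite ler_piMr// divr_ge0//; lra.
Unshelve. all: by end_near. Qed.

Lemma Ck_convolve k (c : R) a : Ck k (fun x => c * convolve (bump_kernel a) x).
Proof.
have cont c' a' : continuous (fun x => c' * convolve (bump_kernel a') x).
  move=> x; apply: (@continuousM R V (cst c') (convolve (bump_kernel a')) x).
    exact: cst_continuous.
  exact: continuous_convolve.
elim: k c a => [|k IHk] c a; first by split.
split => // i.
have D x : is_derive x (delta_mx ord0 i : V) (fun x => c * convolve (bump_kernel a) x)
    (- c * convolve (bump_kernel (bump_index a i)) x).
  apply: (is_derive_eq (is_deriveZ c (convolve_is_derive a i x))).
  by rewrite [_ *: _]mulrN mulNr.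
split; first by move=> x; have := D x; case.
rewrite (_ : (fun x => _) = fun x => - c * convolve (bump_kernel (bump_index a i)) x) //.
by apply/funext => x; have Dx := D x; rewrite derive_val.
Qed.

End convolution.

(** * The Gagliardo energy *)

Section powR_facts.
Context {R : realType} (p : R).
Hypothesis p0 : 0 <= p.

Lemma le_powR_norm (a b : R) : `|a| <= `|b| -> `|a| `^ p <= `|b| `^ p.
Proof. by move=> ab; apply: ge0_ler_powR; rewrite ?nnegrE ?normr_ge0. Qed.

Lemma powR_normD (a b : R) : `|a + b| `^ p <= 2 `^ p * (`|a| `^ p + `|b| `^ p).
Proof.
wlog ab : a b / `|a| <= `|b|.
  move=> H; have [/H//|/ltW ba] := leP `|a| `|b|.
  by rewrite addrC [X in _ * X]addrC; exact: H.
apply: (@le_trans _ _ ((2 * `|b|) `^ p)).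
  apply: ge0_ler_powR; rewrite ?nnegrE ?normr_ge0 ?mulr_ge0 ?normr_ge0//.
  by apply: (le_trans (ler_normD _ _)); lra.
by rewrite powRM ?normr_ge0// ler_wpM2l ?powR_ge0// lerDr powR_ge0.
Qed.

Lemma maxr_dist_powR (a b c d : R) :
  `|Num.max a b - Num.max c d| `^ p <= `|a - c| `^ p + `|b - d| `^ p.
Proof.
have H (x y z : R) : (`|x| <= `|y|) || (`|x| <= `|z|) -> `|x| `^ p <= `|y| `^ p + `|z| `^ p.
  case/orP => /le_powR_norm h; apply: (le_trans h); by rewrite ?lerDl ?lerDr powR_ge0.
apply: H.
have := ler_norm (a - c); have := ler_norm (b - d).
have := ler_norm (c - a); have := ler_norm (d - b).
rewrite (distrC c a) (distrC d b) => h1 h2 h3 h4.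
have [ab|ba] := leP a b; have [cd|dc] := leP c d; apply/orP.
- by right.
- have [bc|cb] := leP b c; [left|right]; rewrite ler_norml; apply/andP; split; lra.
- have [ad|da] := leP a d; [right|left]; rewrite ler_norml; apply/andP; split; lra.
- by left.
Qed.

Hypothesis p1 : 1 <= p.

(** When the order of the two pairs is crossed, the gaps on the left have the
   same sum as those on the right and lie between them; convexity of the power
   function concludes. *)
Lemma maxr_minr_dist_powR (a b c d : R) :
  `|Num.max a b - Num.max c d| `^ p + `|Num.min a b - Num.min c d| `^ p <=
  `|a - c| `^ p + `|b - d| `^ p.
Proof.
have conv (t : R) : 0 <= t -> t <= 1 -> forall x y : R,
    `|t * x + (1 - t) * y| `^ p <= t * `|x| `^ p + (1 - t) * `|y| `^ p.
  move=> t0 t1 x y.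
  apply: (@le_trans _ _ ((t * `|x| + (1 - t) * `|y|) `^ p)).
    apply: ge0_ler_powR; rewrite ?nnegrE ?normr_ge0//.
      by rewrite addr_ge0 ?mulr_ge0 ?normr_ge0 ?subr_ge0.
    apply: (le_trans (ler_normD _ _)); rewrite !normrM (ger0_norm t0).
    by rewrite (ger0_norm (_ : 0 <= 1 - t)) ?subr_ge0.
  have t01 : t \in `[0, 1] by rewrite in_itv/= t0 t1.
  pose tt := @Itv01 R t t0 t1.
  have := @convex_powR R p p1 tt `|x| `|y|.
  rewrite !inE/= !in_itv/= !andbT !normr_ge0 => /(_ isT isT).
  by rewrite !convRE.
wlog ab : a b c d / a <= b => [H|].
  have [ab|/ltW ba] := leP a b.
    by have := H a b c d ab; rewrite (max_r ab) (min_l ab).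
  have := H b a d c ba; rewrite (max_r ba) (min_l ba) (maxC d) (minC d).
  by rewrite [X in _ <= X]addrC.
rewrite (max_r ab) (min_l ab).
have [cd|dc] := leP c d; first by rewrite addrC.
(* b - c and a - d lie between a - c and b - d and have the same sum *)
have [E|NE] := eqVneq (b - d) (a - c).
  have -> : b = a by lra.
  by have : c = d; lra.
have lt0 : 0 < (b - d) - (a - c) by rewrite lt_neqAle eq_sym subr_eq0 NE/=; lra.
pose t := ((b - c) - (a - c)) / ((b - d) - (a - c)).
have t0 : 0 <= t by rewrite divr_ge0//; lra.
have t1 : t <= 1 by rewrite ler_pdivrMr// mul1r; lra.
have tE : t * ((b - d) - (a - c)) = (b - c) - (a - c).
  by rewrite /t divfK// gt_eqF.
have h1 := conv t t0 t1 (b - d) (a - c).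
have h2 := conv t t0 t1 (a - c) (b - d).
have e1 : t * (b - d) + (1 - t) * (a - c) = b - c.
  by rewrite (_ : t * (b - d) + _ = t * ((b - d) - (a - c)) + (a - c)); [rewrite tE; ring|ring].
have e2 : t * (a - c) + (1 - t) * (b - d) = a - d.
  by rewrite (_ : t * (a - c) + _ = (b - d) - t * ((b - d) - (a - c))); [rewrite tE; ring|ring].
rewrite e1 in h1; rewrite e2 in h2.
apply: (le_trans (lerD h1 h2)).
by apply: le_of_eq; ring.
Qed.

End powR_facts.

Section integral_inequalities.
Context d (T : measurableType d) (R : realType) (m : {measure set T -> \bar R}).
Variables (D : set T) (mD : measurable D).
Implicit Types f g h : T -> R.

Lemma ge0_integral_le_comb f g h (a b : R) : 0 <= a -> 0 <= b ->
  (forall x, 0 <= f x) -> (forall x, 0 <= g x) -> (forall x, 0 <= h x) ->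
  measurable_fun D f -> measurable_fun D g -> measurable_fun D h ->
  (forall x, D x -> f x <= a * g x + b * h x) ->
  (\int[m]_(x in D) (f x)%:E <=
   a%:E * \int[m]_(x in D) (g x)%:E + b%:E * \int[m]_(x in D) (h x)%:E)%E.
Proof.
move=> a0 b0 f0 g0 h0 mf mg mh H.
have mE k : measurable_fun D k -> measurable_fun D (EFin \o k) by move=> ?; exact/measurable_EFinP.
have mE' k (c : R) : measurable_fun D k -> measurable_fun D (fun x => c%:E * (k x)%:E)%E.
  by move=> mk; apply: emeasurable_funM; [exact: measurable_cst | exact: mE].
rewrite -ge0_integralZl; [|exact: mD|exact: mE|by move=> *; rewrite lee_fin|by rewrite lee_fin].
rewrite -ge0_integralZl; [|exact: mD|exact: mE|by move=> *; rewrite lee_fin|by rewrite lee_fin].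
rewrite -ge0_integralD; [|exact: mD|by move=> *; rewrite lee_fin mulr_ge0|exact: mE'|
  by move=> *; rewrite lee_fin mulr_ge0|exact: mE'].
apply: ge0_le_integral.
- exact: mD.
- by move=> *; rewrite lee_fin.
- exact: mE.
- by apply: emeasurable_funD; exact: mE'.
- by move=> x Dx; rewrite -!EFinM -EFinD lee_fin; exact: H.
Qed.

Lemma ge0_integral_le_add f g h (k : T -> R) :
  (forall x, 0 <= f x) -> (forall x, 0 <= g x) -> (forall x, 0 <= h x) -> (forall x, 0 <= k x) ->
  measurable_fun D f -> measurable_fun D g -> measurable_fun D h -> measurable_fun D k ->
  (forall x, D x -> f x + g x <= h x + k x) ->
  (\int[m]_(x in D) (f x)%:E + \int[m]_(x in D) (g x)%:E <=
   \int[m]_(x in D) (h x)%:E + \int[m]_(x in D) (k x)%:E)%E.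
Proof.
move=> f0 g0 h0 k0 mf mg mh mk H.
have mE l : measurable_fun D l -> measurable_fun D (EFin \o l) by move=> ?; exact/measurable_EFinP.
rewrite -ge0_integralD; [|exact: mD|by move=> *; rewrite lee_fin|exact: mE|
  by move=> *; rewrite lee_fin|exact: mE].
rewrite -ge0_integralD; [|exact: mD|by move=> *; rewrite lee_fin|exact: mE|
  by move=> *; rewrite lee_fin|exact: mE].
apply: ge0_le_integral.
- exact: mD.
- by move=> *; rewrite -EFinD lee_fin addr_ge0.
- by apply: emeasurable_funD; exact: mE.
- by apply: emeasurable_funD; exact: mE.
- by move=> x Dx; rewrite -!EFinD lee_fin; exact: H.
Qed.

End integral_inequalities.

(** Sealed, so that comparing the energies of two functions never unfolds the
    integrals. *)
HB.lock Definition energy {R : realType} {n : nat} (s p : R) (Om : set 'rV[R]_n)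
  (u : 'rV[R]_n -> R) : \bar R := gagliardo s p Om u.

HB.lock Definition lp_mass {R : realType} {n : nat} (p : R) (Om : set 'rV[R]_n)
  (u : 'rV[R]_n -> R) : \bar R := (\int[@lebesgue_rV R n]_(x in Om) (`|u x| `^ p)%:E)%E.

Lemma energy_gagliardo {R : realType} {n : nat} (s p : R) (Om : set 'rV[R]_n) u :
  energy s p Om u = gagliardo s p Om u.
Proof. by rewrite unlock. Qed.

Lemma lp_massE {R : realType} {n : nat} (p : R) (Om : set 'rV[R]_n) u :
  lp_mass p Om u = (\int[@lebesgue_rV R n]_(x in Om) (`|u x| `^ p)%:E)%E.
Proof. by rewrite unlock. Qed.

Section energy.
Context {R : realType} {n : nat}.
Local Notation mu := (@lebesgue_rV R n).
Local Notation V := 'rV[R]_n.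
Local Notation T := (Rn R n).
Local Notation mu2 := (mu \x mu)%E.
Variables (s p : R).
Hypothesis p1 : 1 < p.
Hypothesis s0 : 0 < s.
Implicit Types (u v : T -> R) (B : set T).

Let p0 : 0 < p. Proof. exact: lt_trans ltr01 p1. Qed.
Let p0' : 0 <= p. Proof. exact: ltW p0. Qed.

Definition energy_density u (z : T * T) : R :=
  `|u z.1 - u z.2| `^ p / edist z.1 z.2 `^ (n%:R + s * p).

Lemma energy_density_ge0 u z : 0 <= energy_density u z.
Proof. by rewrite divr_ge0 ?powR_ge0. Qed.

Lemma measurable_energy_density u : measurable_fun setT u ->
  measurable_fun setT (energy_density u).
Proof.
move=> mfu; apply: measurable_funM.
  apply: (measurableT_comp (measurable_powR _)).
  apply: (measurableT_comp (@normr_measurable R setT)).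
  by apply: measurable_funB; [exact: (measurableT_comp mfu) | exact: (measurableT_comp mfu)].
apply: measurable_funV_ge0; first by move=> z; rewrite powR_ge0.
by apply: (measurableT_comp (measurable_powR _)); exact: measurable_edist2.
Qed.

Lemma iterated_integral_restrict (F : T * T -> \bar R) A B :
  measurable A -> measurable B ->
  measurable_fun setT F -> (forall z, 0 <= F z)%E ->
  (\int[mu]_(x in A) \int[mu]_(y in B) F (x, y) = \int[mu2]_(z in A `*` B) F z)%E.
Proof.
move=> mA mB mF F0.
have mAB : measurable (A `*` B) by exact: measurableX.
rewrite [RHS]integral_mkcond fubini_tonelli1.
- rewrite [LHS]integral_mkcond; apply: eq_integral => x _.
  rewrite /fubini_F patchE; case: ifPn => xA.
    rewrite [LHS]integral_mkcond; apply: eq_integral => y _.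
    rewrite !patchE; have [yB|yB] := boolP (y \in B).
      by rewrite mem_set//; split; exact: set_mem.
    by rewrite ifF//; apply/negbTE; apply: contra yB => /set_mem[_ /mem_set].
  rewrite integral0_eq// => y _; rewrite patchE ifF//; apply/negbTE.
  by apply: contra xA => /set_mem[/mem_set].
- by apply/(measurable_restrictT _ _).1 => //; exact: measurable_funTS.
- by move=> z; rewrite patchE; case: ifP.
Qed.

Lemma energyE B u : measurable B -> measurable_fun setT u ->
  energy s p B u = (\int[mu2]_(z in B `*` B) (energy_density u z)%:E)%E.
Proof.
move=> mB mfu; rewrite unlock -(iterated_integral_restrict (EFin \o energy_density u) _ _ mB mB)//.
  by apply/measurable_EFinP; exact: measurable_energy_density.
by move=> z; rewrite lee_fin energy_density_ge0.
Qed.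

Lemma energy_ge0 B u : (0 <= energy s p B u)%E.
Proof.
rewrite unlock; apply: integral_ge0 => x _; apply: integral_ge0 => y _.
by rewrite lee_fin divr_ge0 ?powR_ge0.
Qed.

Lemma eq_energy B u v : {in B, u =1 v} -> energy s p B u = energy s p B v.
Proof.
move=> uv; rewrite unlock; apply: eq_integral => x xB; apply: eq_integral => y yB.
by rewrite !uv.
Qed.

Lemma le_energy2 B u (a : R) v (b : R) (w : T -> R) : measurable B ->
  0 <= a -> 0 <= b ->
  measurable_fun setT u -> measurable_fun setT v -> measurable_fun setT w ->
  (forall x y, B x -> B y ->
     `|u x - u y| `^ p <= a * `|v x - v y| `^ p + b * `|w x - w y| `^ p) ->
  (energy s p B u <= a%:E * energy s p B v + b%:E * energy s p B w)%E.
Proof.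
move=> mB a0 b0 mfu mfv mfw H.
rewrite (energyE B u mB mfu) (energyE B v mB mfv) (energyE B w mB mfw).
apply: ge0_integral_le_comb.
- exact: measurableX.
- exact: a0.
- exact: b0.
- exact: energy_density_ge0.
- exact: energy_density_ge0.
- exact: energy_density_ge0.
- by apply: measurable_funTS; exact: measurable_energy_density.
- by apply: measurable_funTS; exact: measurable_energy_density.
- by apply: measurable_funTS; exact: measurable_energy_density.
move=> [x y] [Bx By]; rewrite /energy_density/=.
by rewrite !mulrA -mulrDl ler_wpM2r ?invr_ge0 ?powR_ge0//; exact: H.
Qed.

Lemma le_energy B u v : measurable B ->
  measurable_fun setT u -> measurable_fun setT v ->
  (forall x y, B x -> B y -> `|u x - u y| <= `|v x - v y|) ->
  (energy s p B u <= energy s p B v)%E.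
Proof.
move=> mB mfu mfv H.
have := le_energy2 B u 1 v 0 v mB ler01 (lexx _) mfu mfv mfv.
rewrite mul1e mul0e adde0; apply => x y Bx By.
by rewrite mul1r mul0r addr0 le_powR_norm// H.
Qed.

Lemma energy_affine B u (a b : R) : measurable B -> measurable_fun setT u ->
  (energy s p B (fun x => (a * u x + b)%R) <= (`|a| `^ p)%:E * energy s p B u)%E.
Proof.
move=> mB mfu.
have mau : measurable_fun setT (fun x => a * u x + b).
  by apply: measurable_funD; [apply: measurable_funM|]; by [exact: mfu|exact: measurable_cst].
have := le_energy2 B (fun x => a * u x + b) (`|a| `^ p) u 0 u mB (powR_ge0 _ _) (lexx _) mau mfu mfu.
rewrite mul0e adde0; apply => x y Bx By.
rewrite mul0r addr0 opprD addrACA subrr addr0 -mulrBr normrM powRM ?normr_ge0//.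
Qed.

Lemma energy_maxr B u v : measurable B ->
  measurable_fun setT u -> measurable_fun setT v ->
  (energy s p B (fun x => Num.max (u x) (v x)) <= energy s p B u + energy s p B v)%E.
Proof.
move=> mB mfu mfv.
have H := le_energy2 B (fun x => Num.max (u x) (v x)) 1 u 1 v mB ler01 ler01
  (measurable_maxr mfu mfv) mfu mfv.
apply: (le_trans (H _)).
  by move=> x y _ _; rewrite mul1r mul1r; exact: maxr_dist_powR.
by rewrite mul1e mul1e.
Qed.

Lemma energyD B u v : measurable B ->
  measurable_fun setT u -> measurable_fun setT v ->
  (energy s p B (fun x => (u x + v x)%R) <=
   (2 `^ p)%:E * (energy s p B u + energy s p B v))%E.
Proof.
move=> mB mfu mfv.
have H := le_energy2 B (fun x => u x + v x) (2 `^ p) u (2 `^ p) v mB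
  (powR_ge0 _ _) (powR_ge0 _ _) (measurable_funD mfu mfv) mfu mfv.
apply: (le_trans (H _)).
  by move=> x y _ _; rewrite opprD addrACA -mulrDr; exact: powR_normD.
by rewrite ge0_muleDr; [exact: lexx|exact: energy_ge0|exact: energy_ge0].
Qed.

Lemma energy_strong_subadditive B u v : measurable B ->
  measurable_fun setT u -> measurable_fun setT v ->
  (energy s p B (fun x => Num.max (u x) (v x)) +
   energy s p B (fun x => Num.min (u x) (v x)) <=
   energy s p B u + energy s p B v)%E.
Proof.
move=> mB mfu mfv.
rewrite (energyE B (fun x => Num.max (u x) (v x)) mB (measurable_maxr mfu mfv)).
rewrite (energyE B (fun x => Num.min (u x) (v x)) mB (measurable_minr mfu mfv)).
rewrite (energyE B u mB mfu) (energyE B v mB mfv).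
have mM := measurable_maxr mfu mfv; have mm := measurable_minr mfu mfv.
apply: ge0_integral_le_add.
- exact: measurableX.
- exact: energy_density_ge0.
- exact: energy_density_ge0.
- exact: energy_density_ge0.
- exact: energy_density_ge0.
- by apply: measurable_funTS; exact: measurable_energy_density.
- by apply: measurable_funTS; exact: measurable_energy_density.
- by apply: measurable_funTS; exact: measurable_energy_density.
- by apply: measurable_funTS; exact: measurable_energy_density.
move=> [x y] _; rewrite /energy_density/=.
by rewrite -!mulrDl ler_wpM2r ?invr_ge0 ?powR_ge0// maxr_minr_dist_powR// ltW.
Qed.

End energy.

(** * Cutoffs and the Poincare inequality *)

Lemma measurable_powR_norm {d} {T : measurableType d} {R : realType} (p : R)
    (D : set T) (f : T -> R) : measurable_fun D f ->
  measurable_fun D (fun x => `|f x| `^ p).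
Proof.
move=> mf; apply: (measurableT_comp (measurable_powR _)).
exact: (measurableT_comp (@normr_measurable R setT)).
Qed.

Section lp_mass_facts.
Context {R : realType} {n : nat}.
Local Notation mu := (@lebesgue_rV R n).
Local Notation T := (Rn R n).
Variable p : R.
Hypothesis p1 : 1 < p.
Implicit Types (u v : T -> R) (B : set T).

Let p0' : 0 <= p. Proof. exact: ltW (lt_trans ltr01 p1). Qed.

Lemma lp_mass_ge0 B u : (0 <= lp_mass p B u)%E.
Proof. by rewrite unlock; apply: integral_ge0 => x _; rewrite lee_fin powR_ge0. Qed.

Lemma eq_lp_mass B u v : {in B, u =1 v} -> lp_mass p B u = lp_mass p B v.
Proof. by move=> uv; rewrite unlock; apply: eq_integral => x xB; rewrite uv. Qed.

Lemma le_lp_mass2 B u (a : R) v (b : R) (w : T -> R) : measurable B ->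
  0 <= a -> 0 <= b ->
  measurable_fun B u -> measurable_fun B v -> measurable_fun B w ->
  (forall x, B x -> `|u x| `^ p <= a * `|v x| `^ p + b * `|w x| `^ p) ->
  (lp_mass p B u <= a%:E * lp_mass p B v + b%:E * lp_mass p B w)%E.
Proof.
move=> mB a0 b0 mfu mfv mfw H; rewrite unlock; apply: ge0_integral_le_comb.
- exact: mB.
- exact: a0.
- exact: b0.
- by move=> x; exact: powR_ge0.
- by move=> x; exact: powR_ge0.
- by move=> x; exact: powR_ge0.
- exact: measurable_powR_norm.
- exact: measurable_powR_norm.
- exact: measurable_powR_norm.
- exact: H.
Qed.

Lemma le_lp_mass B u v : measurable B -> measurable_fun B u -> measurable_fun B v ->
  (forall x, B x -> `|u x| <= `|v x|) -> (lp_mass p B u <= lp_mass p B v)%E.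
Proof.
move=> mB mfu mfv H.
have H2 := le_lp_mass2 B u 1 v 0 v mB ler01 (lexx _) mfu mfv mfv.
apply: (le_trans (H2 _)).
  by move=> x Bx; rewrite mul1r mul0r addr0 le_powR_norm// H.
by rewrite mul1e mul0e adde0.
Qed.

Lemma lp_mass_maxr B u v : measurable B -> measurable_fun B u -> measurable_fun B v ->
  (lp_mass p B (fun x => Num.max (u x) (v x)) <= lp_mass p B u + lp_mass p B v)%E.
Proof.
move=> mB mfu mfv.
have H2 := le_lp_mass2 B (fun x => Num.max (u x) (v x)) 1 u 1 v mB ler01 ler01
  (measurable_maxr mfu mfv) mfu mfv.
apply: (le_trans (H2 _)); last by rewrite mul1e mul1e.
move=> x _; rewrite mul1r mul1r.
have [_|_] := leP (u x) (v x); first by rewrite lerDr powR_ge0.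
by rewrite lerDl powR_ge0.
Qed.

Lemma lp_mass_affine_le B u (a : R) : measurable B -> measurable_fun B u ->
  (lp_mass p B (fun x => (a * u x)%R) <= (`|a| `^ p)%:E * lp_mass p B u)%E.
Proof.
move=> mB mfu.
have mau : measurable_fun B (fun x => a * u x).
  by apply: measurable_funM; [exact: measurable_cst | exact: mfu].
have H2 := le_lp_mass2 B (fun x => a * u x) (`|a| `^ p) u 0 u mB (powR_ge0 _ _) (lexx _) mau mfu mfu.
apply: (le_trans (H2 _)); last by rewrite mul0e adde0.
by move=> x _; rewrite mul0r addr0 normrM powRM ?normr_ge0.
Qed.

Lemma lp_mass_cst B (c : R) : measurable B ->
  lp_mass p B (fun=> c) = ((`|c| `^ p)%:E * mu B)%E.
Proof. by move=> mB; rewrite unlock integral_cst. Qed.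

Lemma lp_mass_le_comb (q t : R) B u v (a b : R) : measurable B -> 0 <= a -> 0 <= b ->
  measurable_fun B u -> measurable_fun B v ->
  (forall x, B x -> `|u x| `^ q <= a * `|v x| `^ t + b) ->
  (lp_mass q B u <= a%:E * lp_mass t B v + b%:E * mu B)%E.
Proof.
move=> mB a0 b0 mfu mfv uv; rewrite !lp_massE.
rewrite (_ : mu B = (\int[mu]_(x in B) (1%R)%:E)%E); last first.
  by rewrite integral_cst// mul1e.
have H := @ge0_integral_le_comb _ _ _ mu B mB (fun x => `|u x| `^ q)
  (fun x => `|v x| `^ t) (fun=> 1) _ _ a0 b0; apply: H.
- by move=> x; exact: powR_ge0.
- by move=> x; exact: powR_ge0.
- by move=> x; exact: ler01.
- exact: measurable_powR_norm.
- exact: measurable_powR_norm.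
- exact: measurable_cst.
- by move=> x Bx; rewrite mulr1; exact: uv.
Qed.

Lemma lp_massD B u v : measurable B -> measurable_fun B u -> measurable_fun B v ->
  (lp_mass p B (fun x => (u x + v x)%R) <=
   (2 `^ p)%:E * (lp_mass p B u + lp_mass p B v))%E.
Proof.
move=> mB mfu mfv.
have H2 := le_lp_mass2 B (fun x => u x + v x) (2 `^ p) u (2 `^ p) v mB
  (powR_ge0 _ _) (powR_ge0 _ _) (measurable_funD mfu mfv) mfu mfv.
apply: (le_trans (H2 _)).
  by move=> x _; rewrite -mulrDr; exact: powR_normD.
by rewrite ge0_muleDr; [exact: lexx|exact: lp_mass_ge0|exact: lp_mass_ge0].
Qed.

End lp_mass_facts.

Section cutoff.
Context {R : realType} {n : nat}.
Local Notation mu := (@lebesgue_rV R n).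
Local Notation T := (Rn R n).
Implicit Types (u v : T -> R) (B : set T).

Lemma measurable_inner_integral (F : T * T -> \bar R) B :
  measurable B -> measurable_fun setT F -> (forall z, 0 <= F z)%E ->
  measurable_fun setT (fun x => \int[mu]_(y in B) F (x, y))%E.
Proof.
move=> mB mF F0.
pose F' : T * T -> \bar R := F \_ (setT `*` B).
have mTB : measurable ([set: T] `*` B) by exact: measurableX.
have mF' : measurable_fun setT F'.
  by apply/(measurable_restrictT _ _).1 => //; exact: measurable_funTS.
have F'0 z : (0 <= F' z)%E by rewrite /F' patchE; case: ifP.
rewrite (_ : (fun x => _) = fubini_F mu F').
  exact: measurable_fun_fubini_tonelli_F.
apply/funext => x; rewrite /fubini_F [LHS]integral_mkcond; apply: eq_integral => y _.
rewrite /F' !patchE; have [yB|yB] := boolP (y \in B).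
  by rewrite mem_set//; split => //; exact: set_mem.
by rewrite ifF//; apply/negbTE; apply: contra yB => /set_mem[_ /mem_set].
Qed.

(** The radii [5/8 r] and [3/4 r] leave room on both sides: the half ball lies
   well inside the region where the cutoff is [1], and its support lies well
   inside the ball. *)
Definition cutoff (x0 : 'rV[R]_n) (r : R) (x : T) : R :=
  Num.max 0 (Num.min 1 (6 - 8 / r * edist x x0)).

Variables (x0 : 'rV[R]_n) (r : R).
Hypothesis r0 : 0 < r.
Local Notation eta := (cutoff x0 r).

Lemma cutoff_ge0 x : 0 <= eta x. Proof. by rewrite le_max lexx. Qed.

Lemma cutoff_le1 x : eta x <= 1.
Proof. by rewrite ge_max ler01 ge_min lexx. Qed.

Lemma cutoff_eq1 x : edist x x0 <= 5 / 8 * r -> eta x = 1.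
Proof.
move=> xr; have h : 8 / r * edist x x0 <= 5.
  by rewrite mulrAC ler_pdivrMr// mulrC; lra.
by rewrite /cutoff min_l ?max_r//; lra.
Qed.

Lemma cutoff_eq0 x : 3 / 4 * r <= edist x x0 -> eta x = 0.
Proof.
move=> xr; have h : 6 <= 8 / r * edist x x0.
  by rewrite mulrAC ler_pdivlMr// mulrC; lra.
by rewrite /cutoff max_l// ge_min; apply/orP; right; lra.
Qed.

Lemma cutoff_lipschitz x y : `|eta x - eta y| <= 8 / r * edist x y.
Proof.
have clampP (a : R) : [\/ a <= 0 /\ Num.max 0 (Num.min 1 a) = 0,
    [/\ 0 <= a, a <= 1 & Num.max 0 (Num.min 1 a) = a] |
    1 <= a /\ Num.max 0 (Num.min 1 a) = 1].
  have [a1|a1] := leP 1 a; first by constructor 3; split => //; rewrite max_r.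
  have [a0|a0] := leP 0 a; first by constructor 2; split => //; exact: ltW.
  by constructor 1; split => //; exact: ltW.
have clampl (a b : R) : `|Num.max 0 (Num.min 1 a) - Num.max 0 (Num.min 1 b)| <= `|a - b|.
  have h1 := ler_norm (a - b); have h2 := ler_norm (b - a); rewrite (distrC b a) in h2.
  have h3 := normr_ge0 (a - b).
  case: (clampP a) => [[h4 ->]|[h4 h4' ->]|[h4 ->]];
  case: (clampP b) => [[h5 ->]|[h5 h5' ->]|[h5 ->]];
  by rewrite ler_norml; apply/andP; split; lra.
apply: (le_trans (clampl _ _)).
rewrite opprD addrACA subrr add0r opprK addrC -mulrBr normrM.
rewrite ger0_norm ?divr_ge0 ?(ltW r0)// ler_wpM2l ?divr_ge0 ?(ltW r0)//.
have := euclid_triangle y x x0; have := euclid_triangle x y x0; rewrite (euclid_sym y x).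
by move=> ? ?; rewrite ler_norml; apply/andP; split; lra.
Qed.

Lemma measurable_cutoff : measurable_fun setT eta.
Proof.
apply: measurable_maxr; first exact: measurable_cst.
apply: measurable_minr; first exact: measurable_cst.
apply: measurable_funB; first exact: measurable_cst.
by apply: measurable_funM; [exact: measurable_cst | exact: measurable_edist].
Qed.

End cutoff.

Section cutoff_poincare.
Context {R : realType} {n : nat}.
Local Notation mu := (@lebesgue_rV R n).
Local Notation T := (Rn R n).
Variables (s p : R).
Hypotheses (n0 : (0 < n)%N) (s0 : 0 < s) (s1 : s < 1) (p1 : 1 < p).
Implicit Types (u v : T -> R) (B : set T).

Let p0 : 0 < p. Proof. exact: lt_trans ltr01 p1. Qed.
Let nsp0 : 0 < n%:R + s * p. Proof. by rewrite ltr_wpDl// mulr_gt0. Qed.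

Lemma cutoff_kernel (d : R) : 0 <= d ->
  d `^ p / d `^ (n%:R + s * p) = d `^ (p - s * p) / d ^+ n.
Proof.
rewrite le_eqVlt => /predU1P[<-|d0].
  have h : p - s * p != 0 by rewrite gt_eqF// subr_gt0 gtr_pMl.
  have h1 : p != 0 by rewrite gt_eqF.
  have h2 : n%:R + s * p != 0 by rewrite gt_eqF.
  by rewrite (powR0 h) (powR0 h1) (powR0 h2) !mul0r.
have -> : d `^ (n%:R + s * p) = d ^+ n * d `^ (s * p).
  by rewrite powRD ?(gt_eqF d0) ?implybT// powR_mulrn// ltW.
have -> : d `^ p = d `^ (p - s * p) * d `^ (s * p).
  by rewrite -powRD ?(gt_eqF d0) ?implybT//; congr (_ `^ _); ring.
have h1 : d ^+ n != 0 by rewrite expf_neq0 ?gt_eqF.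
have h2 : d `^ (s * p) != 0 by rewrite gt_eqF ?powR_gt0.
by field; rewrite h1 h2.
Qed.

(** By the product rule only the increments of the cutoff need care. They are
   at most [8 / r] times the distance, so that the kernel becomes [d^(p - sp -
   n)], which is integrable because [s < 1]. *)
Lemma energy_cutoff : exists2 C : R, 0 < C & forall x0 r, 0 < r ->
  forall g : T -> R, measurable_fun setT g ->
  (energy s p (eball x0 r) (fun x => (cutoff x0 r x * g x)%R) <=
   C%:E * (energy s p (eball x0 r) g + (r `^ (- (s * p)))%:E * lp_mass p (eball x0 r) g))%E.
Proof.
have al0 : 0 < p - s * p by rewrite subr_gt0 gtr_pMl.
have [K K0 HK] := @integral_kernel_ball R n n0 (p - s * p) al0.
pose C1 := 8 `^ p * K * 2 `^ (p - s * p).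
have C10 : 0 < C1 by rewrite !mulr_gt0 ?powR_gt0.
exists (2 `^ p * (1 + C1)); first by rewrite mulr_gt0 ?powR_gt0// addr_gt0.
move=> x0 r r0 g mg; pose B : set T := eball x0 r; rewrite -/B.
have mB : measurable B by exact: measurable_eball.
have meta := measurable_cutoff x0 r.
pose G (z : T * T) : R := `|g z.1| `^ p *
  (`|cutoff x0 r z.1 - cutoff x0 r z.2| `^ p / edist z.1 z.2 `^ (n%:R + s * p)).
have G0 z : 0 <= G z by rewrite mulr_ge0 ?divr_ge0 ?powR_ge0.
have mG : measurable_fun setT G.
  apply: measurable_funM.
    by apply: measurable_powR_norm; exact: (measurableT_comp mg).
  exact: (measurable_energy_density s p _ meta).
have mgeta : measurable_fun setT (fun x => cutoff x0 r x * g x) by exact: measurable_funM.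
have step1 : (energy s p B (fun x => (cutoff x0 r x * g x)%R) <=
   (2 `^ p)%:E * energy s p B g + (2 `^ p)%:E * \int[(mu \x mu)%E]_(z in B `*` B) (G z)%:E)%E.
  rewrite (energyE s p B _ mB mgeta) (energyE s p B _ mB mg).
  apply: ge0_integral_le_comb.
  - exact: measurableX.
  - exact: powR_ge0.
  - exact: powR_ge0.
  - exact: energy_density_ge0.
  - exact: energy_density_ge0.
  - exact: G0.
  - by apply: measurable_funTS; exact: measurable_energy_density.
  - by apply: measurable_funTS; exact: measurable_energy_density.
  - by apply: measurable_funTS.
  move=> [x y] _; rewrite /energy_density /G/= mulrA (mulrA (`|g x| `^ p)) (mulrA (2 `^ p)) -mulrDl.
  rewrite ler_wpM2r ?invr_ge0 ?powR_ge0// -mulrDr.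
  rewrite (_ : cutoff x0 r x * g x - cutoff x0 r y * g y = cutoff x0 r y * (g x - g y) +
     g x * (cutoff x0 r x - cutoff x0 r y)); last ring.
  apply: (le_trans (powR_normD p (ltW p0) _ _)); rewrite ler_wpM2l ?powR_ge0//.
  rewrite !normrM !powRM ?normr_ge0// lerD2r ler_piMl ?powR_ge0//.
  have -> : (1 : R) = 1 `^ p by rewrite powR1.
  rewrite ger0_norm ?cutoff_ge0//.
  by apply: ge0_ler_powR; rewrite ?nnegrE ?cutoff_ge0 ?cutoff_le1// ltW.
have step2 : (\int[(mu \x mu)%E]_(z in B `*` B) (G z)%:E <=
    (C1 * r `^ (- (s * p)))%:E * lp_mass p B g)%E.
  have mEG : measurable_fun setT (EFin \o G) by exact/measurable_EFinP.
  have EG0 z : (0 <= (EFin \o G) z)%E by rewrite lee_fin.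
  have mgp : measurable_fun B (fun x => (`|g x| `^ p)%:E).
    by apply/measurable_EFinP; apply: measurable_powR_norm; exact: measurable_funTS.
  rewrite -(iterated_integral_restrict (EFin \o G) B B mB mB mEG EG0).
  rewrite (lp_massE p B g) -ge0_integralZl; first last.
  - by rewrite lee_fin mulr_ge0 ?powR_ge0 ?ltW.
  - by move=> x _; rewrite lee_fin powR_ge0.
  - exact: mgp.
  - exact: mB.
  apply: ge0_le_integral.
  - exact: mB.
  - by move=> x _; apply: integral_ge0 => y _; exact: EG0.
  - by apply: measurable_funTS; exact: (measurable_inner_integral (EFin \o G) B mB mEG EG0).
  - by apply: emeasurable_funM; [exact: measurable_cst | exact: mgp].
  move=> x Bx.
  have mker : measurable_fun setT (fun y : T => edist y x `^ (p - s * p) / edist y x ^+ n).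
    apply: measurable_funM.
      by apply: (measurableT_comp (measurable_powR _)); exact: measurable_edist.
    apply: measurable_funV_ge0; first by move=> y; rewrite exprn_ge0 ?euclid_ge0.
    by apply: measurable_funX; exact: measurable_edist.
  pose c := `|g x| `^ p * (8 / r) `^ p.
  have c0 : 0 <= c by rewrite mulr_ge0 ?powR_ge0.
  apply: (@le_trans _ _ (\int[mu]_(y in B) (c%:E * (edist y x `^ (p - s * p) / edist y x ^+ n)%:E))%E).
    apply: ge0_le_integral.
    - exact: mB.
    - by move=> y _; exact: EG0.
    - apply: measurable_funTS; apply: (measurableT_comp mEG); exact: measurable_pair1.
    - apply: emeasurable_funM; first exact: measurable_cst.
      by apply/measurable_EFinP; exact: measurable_funTS.
    move=> y By; rewrite -EFinM lee_fin /G/= /c -cutoff_kernel ?euclid_ge0// -!mulrA.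
    rewrite ler_wpM2l ?powR_ge0// mulrA euclid_sym.
    rewrite ler_wpM2r ?invr_ge0 ?powR_ge0// -powRM ?euclid_ge0 ?divr_ge0 ?(ltW r0)//.
    apply: ge0_ler_powR; rewrite ?nnegrE ?normr_ge0 ?mulr_ge0 ?invr_ge0 ?euclid_ge0 ?(ltW r0) ?(ltW p0)//.
    by rewrite euclid_sym; exact: cutoff_lipschitz.
  rewrite ge0_integralZl; first last.
  - by rewrite lee_fin.
  - by move=> y _; rewrite lee_fin divr_ge0 ?powR_ge0 ?exprn_ge0 ?euclid_ge0.
  - by apply/measurable_EFinP; exact: measurable_funTS.
  - exact: mB.
  apply: (@le_trans _ _ (c%:E * (K * (2 * r) `^ (p - s * p))%:E)%E).
    apply: lee_wpmul2l; first by rewrite lee_fin.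
    apply: le_trans (HK x (2 * r) _); last by rewrite mulr_gt0.
    apply: ge0_subset_integral.
    - exact: mB.
    - exact: measurable_eball.
    - by apply/measurable_EFinP; exact: measurable_funTS.
    - by move=> y _; rewrite lee_fin divr_ge0 ?powR_ge0 ?exprn_ge0 ?euclid_ge0.
    move=> y By; rewrite /eball/=; apply: (le_lt_trans (euclid_triangle x0 _ _)).
    by rewrite (euclid_sym x0); move: Bx By; rewrite /B /eball/=; lra.
  rewrite -!EFinM lee_fin /c /C1; apply: le_of_eq.
  rewrite !powRM ?invr_ge0 ?(ltW r0)//.
  have rn : r != 0 by rewrite gt_eqF.
  rewrite -[r^-1]powR_inv1 ?(ltW r0)// -powRrM mulN1r.
  have -> : r `^ (- (s * p)) = r `^ (- p) * r `^ (p - s * p).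
    by rewrite -powRD ?rn ?implybT//; congr (_ `^ _); ring.
  by ring.
apply: (le_trans step1).
have e0 := energy_ge0 s p B g; have l0 := lp_mass_ge0 p B g.
have G20 : (0 <= \int[(mu \x mu)%E]_(z in B `*` B) (G z)%:E)%E.
  by apply: integral_ge0 => z _; rewrite lee_fin.
move: step2 e0 l0 G20; move: (energy s p B g) (lp_mass p B g) (integral _ _ _) => a b c cb a0 b0 c0.
have p2 : (0 <= (2 `^ p)%:E :> \bar R)%E by rewrite lee_fin powR_ge0.
have X0 : (0 <= a + (r `^ (- (s * p)))%:E * b)%E.
  by rewrite adde_ge0// mule_ge0// lee_fin powR_ge0.
rewrite -ge0_muleDr// EFinM -muleA; apply: lee_wpmul2l => //.
apply: (le_trans (leeD2l a cb)).
rewrite EFinD ge0_muleDl ?lee_fin ?(ltW C10)// mul1e EFinM -muleA.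
apply: leeD; first by rewrite leeDl// mule_ge0// lee_fin powR_ge0.
by apply: lee_wpmul2l; [rewrite lee_fin ltW|rewrite leeDr].
Qed.

(** The constant is the value of [u] at a point whose inner energy integral is
   at most the average; the strict bound on the energy ensures that there is
   such a point. *)
Lemma poincare : exists2 C : R, 0 < C & forall x0 r (u : T -> R) (k : R), 0 < r ->
  measurable_fun setT u ->
  (energy s p (eball x0 r) u < k%:E)%E ->
  exists c : R, (lp_mass p (eball x0 r) (fun x => (u x - c)%R) <=
    (C * r `^ (s * p) * k)%:E)%E.
Proof.
exists (2 `^ (n%:R + s * p) * n%:R ^+ n).
  by rewrite mulr_gt0 ?powR_gt0// exprn_gt0// ltr0n.
move=> x0 r u k r0 mfu; pose B : set T := eball x0 r; rewrite -/B => Ek.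
have mB : measurable B by exact: measurable_eball.
pose F (z : T * T) : \bar R := (energy_density s p u z)%:E.
have mF : measurable_fun setT F.
  by apply/measurable_EFinP; exact: measurable_energy_density.
have F0 z : (0 <= F z)%E by rewrite lee_fin energy_density_ge0.
have k0 : 0 < k by rewrite -lte_fin; apply: le_lt_trans Ek; exact: energy_ge0.
pose b := (r / n%:R) ^+ n.
have nn : 0 < n%:R :> R by rewrite ltr0n.
have b0 : 0 < b by rewrite exprn_gt0// divr_gt0.
have bB : (b%:E <= mu B)%E by exact: eball_volume_ge.
have [x [Bx Ix]] : exists x, B x /\ (\int[mu]_(y in B) F (x, y) <= (k / b)%:E)%E.
  apply: contrapT => /forallNP H.
  have : (k%:E <= energy s p B u)%E.
    rewrite (energyE s p B u mB mfu) -(iterated_integral_restrict F B B mB mB mF F0).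
    apply: (@le_trans _ _ (\int[mu]_(x in B) (k / b)%:E)%E).
      rewrite integral_cst//; apply: (@le_trans _ _ ((k / b)%:E * b%:E)%E).
        by rewrite -EFinM divfK// gt_eqF.
      by apply: lee_wpmul2l => //; rewrite lee_fin divr_ge0 ?ltW.
    apply: ge0_le_integral.
    - exact: mB.
    - by move=> *; rewrite lee_fin divr_ge0 ?ltW.
    - exact: measurable_cst.
    - by apply: measurable_funTS; exact: (measurable_inner_integral F B mB mF F0).
    move=> x Bx; have /not_andP[//|/negP] := H x.
    by rewrite -ltNge => /ltW.
  by rewrite leNgt Ek.
exists (u x).
have mux : measurable_fun setT (fun y => u y - u x).
  by apply: measurable_funB; [exact: mfu|exact: measurable_cst].
rewrite lp_massE.
pose D := (2 * r) `^ (n%:R + s * p).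
have D0 : 0 <= D by exact: powR_ge0.
apply: (@le_trans _ _ (\int[mu]_(y in B) (D%:E * F (x, y)))%E).
  apply: ge0_le_integral.
  - exact: mB.
  - by move=> y _; rewrite lee_fin powR_ge0.
  - by apply/measurable_EFinP; apply: measurable_powR_norm; exact: measurable_funTS.
  - apply: emeasurable_funM; first exact: measurable_cst.
    by apply: measurable_funTS; apply: (measurableT_comp mF); exact: measurable_pair1.
  move=> y By; rewrite -EFinM lee_fin /energy_density/= distrC.
  have [->|xy] := eqVneq x y.
    by rewrite subrr normr0 powR0 ?gt_eqF// mul0r mulr0.
  have dxy : 0 < edist x y by rewrite edist_gt0.
  rewrite mulrCA ler_peMr ?powR_ge0// ler_pdivlMr ?powR_gt0// mul1r.
  apply: ge0_ler_powR; rewrite ?nnegrE ?euclid_ge0 ?mulr_ge0 ?(ltW r0) ?(ltW nsp0)//.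
  apply: (le_trans (euclid_triangle x0 _ _)).
  by rewrite (euclid_sym x0); move: Bx By; rewrite /B /eball/=; lra.
rewrite ge0_integralZl; first last.
- by rewrite lee_fin.
- by move=> *; exact: F0.
- by apply: measurable_funTS; apply: (measurableT_comp mF); exact: measurable_pair1.
- exact: mB.
apply: (@le_trans _ _ (D%:E * (k / b)%:E)%E); first by apply: lee_wpmul2l.
rewrite -EFinM lee_fin; apply: le_of_eq.
rewrite /D /b powRM ?(ltW r0)// expr_div_n.
rewrite [r `^ _]powRD ?(gt_eqF r0) ?implybT// powR_mulrn ?(ltW r0)//.
have h1 : r ^+ n != 0 by rewrite expf_neq0 ?gt_eqF.
have h2 : n%:R ^+ n != 0 :> R by rewrite expf_neq0 ?gt_eqF.
by field; rewrite h1 h2.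
Qed.

End cutoff_poincare.

(** * The Sobolev inequality on balls *)

Lemma integral_ge_cst_mul {d} {T : measurableType d} {R : realType}
    (m : {measure set T -> \bar R}) (D A : set T) (f : T -> R) (c : R) :
  measurable D -> measurable A -> A `<=` D -> 0 <= c -> measurable_fun D f ->
  (forall x, 0 <= f x) -> (forall x, A x -> c <= f x) ->
  (c%:E * m A <= \int[m]_(x in D) (f x)%:E)%E.
Proof.
move=> mD mA AD c0 mf f0 cf.
have mEf : measurable_fun D (EFin \o f) by exact/measurable_EFinP.
rewrite -integral_cst//.
apply: (@le_trans _ _ (\int[m]_(x in A) (f x)%:E)%E).
  apply: ge0_le_integral.
  - exact: mA.
  - by move=> x _; rewrite lee_fin.
  - exact: measurable_cst.
  - exact: measurable_funS mEf.
  - by move=> x Ax; rewrite lee_fin cf.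
apply: ge0_subset_integral.
- exact: mA.
- exact: mD.
- exact: mEf.
- by move=> x _; rewrite lee_fin.
- exact: AD.
Qed.

Lemma maxr_cst_dist {R : realFieldType} (a b c : R) :
  `|Num.max a c - Num.max b c| <= `|a - b|.
Proof.
have := ler_norm (a - b); have := ler_norm (b - a).
rewrite (distrC b) => h1 h2; have h3 := normr_ge0 (a - b).
by have [?|?] := leP a c; have [?|?] := leP b c;
  rewrite ler_norml; apply/andP; split; lra.
Qed.

Lemma minr_cst_dist {R : realFieldType} (a b c : R) :
  `|Num.min a c - Num.min b c| <= `|a - b|.
Proof.
have := maxr_cst_dist (- a) (- b) (- c).
by rewrite -!oppr_min -!opprD !normrN.
Qed.

Section sobolev_ball.
Context {R : realType} {n : nat}.
Local Notation mu := (@lebesgue_rV R n).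
Local Notation T := (Rn R n).
(* [a] is [1 - p / Q]; the hypothesis [asp] says that [Q] does not exceed the
   critical exponent *)
Variables (s p Q a : R).
Hypotheses (n0 : (0 < n)%N) (s0 : 0 < s) (p1 : 1 < p) (pQ : p < Q).
Hypotheses (aQ : a * Q = Q - p) (asp : a * n%:R <= s * p).

Let p0 : 0 < p. Proof. exact: lt_trans ltr01 p1. Qed.
Let Q0 : 0 < Q. Proof. exact: lt_trans p0 pQ. Qed.
Let a0 : 0 < a.
Proof. by rewrite -(pmulr_lgt0 a Q0) aQ subr_gt0. Qed.
Let a1 : a < 1.
Proof. by rewrite -(ltr_pM2r Q0) aQ mul1r gtrBl. Qed.
Let nn : 0 < n%:R :> R. Proof. by rewrite ltr0n. Qed.

(** The ball of radius [rho] about [x] meets the large ball in mass at least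
   [2 b], of which the complement of [A] takes at most [b]. *)
Lemma mass_near x0 r (x : T) (A : set T) (b rho : R) : 0 < r ->
  eball x0 r x -> measurable A -> 0 < rho -> (rho / 2 / n%:R) ^+ n = 2 * b ->
  ((2 * b)%:E <= mu (eball x0 r))%E -> (mu (eball x0 r `\` A) <= b%:E)%E ->
  (b%:E <= mu (eball x0 r `&` A `&` eball x rho))%E.
Proof.
move=> r0 Bx mA rho0 rhoE b2 Ab; pose B : set T := eball x0 r.
have mB : measurable B by exact: measurable_eball.
have mS : measurable (eball x rho : set T) by exact: measurable_eball.
have H : ((2 * b)%:E <= mu (B `&` eball x rho))%E.
  have [rr|rr] := leP rho (2 * r); first by rewrite -rhoE; exact: eball_density.
  rewrite setIidl// => y By; rewrite /eball/=.
  apply: (le_lt_trans (euclid_triangle x0 _ _)).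
  by rewrite (euclid_sym x0); move: Bx By; rewrite /B /eball/=; lra.
have sub : B `&` eball x rho `<=` (B `&` A `&` eball x rho) `|` (B `\` A).
  by move=> y [By Sy]; have [Ay|nAy] := pselect (A y); [left|right].
have : ((2 * b)%:E <= mu (B `&` A `&` eball x rho) + b%:E)%E.
  apply: (le_trans H); apply: (@le_trans _ _ (mu ((B `&` A `&` eball x rho) `|` (B `\` A)))).
    apply: le_measure; rewrite ?inE//; first exact: measurableI.
    by apply: measurableU; [apply: measurableI => //; exact: measurableI|exact: measurableD].
  apply: (le_trans (measureU2 _ _ _)).
  - by apply: measurableI => //; exact: measurableI.
  - exact: measurableD.
  - by rewrite leeD2l.
by rewrite mulr_natl mulr2n EFinD leeD2rE.
Qed.

(** The points [y] with [f y <= f x / 2] have mass at least [b] within a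
   distance [rho] of order [b^(1/n)] from [x], and each of them contributes at
   least [(f x / 2)^p] times the kernel at distance [rho]. *)
Lemma inner_energy_ge x0 r (f : T -> R) (x : T) (b N : R) : 0 < r -> eball x0 r x ->
  measurable_fun setT f -> 0 < f x -> 0 < b -> 0 < N ->
  ((2 * b)%:E <= mu (eball x0 r))%E ->
  (mu (eball x0 r `&` [set y | (f x / 2 < f y)%R]) <= b%:E)%E ->
  b <= N * (2 / f x) `^ Q ->
  (((2 * (2 * n%:R) ^+ n) `^ (- (1 + a)) * (2 * r) `^ (a * n%:R - s * p) *
     N `^ (- a) * (f x / 2) `^ Q)%:E <=
   \int[mu]_(y in eball x0 r) (energy_density s p f (x, y))%:E)%E.
Proof.
move=> r0 Bx mf t0 b0 N0 b2 Ab bN; pose B : set T := eball x0 r; rewrite -/B.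
set t := f x in t0 Ab bN *.
have mB : measurable B by exact: measurable_eball.
pose rho := 2 * n%:R * (2 * b) `^ n%:R^-1.
have rho0 : 0 < rho by rewrite mulr_gt0 ?powR_gt0 ?mulr_gt0.
have root : ((2 * b) `^ n%:R^-1) ^+ n = 2 * b.
  rewrite -powR_mulrn ?powR_ge0// -powRrM mulVf ?gt_eqF// powRr1//.
  by rewrite mulr_ge0// ltW.
have rhoE : (rho / 2 / n%:R) ^+ n = 2 * b.
  by rewrite (_ : rho / 2 / n%:R = (2 * b) `^ n%:R^-1)// /rho; field; rewrite gt_eqF.
pose A : set T := [set y | f y <= t / 2].
have mA : measurable A.
  rewrite (_ : A = setT `&` f @^-1` `]-oo, t / 2]).
    by apply: mf => //; exact: measurable_itv.
  by apply/seteqP; split => y /=; rewrite in_itv//= => -[].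
have BA : B `\` A = B `&` [set y | (t / 2 < f y)%R].
  apply/seteqP; split => y /= [By]; rewrite /A/=.
    by move=> /negP; rewrite -ltNge.
  by move=> ty; split => //; apply/negP; rewrite -ltNge.
have bAS : (b%:E <= mu (B `&` A `&` eball x rho))%E.
  by apply: (mass_near x0 r x A b rho) => //; rewrite -/B BA.
have mBAS : measurable (B `&` A `&` (eball x rho : set T)).
  by apply: measurableI; [exact: measurableI|exact: measurable_eball].
pose c := (t / 2) `^ p / (rho `^ (n%:R * (1 + a)) * (2 * r) `^ (s * p - a * n%:R)).
have c0 : 0 <= c by rewrite divr_ge0 ?mulr_ge0 ?powR_ge0.
have r20 : 0 < 2 * r by rewrite mulr_gt0.
have sub : B `&` A `&` eball x rho `<=` B by move=> y [[]].
apply: (@le_trans _ _ (c%:E * mu (B `&` A `&` eball x rho))%E); last first.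
  apply: integral_ge_cst_mul.
  - exact: mB.
  - exact: mBAS.
  - exact: sub.
  - exact: c0.
  - apply: measurable_funTS; apply: (measurableT_comp (measurable_energy_density s p _ mf)).
    exact: measurable_pair1.
  - by move=> y; exact: energy_density_ge0.
  move=> y [[By Ay] Sy]; rewrite /energy_density/= -/t.
  have tf : t / 2 <= `|t - f y|.
    by apply: le_trans (ler_norm _); move: Ay; rewrite /A/=; lra.
  have dxy : 0 < edist x y.
    rewrite edist_gt0; apply/negP => /eqP xy; move: Ay; rewrite /A/= -xy -/t; lra.
  have drho : edist x y <= rho by rewrite euclid_sym; exact: ltW.
  have d2r : edist x y <= 2 * r.
    apply: (le_trans (euclid_triangle x0 _ _)).
    by rewrite (euclid_sym x0); move: Bx By; rewrite /B /eball/=; lra.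
  rewrite /c; apply: ler_pM; rewrite ?powR_ge0 ?invr_ge0 ?mulr_ge0 ?powR_ge0//.
    by apply: ge0_ler_powR; rewrite ?nnegrE ?divr_ge0 ?(ltW t0) ?(ltW p0).
  rewrite lef_pV2 ?posrE ?mulr_gt0 ?powR_gt0//.
  have -> : n%:R + s * p = n%:R * (1 + a) + (s * p - a * n%:R) by ring.
  rewrite powRD ?(gt_eqF dxy) ?implybT//; apply: ler_pM; rewrite ?powR_ge0//.
    apply: ge0_ler_powR; rewrite ?nnegrE ?(ltW rho0) ?(ltW dxy)//.
    by rewrite mulr_ge0 ?addr_ge0 ?(ltW a0).
  by apply: ge0_ler_powR; rewrite ?nnegrE ?(ltW r20) ?(ltW dxy) ?subr_ge0.
apply: (@le_trans _ _ (c%:E * b%:E)%E); last by apply: lee_wpmul2l.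
rewrite -EFinM lee_fin.
pose K := 2 * (2 * n%:R) ^+ n : R.
have K0 : 0 < K by rewrite mulr_gt0 ?exprn_gt0 ?mulr_gt0.
have rhon : rho `^ (n%:R * (1 + a)) = K `^ (1 + a) * b `^ (1 + a).
  rewrite powRrM powR_mulrn ?(ltW rho0)// /rho exprMn root -powRM ?(ltW K0) ?(ltW b0)//.
  by congr (_ `^ _); rewrite /K; ring.
have t2 : 0 < t / 2 by rewrite divr_gt0.
have E1 : c * b = K `^ (- (1 + a)) * (2 * r) `^ (a * n%:R - s * p) * (b `^ (- a) * (t / 2) `^ p).
  rewrite /c rhon -(opprB (s * p)) !powRN.
  have -> : b `^ (1 + a) = b * b `^ a by rewrite powRD ?(gt_eqF b0) ?implybT// powRr1// ltW.
  have h1 : K `^ (1 + a) != 0 by rewrite gt_eqF ?powR_gt0.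
  have h2 : (2 * r) `^ (s * p - a * n%:R) != 0 by rewrite gt_eqF ?powR_gt0.
  have h3 : b `^ a != 0 by rewrite gt_eqF ?powR_gt0.
  by field; rewrite h1 h2 h3 gt_eqF.
rewrite E1 -[leLHS]mulrA; apply: ler_wpM2l; first by rewrite mulr_ge0 ?powR_ge0.
have -> : (t / 2) `^ Q = (t / 2) `^ (a * Q) * (t / 2) `^ p.
  by rewrite -powRD ?(gt_eqF t2) ?implybT//; congr (_ `^ _); rewrite aQ; ring.
rewrite mulrA ler_wpM2r ?powR_ge0//.
have -> : N `^ (- a) * (t / 2) `^ (a * Q) = (N * (2 / t) `^ Q) `^ (- a).
  rewrite [RHS]powRM ?powR_ge0 ?(ltW N0)//; congr (_ * _).
  have -> : 2 / t = (t / 2)^-1 by rewrite invf_div.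
  by rewrite -[(t / 2)^-1]powR_inv1 ?(ltW t2)// -!powRrM; congr (_ `^ _); ring.
rewrite !powRN lef_pV2 ?posrE ?powR_gt0 ?mulr_gt0 ?powR_gt0 ?divr_gt0//.
apply: ge0_ler_powR; rewrite ?nnegrE ?(ltW a0) ?(ltW b0)//.
by rewrite mulr_ge0 ?powR_ge0 ?(ltW N0).
Qed.

(** Chebyshev's inequality bounds the measure of [f > f x / 2] by [N (2 / f
   x)^Q], so that the inner energy at [x] is at least of order [N^(-a) (f
   x)^Q]. Integrating over [x] gives the estimate, in which the finite number
   [N] is then absorbed. *)
Lemma sobolev_bounded : exists2 C : R, 0 < C &
  forall x0 (r : R) (f : T -> R) (k N : R), 0 < r -> 0 <= k ->
  measurable_fun setT f -> (forall x, 0 <= f x) ->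
  (mu (eball x0 r `&` [set y | (0 < f y)%R]) <= (((r / n%:R) ^+ n) / 2)%:E)%E ->
  lp_mass Q (eball x0 r) f = N%:E ->
  (energy s p (eball x0 r) f <= k%:E)%E ->
  N `^ (1 - a) <= C * r `^ (s * p - a * n%:R) * k.
Proof.
pose K : R := (2 * (2 * n%:R) ^+ n) `^ (1 + a).
have K0 : 0 < K by rewrite powR_gt0 ?mulr_gt0 ?exprn_gt0 ?mulr_gt0.
exists (K * 2 `^ (s * p - a * n%:R) * 2 `^ Q).
  apply: mulr_gt0; last by rewrite powR_gt0.
  by apply: mulr_gt0; [exact: K0|rewrite powR_gt0].
move=> x0 r f k N r0 k0 mf f0 half NE Ek; pose B : set T := eball x0 r.
rewrite -/B in half NE Ek.
have mB : measurable B by exact: measurable_eball.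
have N0 : 0 <= N by rewrite -lee_fin -NE; exact: lp_mass_ge0.
have [->|Nn] := eqVneq N 0.
  by rewrite powR0 ?mulr_ge0 ?powR_ge0 ?(ltW K0)// gt_eqF// subr_gt0.
have {N0}N0 : 0 < N by rewrite lt_neqAle eq_sym Nn.
pose h := (r / n%:R) ^+ n.
have h0 : 0 < h by rewrite exprn_gt0// divr_gt0.
have hB : (h%:E <= mu B)%E by exact: eball_volume_ge.
pose L := K^-1 * (2 * r) `^ (a * n%:R - s * p) * N `^ (- a) * (2 `^ Q)^-1.
have r2 : 0 < 2 * r by rewrite mulr_gt0.
have L0 : 0 < L.
  apply: mulr_gt0; last by rewrite invr_gt0 powR_gt0.
  apply: mulr_gt0; last by rewrite powR_gt0.
  by apply: mulr_gt0; [rewrite invr_gt0; exact: K0|rewrite powR_gt0].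
pose F (z : T * T) : \bar R := (energy_density s p f z)%:E.
have mF : measurable_fun setT F.
  by apply/measurable_EFinP; exact: measurable_energy_density.
have F0 z : (0 <= F z)%E by rewrite lee_fin energy_density_ge0.
have mset c : measurable (B `&` [set y | (c < f y)%R]).
  by apply: measurableI; [exact: mB|exact: measurable_superlevel].
have mfQ : measurable_fun B (fun x => `|f x| `^ Q).
  by apply: measurable_powR_norm; exact: measurable_funTS.
have inner x : B x -> ((L * `|f x| `^ Q)%:E <= \int[mu]_(y in B) F (x, y))%E.
  move=> Bx; have [fx0|fxn] := eqVneq (f x) 0.
    rewrite fx0 normr0 powR0 ?gt_eqF// mulr0.
    by apply: integral_ge0 => y _; exact: F0.
  have fx : 0 < f x by rewrite lt_neqAle eq_sym fxn f0.
  have fx2 : 0 < f x / 2 by rewrite divr_gt0.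
  pose b := Num.min (h / 2) (N * (2 / f x) `^ Q).
  have b0 : 0 < b by rewrite lt_min divr_gt0//= mulr_gt0// powR_gt0// divr_gt0.
  have H := inner_energy_ge x0 r f x b N r0 Bx mf fx b0 N0.
  apply: (le_trans _ (H _ _ _)).
  - rewrite lee_fin; apply: le_of_eq.
    rewrite /L /K powRN (ger0_norm (f0 x)) (powRM _ (f0 x)) ?invr_ge0//.
    by rewrite -(powR_inv1 (_ : 0 <= 2))// -powRrM mulN1r !powRN; ring.
  - apply: le_trans hB; rewrite lee_fin.
    have : b <= h / 2 by rewrite ge_min lexx.
    by lra.
  - rewrite /b; case: (leP (h / 2) (N * (2 / f x) `^ Q)) => _.
      apply: le_trans half; apply: le_measure; rewrite ?inE; [exact: mset|exact: mset|].
      by move=> y [By /= fy]; split => //=; exact: lt_trans fy.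
    have C0 : 0 < (f x / 2) `^ Q by rewrite powR_gt0.
    have cheb : (((f x / 2) `^ Q)%:E * mu (B `&` [set y | (f x / 2 < f y)%R]) <= N%:E)%E.
      rewrite -NE lp_massE; apply: integral_ge_cst_mul.
      - exact: mB.
      - exact: mset.
      - by move=> y [].
      - exact: ltW.
      - exact: mfQ.
      - by move=> y; exact: powR_ge0.
      move=> y [_ /= fy]; apply: ge0_ler_powR; rewrite ?nnegrE ?(ltW fx2) ?(ltW Q0)//.
      by apply: (le_trans (ltW fy)); exact: ler_norm.
    move: cheb; rewrite -lee_pdivlMl// => /le_trans; apply.
    rewrite -EFinM lee_fin; apply: le_of_eq.
    rewrite mulrC; congr (_ * _).
    have -> : 2 / f x = (f x / 2)^-1 by rewrite invf_div.
    by rewrite -[(f x / 2)^-1]powR_inv1 ?(ltW fx2)// -powRrM mulN1r powRN.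
  - by rewrite ge_min lexx orbT.
have LN : (L%:E * N%:E <= k%:E)%E.
  apply: le_trans Ek; rewrite (energyE s p B f mB mf).
  rewrite -(iterated_integral_restrict F B B mB mB mF F0) -NE lp_massE.
  rewrite -ge0_integralZl; first last.
  - by rewrite lee_fin ltW.
  - by move=> x _; rewrite lee_fin powR_ge0.
  - by apply/measurable_EFinP.
  - exact: mB.
  apply: ge0_le_integral.
  - exact: mB.
  - by move=> x _; rewrite lee_fin mulr_ge0 ?powR_ge0 ?(ltW L0).
  - by apply: emeasurable_funM; [exact: measurable_cst|exact/measurable_EFinP].
  - by apply: measurable_funTS; exact: (measurable_inner_integral F B mB mF F0).
  by move=> x Bx; rewrite -EFinM; exact: inner.
move: LN; rewrite -EFinM lee_fin mulrC -ler_pdivlMr// => LN.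
have NN : N `^ (1 - a) = N * N `^ (- a).
  by rewrite powRD ?(gt_eqF N0) ?implybT// powRr1// ltW.
rewrite NN; apply: (le_trans (ler_wpM2r (powR_ge0 _ _) LN)).
apply: le_of_eq.
rewrite /L -(opprB (s * p)) (powRN (2 * r)) (powRM _ (_ : 0 <= 2) (ltW r0))//.
have h1 : K != 0 by rewrite gt_eqF.
have h2 : 2 `^ (s * p - a * n%:R) != 0 :> R by rewrite gt_eqF ?powR_gt0.
have h3 : r `^ (s * p - a * n%:R) != 0 by rewrite gt_eqF ?powR_gt0.
have h4 : N `^ (- a) != 0 by rewrite gt_eqF ?powR_gt0.
have h5 : 2 `^ Q != 0 :> R by rewrite gt_eqF ?powR_gt0.
by field; rewrite h1 h2 h3 h4 h5.
Qed.

(** The truncations of [f] have finite mass and no more energy than [f], so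
   that the bounded case applies to them and monotone convergence concludes.
   *)
Lemma sobolev : exists2 C : R, 0 < C &
  forall x0 (r : R) (f : T -> R) (k : R), 0 < r -> 0 <= k ->
  measurable_fun setT f -> (forall x, 0 <= f x) ->
  (mu (eball x0 r `&` [set y | (0 < f y)%R]) <= (((r / n%:R) ^+ n) / 2)%:E)%E ->
  (energy s p (eball x0 r) f <= k%:E)%E ->
  (lp_mass Q (eball x0 r) f <= ((C * r `^ (s * p - a * n%:R) * k) `^ (Q / p))%:E)%E.
Proof.
have [C C0 HC] := sobolev_bounded; exists C => // x0 r f k r0 k0 mf f0 half Ek.
pose B : set T := eball x0 r; rewrite -/B in half Ek *.
have mB : measurable B by exact: measurable_eball.
pose g (M : nat) (x : T) : R := Num.min (f x) M%:R.
have g0 M x : 0 <= g M x by rewrite le_min f0 ler0n.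
have mg M : measurable_fun setT (g M).
  by apply: measurable_minr => //; exact: measurable_cst.
set W := _ `^ _.
have gW M : (lp_mass Q B (g M) <= W%:E)%E.
  have fin : (lp_mass Q B (g M) < +oo)%E.
    apply: (@le_lt_trans _ _ (lp_mass Q B (fun=> M%:R))).
      apply: le_lp_mass; try exact: (lt_trans p1 pQ).
      - exact: mB.
      - exact: measurable_funTS.
      - exact: measurable_cst.
      - by move=> x _; rewrite (ger0_norm (g0 M x)) ger0_norm// ge_min lexx orbT.
    rewrite lp_mass_cst// lte_mul_pinfty ?lee_fin ?powR_ge0//.
    by apply: (le_lt_trans (eball_volume_le x0 r (ltW r0))); rewrite ltry.
  have NE : lp_mass Q B (g M) = (fine (lp_mass Q B (g M)))%:E.
    by rewrite fineK// ge0_fin_numE// lp_mass_ge0.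
  have half' : (mu (B `&` [set y | (0 < g M y)%R]) <= (((r / n%:R) ^+ n) / 2)%:E)%E.
    apply: le_trans half; apply: le_measure; rewrite ?inE.
    - by apply: measurableI; [exact: mB|exact: measurable_superlevel].
    - by apply: measurableI; [exact: mB|exact: measurable_superlevel].
    - by move=> y [By /=]; rewrite /g lt_min => /andP[].
  have Eg : (energy s p B (g M) <= k%:E)%E.
    apply: le_trans Ek; apply: (le_energy s p p1) => // x y _ _.
    exact: minr_cst_dist.
  have N0 : 0 <= fine (lp_mass Q B (g M)) by apply: fine_ge0; exact: lp_mass_ge0.
  have NC := HC x0 r (g M) k _ r0 k0 (mg M) (g0 M) half' NE Eg.
  rewrite NE lee_fin /W; clear NE; move: (fine _) N0 NC => N N0 NC.
  have -> : N = (N `^ (1 - a)) `^ (Q / p).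
    rewrite -powRrM (_ : (1 - a) * (Q / p) = 1) ?powRr1//.
    by rewrite mulrA mulrBl mul1r aQ opprB addrC subrK divff// gt_eqF.
  apply: ge0_ler_powR; rewrite ?nnegrE ?powR_ge0 ?divr_ge0 ?(ltW Q0) ?(ltW p0)//.
  by rewrite !mulr_ge0 ?powR_ge0// ltW.
have cvgg x : limn (fun M => (`|g M x| `^ Q)%:E) = (`|f x| `^ Q)%:E.
  apply: lim_near_cst => //; near=> M; rewrite /g min_l//.
  by near: M; exact: nbhs_infty_ger.
rewrite lp_massE (_ : (\int[mu]_(x in B) _ = \int[mu]_(x in B) limn (fun M => (`|g M x| `^ Q)%:E))%E); last first.
  by apply: eq_integral => x _; rewrite cvgg.
rewrite monotone_convergence.
- apply: lime_le; last by apply: nearW => M; rewrite -lp_massE; exact: gW.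
  apply: ereal_nondecreasing_is_cvgn => i j ij; rewrite -!lp_massE.
  apply: le_lp_mass; try exact: (lt_trans p1 pQ).
  - exact: mB.
  - exact: measurable_funTS.
  - exact: measurable_funTS.
  - move=> x _; rewrite !ger0_norm ?g0// /g le_min ge_min lexx/= ge_min ler_nat ij orbT//.
- exact: mB.
- by move=> M; apply/measurable_EFinP; apply: measurable_powR_norm; exact: measurable_funTS.
- by move=> M x _; rewrite lee_fin powR_ge0.
- move=> x _ i j ij; rewrite lee_fin; apply: le_powR_norm; first exact: ltW.
  by rewrite !ger0_norm ?g0// /g le_min ge_min lexx/= ge_min ler_nat ij orbT.
Unshelve. all: by end_near. Qed.

(** With [c] the Poincare constant, Chebyshev's inequality gives a level [la]
   such that [|u - c| > la] on at most half of the ball. The excess [f] of [|u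
   - c|] over this level is controlled by [sobolev], and lower exponents
   follow by comparing [f] with the constant [m0]. *)
Lemma poincare_sobolev q : 1 <= q -> q <= Q -> exists2 C : R, 0 < C &
  forall x0 (r : R) (u : T -> R) (k : R), 0 < r -> 0 < k ->
  measurable_fun setT u ->
  (energy s p (eball x0 r) u < (r `^ (n%:R - s * p) * k)%:E)%E ->
  exists c : R,
    (lp_mass p (eball x0 r) (fun x => (u x - c)%R) <= (C * r ^+ n * k)%:E)%E /\
    (lp_mass q (eball x0 r) (fun x => (u x - c)%R) <= (C * r ^+ n * k `^ (q / p))%:E)%E.
Proof.
move=> q1 qQ; have q0 : 0 < q by exact: lt_le_trans ltr01 q1.
have [C1 C10 HP] := poincare s p n0 s0 p1.
have [C2 C20 HS] := sobolev.
pose C3 := 2 * C1 * n%:R ^+ n.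
have C30 : 0 < C3 by rewrite mulr_gt0 ?exprn_gt0// mulr_gt0.
pose C4 := 2 `^ q * (C2 `^ (Q / p) + (1 + C3 `^ (q / p)) * 2 ^+ n).
have C40 : 0 < C4.
  rewrite mulr_gt0 ?powR_gt0// ltr_wpDr ?powR_gt0// mulr_ge0 ?exprn_ge0//.
  by rewrite addr_ge0// powR_ge0.
exists (C1 + C4) => [|x0 r u k r0 k0 mu_ Ek]; first by rewrite addr_gt0.
pose B : set T := eball x0 r; rewrite -/B in Ek *.
have mB : measurable B by exact: measurable_eball.
have kq0 : 0 < k `^ (q / p) by rewrite powR_gt0.
have rn0 : 0 < r ^+ n by rewrite exprn_gt0.
have rsp : r `^ (s * p) * r `^ (n%:R - s * p) = r ^+ n.
  by rewrite -powRD ?(gt_eqF r0) ?implybT// subrKC powR_mulrn// ltW.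
have [c Hc] := HP x0 r u _ r0 mu_ Ek; exists c.
have {}Hc : (lp_mass p B (fun x => (u x - c)%R) <= (C1 * r ^+ n * k)%:E)%E.
  by apply: le_trans Hc _; rewrite lee_fin -rsp !mulrA.
split.
  apply: (le_trans Hc); rewrite lee_fin ler_wpM2r ?(ltW k0)// ler_wpM2r ?(ltW rn0)//.
  by rewrite lerDl ltW.
pose w x : R := u x - c; rewrite -/w.
have mw : measurable_fun setT w by apply: measurable_funB => //; exact: measurable_cst.
have mnw : measurable_fun setT (fun x => `|w x|) by exact: measurableT_comp.
pose la := (C3 * k) `^ p^-1.
have la0 : 0 < la by rewrite powR_gt0// mulr_gt0.
have lap : la `^ p = C3 * k.
  by rewrite -powRrM mulVf ?gt_eqF// powRr1// mulr_ge0// ltW.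
pose f x : R := Num.max (`|w x| - la) 0.
have mf : measurable_fun setT f.
  apply: measurable_maxr; last exact: measurable_cst.
  by apply: measurable_funB => //; exact: measurable_cst.
have f0 x : 0 <= f x by rewrite le_max lexx orbT.
have mset : measurable (B `&` [set y | (la < `|w y|)%R]).
  by apply: measurableI; [exact: mB|exact: (measurable_superlevel _ la mnw)].
have setE : B `&` [set y | (0 < f y)%R] = B `&` [set y | (la < `|w y|)%R].
  by apply/seteqP; split => y [By] /=; rewrite /f lt_max ltxx orbF subr_gt0.
have half : (mu (B `&` [set y | (0 < f y)%R]) <= (((r / n%:R) ^+ n) / 2)%:E)%E.
  rewrite setE.
  have cheb : ((la `^ p)%:E * mu (B `&` [set y | (la < `|w y|)%R]) <= (C1 * r ^+ n * k)%:E)%E.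
    apply: le_trans Hc; rewrite lp_massE; apply: integral_ge_cst_mul.
    - exact: mB.
    - exact: mset.
    - by move=> y [].
    - exact: powR_ge0.
    - by apply: measurable_powR_norm; exact: measurable_funTS.
    - by move=> y; exact: powR_ge0.
    move=> y [_ /= wy]; apply: ge0_ler_powR; rewrite ?nnegrE ?(ltW la0) ?(ltW p0) ?normr_ge0//.
    exact: ltW.
  have C3k : 0 < C3 * k by rewrite mulr_gt0.
  move: cheb; rewrite lap -lee_pdivlMl// => cheb; apply: (le_trans cheb).
  rewrite -EFinM lee_fin; apply: le_of_eq.
  by rewrite /C3 expr_div_n; field; rewrite expf_neq0 ?gt_eqF.
have Ef : (energy s p B f <= (r `^ (n%:R - s * p) * k)%:E)%E.
  apply: le_trans (ltW Ek); apply: (le_energy s p p1) => // x y _ _; rewrite /f.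
  have E : u x - u y = w x - w y by rewrite /w; ring.
  rewrite E; apply: le_trans (ler_dist_dist (w x) (w y)).
  apply: (le_trans (maxr_cst_dist _ _ _)).
  by rewrite opprD addrACA opprK addNr addr0.
have k'0 : 0 <= r `^ (n%:R - s * p) * k by rewrite mulr_ge0 ?powR_ge0// ltW.
have HQ := HS x0 r f _ r0 k'0 mf f0 half Ef.
have {}HQ : (lp_mass Q B f <= (C2 `^ (Q / p) * k `^ (Q / p) * r ^+ n)%:E)%E.
  apply: (le_trans HQ); rewrite lee_fin; apply: le_of_eq.
  have -> : C2 * r `^ (s * p - a * n%:R) * (r `^ (n%:R - s * p) * k) =
      C2 * k * r `^ (n%:R * (1 - a)).
    have -> : n%:R * (1 - a) = (s * p - a * n%:R) + (n%:R - s * p) by ring.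
    by rewrite [in RHS]powRD ?(gt_eqF r0) ?implybT//; ring.
  rewrite powRM ?powR_ge0 ?mulr_ge0 ?(ltW k0) ?(ltW C20)//.
  rewrite powRM ?(ltW k0) ?(ltW C20)//; congr (_ * _).
  rewrite -powRrM -powR_mulrn ?(ltW r0)//; congr (_ `^ _).
  have aE : (1 - a) * (Q / p) = 1.
    by rewrite mulrA mulrBl mul1r aQ opprB addrC subrK divff// gt_eqF.
  by rewrite -mulrA aE mulr1.
pose m0 := k `^ p^-1.
have m00 : 0 < m0 by rewrite powR_gt0.
have pt x : `|w x| `^ q <= (2 `^ q * m0 `^ (q - Q)) * `|f x| `^ Q +
    2 `^ q * (m0 `^ q + la `^ q).
  have wf : `|w x| <= `|f x + la|.
    have fl : 0 <= f x + la by rewrite addr_ge0 ?f0 ?ltW.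
    by rewrite [leRHS]ger0_norm// -lerBlDr /f le_max lexx.
  apply: (le_trans (le_powR_norm q (ltW q0) _ _ wf)).
  apply: (le_trans (powR_normD q (ltW q0) _ _)).
  rewrite -mulrA -mulrDr ler_wpM2l ?powR_ge0// (ger0_norm (ltW la0)) addrA lerD2r.
  rewrite (ger0_norm (f0 x)); have [fm|fm] := leP (f x) m0.
    rewrite -[leLHS]add0r lerD ?mulr_ge0 ?powR_ge0//.
    by apply: ge0_ler_powR; rewrite ?nnegrE ?f0 ?(ltW m00) ?(ltW q0).
  have fx0 : 0 < f x by exact: lt_trans fm.
  rewrite -[leLHS]addr0 lerD ?powR_ge0//.
  have -> : f x `^ q = f x `^ (q - Q) * f x `^ Q.
    by rewrite -powRD ?(gt_eqF fx0) ?implybT// subrK.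
  rewrite ler_wpM2r ?powR_ge0// -(opprB Q) !powRN lef_pV2 ?posrE ?powR_gt0//.
  by apply: ge0_ler_powR; rewrite ?nnegrE ?subr_ge0 ?(ltW m00) ?(ltW fx0) ?(ltW fm).
have a10 : 0 <= 2 `^ q * m0 `^ (q - Q) by rewrite mulr_ge0 ?powR_ge0.
have a20 : 0 <= 2 `^ q * (m0 `^ q + la `^ q) by rewrite mulr_ge0 ?addr_ge0 ?powR_ge0.
have main : (lp_mass q B w <= (2 `^ q * m0 `^ (q - Q))%:E * lp_mass Q B f +
    (2 `^ q * (m0 `^ q + la `^ q))%:E * mu B)%E.
  apply: (lp_mass_le_comb q Q B w f _ _ mB a10 a20); [exact: measurable_funTS|exact: measurable_funTS|].
  by move=> x _; exact: pt.
have HB := eball_volume_le x0 r (ltW r0).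
apply: (le_trans main); apply: (@le_trans _ _
  ((2 `^ q * m0 `^ (q - Q))%:E * (C2 `^ (Q / p) * k `^ (Q / p) * r ^+ n)%:E +
   (2 `^ q * (m0 `^ q + la `^ q))%:E * ((2 * r) ^+ n)%:E)%E).
  by apply: leeD; apply: lee_wpmul2l; rewrite ?lee_fin.
rewrite -!EFinM -EFinD lee_fin.
have mq : m0 `^ q = k `^ (q / p) by rewrite -powRrM mulrC.
have laq : la `^ q = C3 `^ (q / p) * k `^ (q / p).
  by rewrite -powRrM (mulrC p^-1) powRM ?(ltW k0) ?(ltW C30).
have mQ : m0 `^ (q - Q) * k `^ (Q / p) = k `^ (q / p).
  rewrite -powRrM -powRD ?(gt_eqF k0) ?implybT//; congr (_ `^ _); ring.
apply: (@le_trans _ _ (C4 * r ^+ n * k `^ (q / p))).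
  rewrite mq laq /C4 exprMn; apply: le_of_eq.
  by rewrite -mQ; ring.
by rewrite ler_wpM2r ?(ltW kq0)// ler_wpM2r ?(ltW rn0)// lerDr ltW.
Qed.

End sobolev_ball.

(** * Mollification does not increase the energy much *)

(** The graph of [t^p] lies above its tangent at [A], by Young's inequality;
   the tangent is integrated against [rho]. *)
Lemma jensen_powR {d} {T : measurableType d} {R : realType}
    (m : {measure set T -> \bar R}) (rho f : T -> R) (p : R) : 1 < p ->
  (forall x, 0 <= rho x) -> measurable_fun setT rho -> measurable_fun setT f ->
  (\int[m]_x (rho x)%:E = 1)%E ->
  m.-integrable setT (EFin \o (fun x => rho x * f x)) ->
  ((`|Rintegral m setT (fun x => rho x * f x)| `^ p)%:E <=
    \int[m]_x (rho x * `|f x| `^ p)%:E)%E.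
Proof.
move=> p1 rho0 mrho mf rho1 irf; have p0 : 0 < p by exact: lt_trans ltr01 p1.
set A := `|_|; have A0 : 0 <= A by exact: normr_ge0.
have mfp : measurable_fun setT (fun x => rho x * `|f x| `^ p).
  apply: measurable_funM => //; apply: (measurableT_comp (measurable_powR _)).
  exact: measurableT_comp.
have J0 : (0 <= \int[m]_x (rho x * `|f x| `^ p)%:E)%E.
  by apply: integral_ge0 => x _; rewrite lee_fin mulr_ge0 ?powR_ge0.
have [->|An] := eqVneq A 0; first by rewrite powR0 ?gt_eqF.
have {An} A1 : 0 < A by rewrite lt_neqAle eq_sym An.
have mrf : measurable_fun setT (fun x => rho x * `|f x|).
  by apply: measurable_funM => //; exact: measurableT_comp.
have AI : (A%:E <= \int[m]_x (rho x * `|f x|)%:E)%E.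
  rewrite (EFin_normr_Rintegral _ irf)//.
  apply: (le_trans (le_abse_integral m measurableT (measurable_int m irf))).
  apply: ge0_le_integral.
  - exact: measurableT.
  - by move=> x _; exact: abse_ge0.
  - apply/measurable_EFinP; apply: measurableT_comp => //.
    by apply: measurable_funM.
  - exact/measurable_EFinP.
  - by move=> x _; rewrite lee_fin normrM (ger0_norm (rho0 x)).
have tangent (t : R) : 0 <= t -> p * A `^ (p - 1) * t <= 1 * t `^ p + (p - 1) * A `^ p.
  move=> t0; pose p' := p / (p - 1).
  have pp : p - 1 != 0 by rewrite gt_eqF// subr_gt0.
  have pq : p^-1 + p'^-1 = 1 by rewrite /p'; field; rewrite pp gt_eqF.
  have p'0 : 0 < p' by rewrite divr_gt0// subr_gt0.
  have := @conjugate_powR R t (A `^ (p - 1)) p p' t0 (powR_ge0 _ _) p0 p'0 pq.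
  rewrite -powRrM (_ : (p - 1) * p' = p); last by rewrite /p'; field.
  move=> /(ler_wpM2l (ltW p0)); set y := A `^ (p - 1); set z := A `^ p.
  have -> : p * (t `^ p / p + z / p') = t `^ p + (p - 1) * z.
    by rewrite /p'; field; rewrite pp gt_eqF.
  by rewrite mul1r mulrA (mulrAC p).
have Ap0 : 0 <= (p - 1) * A `^ p by rewrite mulr_ge0 ?powR_ge0// subr_ge0 ltW.
have c0 : 0 <= p * A `^ (p - 1) by rewrite mulr_ge0 ?powR_ge0// ltW.
have H : (\int[m]_x (p * A `^ (p - 1) * (rho x * `|f x|))%:E <=
    1%:E * \int[m]_x (rho x * `|f x| `^ p)%:E +
    ((p - 1) * A `^ p)%:E * \int[m]_x (rho x)%:E)%E.
  have := @ge0_integral_le_comb _ _ _ m setT measurableT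
    (fun x => p * A `^ (p - 1) * (rho x * `|f x|))
    (fun x => rho x * `|f x| `^ p) rho 1 _ ler01 Ap0; apply.
  - by move=> x; rewrite mulr_ge0// mulr_ge0.
  - by move=> x; rewrite mulr_ge0 ?powR_ge0.
  - exact: rho0.
  - by apply: measurable_funM => //; exact: measurable_cst.
  - exact: mfp.
  - exact: mrho.
  move=> x _; have := ler_wpM2l (rho0 x) (tangent _ (normr_ge0 (f x))).
  by rewrite !mul1r mulrDr mulrCA (mulrC (rho x) (_ * A `^ p)).
have {H} : ((p * A `^ (p - 1))%:E * A%:E <=
    \int[m]_x (rho x * `|f x| `^ p)%:E + ((p - 1) * A `^ p)%:E)%E.
  move: H; rewrite rho1 mule1 mul1e; apply: le_trans.
  under eq_integral do rewrite EFinM.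
  rewrite ge0_integralZl//; first by rewrite lee_wpmul2l.
  - exact/measurable_EFinP.
  - by move=> x _; rewrite lee_fin mulr_ge0.
have AA : A `^ (p - 1) * A = A `^ p.
  by rewrite -[X in _ * X]powRr1// -powRD ?(gt_eqF A1) ?implybT// subrK.
rewrite -EFinM -mulrA AA; move: J0; set J := integral _ _ _.
case: J => [j| |] // _; rewrite ?leey// -EFinD !lee_fin.
by move=> ?; lra.
Qed.

Section energy_translation.
Context {R : realType} {n : nat}.
Local Notation mu := (@lebesgue_rV R n).
Local Notation T := (Rn R n).
Variables (s p : R).
Hypotheses (s0 : 0 < s) (p1 : 1 < p).

Let p0 : 0 < p. Proof. exact: lt_trans ltr01 p1. Qed.

Lemma integral_shift_le (h : 'rV[R]_n) (f : T -> \bar R) (B B' : set T) :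
  measurable B -> measurable B' -> measurable_fun setT f -> (forall x, 0 <= f x)%E ->
  (forall x, B x -> B' (rV_shift h x)) ->
  (\int[mu]_(x in B) f (rV_shift h x) <= \int[mu]_(x in B') f x)%E.
Proof.
move=> mB mB' mf f0 BB'.
have mfB : measurable_fun setT (f \_ B').
  by apply/(measurable_restrictT _ _).1 => //; exact: measurable_funTS.
have fB0 x : (0 <= (f \_ B') x)%E by rewrite patchE; case: ifP.
rewrite [leRHS]integral_mkcond -(ge0_integral_shift h _ mfB fB0) [leLHS]integral_mkcond.
have msf : measurable_fun setT (f \o rV_shift h).
  exact: (measurableT_comp mf (measurable_rV_shift h)).
apply: ge0_le_integral.
- exact: measurableT.
- by move=> x _; rewrite patchE; case: ifP.
- apply/(measurable_restrictT _ _).1; first exact: mB.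
  by apply: measurable_funTS; exact: msf.
- by exact: (measurableT_comp mfB (measurable_rV_shift h)).
- move=> x _; rewrite !patchE; case: ifPn => xB; last by case: ifP.
  by rewrite ifT//; apply/mem_set/BB'; exact: set_mem.
Qed.

Lemma energy_shift_le (h : 'rV[R]_n) (u : T -> R) (B B' : set T) :
  measurable B -> measurable B' -> measurable_fun setT u ->
  (forall x, B x -> B' (rV_shift h x)) ->
  (energy s p B (u \o rV_shift h) <= energy s p B' u)%E.
Proof.
move=> mB mB' mfu BB'.
pose F (z : T * T) : \bar R := (energy_density s p u z)%:E.
have mF : measurable_fun setT F.
  by apply/measurable_EFinP; exact: measurable_energy_density.
have F0 z : (0 <= F z)%E by rewrite lee_fin energy_density_ge0.
have mFx x : measurable_fun setT (fun y => F (x, y)).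
  by apply: (measurableT_comp mF); exact: measurable_pair1.
have mI := measurable_inner_integral F B' mB' mF F0.
have mu' : measurable_fun setT (u \o rV_shift h).
  exact: (measurableT_comp mfu (measurable_rV_shift h)).
rewrite (energyE s p B _ mB mu') (energyE s p B' _ mB' mfu).
rewrite -(iterated_integral_restrict (EFin \o energy_density s p (u \o rV_shift h)) _ _ mB mB).
- rewrite -(iterated_integral_restrict F _ _ mB' mB' mF F0).
  have I0 x : (0 <= \int[mu]_(y in B') F (x, y))%E by apply: integral_ge0 => y _; exact: F0.
  apply: le_trans (integral_shift_le h _ _ _ mB mB' mI I0 BB').
  apply: ge0_le_integral.
  - exact: mB.
  - by move=> x _; apply: integral_ge0 => y _; rewrite lee_fin energy_density_ge0.
  - apply: measurable_funTS.
    apply: (measurable_inner_integral (EFin \o energy_density s p (u \o rV_shift h)) B mB).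
      by apply/measurable_EFinP; exact: measurable_energy_density.
    by move=> z; rewrite lee_fin energy_density_ge0.
  - by apply: measurable_funTS; exact: (measurableT_comp mI (measurable_rV_shift h)).
  move=> x Bx; apply: le_trans (integral_shift_le h _ _ _ mB mB' (mFx (rV_shift h x)) _ BB').
    apply: le_of_eq; apply: eq_integral => y _.
    by rewrite /F /energy_density/= /rV_shift edist_shift.
  by move=> y; exact: F0.
- by apply/measurable_EFinP; exact: measurable_energy_density.
- by move=> z; rewrite lee_fin energy_density_ge0.
Qed.

Lemma ae_eq_energy (u v : T -> R) (B : set T) : measurable B ->
  measurable_fun setT u -> measurable_fun setT v ->
  {ae mu, forall x, u x = v x} -> energy s p B u = energy s p B v.
Proof.
move=> mB mfu mfv uv.
have mEF (w : T -> R) : measurable_fun setT w ->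
  measurable_fun setT (EFin \o energy_density s p w).
  by move=> mw; apply/measurable_EFinP; exact: measurable_energy_density.
have F0 (w : T -> R) z : (0 <= (EFin \o energy_density s p w) z)%E by rewrite lee_fin energy_density_ge0.
rewrite (energyE s p B _ mB mfu) (energyE s p B _ mB mfv).
rewrite -(iterated_integral_restrict _ _ _ mB mB (mEF _ mfu) (F0 u)).
rewrite -(iterated_integral_restrict _ _ _ mB mB (mEF _ mfv) (F0 v)).
apply: ge0_ae_eq_integral.
- exact: mB.
- by apply: measurable_funTS; exact: (measurable_inner_integral _ _ mB (mEF _ mfu)).
- by apply: measurable_funTS; exact: (measurable_inner_integral _ _ mB (mEF _ mfv)).
- by move=> x _; apply: integral_ge0 => y _; exact: F0.
- by move=> x _; apply: integral_ge0 => y _; exact: F0.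
apply: filterS (uv) => x ux _; apply: ge0_ae_eq_integral.
- exact: mB.
- by apply: measurable_funTS; apply: (measurableT_comp (mEF _ mfu)); exact: measurable_pair1.
- by apply: measurable_funTS; apply: (measurableT_comp (mEF _ mfv)); exact: measurable_pair1.
- by move=> y _; exact: F0.
- by move=> y _; exact: F0.
by apply: filterS uv => y uy _; rewrite /= /energy_density/= ux uy.
Qed.

End energy_translation.

Section mollifier.
Context {R : realType} {n : nat}.
Local Notation mu := (@lebesgue_rV R n).
Local Notation T := (Rn R n).
Variable e : R.
Hypothesis e0 : 0 < e.
Local Notation K := (@bump_kernel R n e (fun=> 0)).

Lemma bump_kernel_eq0_far (z : T) : ~ eball 0 (n.+1%:R * e) z -> K z = 0.
Proof.
move=> nz; apply: contrapT => Kz; apply: nz; rewrite /eball/=.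
have ze i : `|z ord0 i| < e.
  by rewrite ltNge; apply/negP => ez; apply: Kz; exact: (bump_kernel0_eq0 e _ i).
apply: (le_lt_trans (edist_le_sum _ _)).
apply: (@le_lt_trans _ _ (\sum_(i < n) e)).
  by apply: ler_sum => i _; rewrite mxE subr0 ltW.
have -> : \sum_(i < n) e = n%:R * e by rewrite sumr_const card_ord mulr_natl.
by rewrite ltr_pM2r// ltr_nat.
Qed.

Lemma integrable_bump_kernel : mu.-integrable setT (EFin \o K).
Proof.
have [M M0 HM] := bump_kernel_bound (n := n) _ e0 (fun=> 0).
have mK : measurable_fun setT (K : T -> R) by exact: measurable_bump_kernel.
have mB : measurable (eball 0 (n.+1%:R * e) : set T) by exact: measurable_eball.
apply/integrableP; split; first exact/measurable_EFinP.
apply: (@le_lt_trans _ _ (M%:E * mu (eball 0 (n.+1%:R * e)))%E).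
  rewrite -integral_cst// [leRHS]integral_mkcond.
  apply: ge0_le_integral.
  - exact: measurableT.
  - by move=> x _; exact: abse_ge0.
  - by apply/measurable_EFinP; apply: measurableT_comp.
  - apply/(measurable_restrictT _ _).1; first exact: mB.
    exact: measurable_cst.
  move=> x _; rewrite patchE; case: ifPn => xB; first by rewrite lee_fin.
  rewrite /= bump_kernel_eq0_far ?normr0//.
  by move=> /mem_set Bx; rewrite Bx in xB.
rewrite lte_mul_pinfty//.
apply: (le_lt_trans (eball_volume_le _ _ _)); first by rewrite mulr_ge0// ltW.
by rewrite ltry.
Qed.

Hypothesis n0 : (0 < n)%N.

Lemma Rintegral_bump_kernel_gt0 : 0 < Rintegral mu setT (K : T -> R).
Proof.
have K0 (x : T) : 0 <= K x by exact: bump_kernel0_ge0.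
have RK0 : 0 <= Rintegral mu setT (K : T -> R).
  by apply: Rintegral_ge0 => x _; exact: K0.
rewrite lt_neqAle RK0 andbT eq_sym; apply/negP => /eqP RK.
have mK : measurable_fun setT (EFin \o K : T -> \bar R).
  by apply/measurable_EFinP; exact: measurable_bump_kernel.
have : (\int[mu]_x `|(EFin \o K) x| = 0)%E.
  have := integrable_fin_num measurableT integrable_bump_kernel.
  rewrite (eq_integral (EFin \o K : T -> \bar R)); last by move=> x _; rewrite /= ger0_norm.
  by move=> /fineK <-; congr EFin; exact: RK.
move/(ae_eq_integral_abs mu measurableT mK) => [N [mN N0 HN]].
have : (mu (eball 0 e) <= 0)%E.
  rewrite -N0; apply: le_measure; rewrite ?inE//; first exact: measurable_eball.
  move=> x Bx; apply: HN => /= /(_ Logic.I) [] Kx.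
  suff : 0 < K x by rewrite Kx ltxx.
  apply: bump_kernel0_gt0 => // i; apply: le_lt_trans Bx.
  by have := coord_le_edist x 0 i; rewrite mxE subr0.
rewrite leNgt => /negP; apply.
have := eball_volume_ge (0 : 'rV[R]_n) e n0 e0; apply: lt_le_trans.
by rewrite lte_fin exprn_gt0// divr_gt0// ltr0n.
Qed.

Variable v : T -> R.
Hypothesis iv : mu.-integrable setT (EFin \o v).

Definition mollify (x : 'rV[R]_n) : R :=
  (Rintegral mu setT (K : T -> R))^-1 * convolve v K x.

Lemma mollify_ge (c : R) (x : 'rV[R]_n) :
  (forall y : 'rV[R]_n, (forall i, `|y ord0 i - x ord0 i| < e) -> c <= v y) -> c <= mollify x.
Proof.
move=> cv; rewrite /mollify mulrC ler_pdivlMr ?Rintegral_bump_kernel_gt0//.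
have [M M0 HM] := bump_kernel_bound (n := n) _ e0 (fun=> 0).
have [i1 _] := Rintegral_bounded_mul _ iv _ M (measurable_kernel_shift e (fun=> 0) x) (fun y => HM _).
have iKx : mu.-integrable setT (EFin \o (fun y : T => K ((y : 'rV[R]_n) - x))).
  have := integrable_bump_kernel => /integrableP[mK fK].
  apply/integrableP; split; first exact: (measurableT_comp mK (measurable_rV_shift (- x))).
  apply: le_lt_trans fK; apply: le_of_eq.
  apply: (ge0_integral_shift (- x) (fun y => `|(EFin \o K) y|)%E).
    exact: measurableT_comp.
  by move=> y; exact: abse_ge0.
have -> : Rintegral mu setT (K : T -> R) = Rintegral mu setT (fun y : T => K ((y : 'rV[R]_n) - x)).
  congr fine; apply/esym; apply: (integral_shift (- x) (EFin \o K)).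
  by apply/measurable_EFinP; exact: measurable_bump_kernel.
rewrite -RintegralZl//; apply: le_Rintegral => //.
  exact: (integrableZl measurableT c iKx).
move=> y _ /=; have [Ky|Ky] := eqVneq (K ((y : 'rV[R]_n) - x)) 0.
  by rewrite Ky mulr0 mul0r.
rewrite mulrC ler_wpM2l ?bump_kernel0_ge0//; apply: cv => i.
rewrite ltNge; apply/negP => ey; move/eqP: Ky; apply.
by apply: (bump_kernel0_eq0 e _ i); rewrite !mxE.
Qed.

Lemma mollify_eq0 (x : 'rV[R]_n) :
  (forall y : 'rV[R]_n, (forall i, `|y ord0 i - x ord0 i| < e) -> v y = 0) -> mollify x = 0.
Proof.
move=> v0; rewrite /mollify /convolve (_ : (fun y : T => _) = cst 0).
  by rewrite Rintegral_cst// mul0r mulr0.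
apply/funext => y /=.
have [Ky|Ky] := eqVneq (K ((y : 'rV[R]_n) - x)) 0; first by rewrite Ky mul0r.
rewrite v0 ?mulr0// => i.
rewrite ltNge; apply/negP => ey; move/eqP: Ky; apply.
by apply: (bump_kernel0_eq0 e _ i); rewrite !mxE.
Qed.

Lemma Ck_mollify k : Ck k mollify.
Proof. exact: Ck_convolve. Qed.

End mollifier.

Section tonelli_square.
Context {d} {T : measurableType d} {R : realType}.
Variable m : {sigma_finite_measure set T -> \bar R}.

(** An alias of the product measure that carries a sigma-finite structure, so
   that Tonelli's theorem applies to it and a third variable. *)
Definition square_measure : set (T * T) -> \bar R := (m \x m)%E.

HB.instance Definition _ := Measure.on square_measure.

Let square_measure_sigma_finite : sigma_finite setT square_measure.
Proof.
have /sigma_finiteP[F [TF ndF Foo]] := sigma_finiteT m.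
exists (fun k => F k `*` F k).
  apply/esym; rewrite -subTset => -[x y] _.
  have : [set: T] x by []. rewrite TF => -[i _ Fix].
  have : [set: T] y by []. rewrite TF => -[j _ Fjy].
  exists (maxn i j) => //; split.
  - by move: x Fix; exact/subsetPset/ndF/leq_maxl.
  - by move: y Fjy; exact/subsetPset/ndF/leq_maxr.
move=> k; have [? ?] := Foo k; split; first exact: measurableX.
rewrite /square_measure product_measure1E//.
by rewrite lte_mul_pinfty// ge0_fin_numE.
Qed.

HB.instance Definition _ := Measure_isSigmaFinite.Build _ _ _ square_measure
  square_measure_sigma_finite.

Lemma tonelli_square (F : (T * T) * T -> \bar R) :
  measurable_fun setT F -> (forall z, 0 <= F z)%E ->
  [/\ (\int[m \x m]_z \int[m]_h F (z, h) = \int[m]_h \int[m \x m]_z F (z, h))%E,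
    measurable_fun setT (fun z => \int[m]_h F (z, h))%E &
    measurable_fun setT (fun h => \int[m \x m]_z F (z, h))%E].
Proof.
move=> mF F0; split.
- exact: (@fubini_tonelli _ _ _ _ R square_measure m F mF F0).
- exact: (@measurable_fun_fubini_tonelli_F _ _ _ _ R m F mF F0).
- exact: (@measurable_fun_fubini_tonelli_G _ _ _ _ R square_measure F mF F0).
Qed.

End tonelli_square.

Section energy_mollify.
Context {R : realType} {n : nat}.
Local Notation mu := (@lebesgue_rV R n).
Local Notation T := (Rn R n).
Local Notation mu2 := (mu \x mu)%E.
Variables (s p e : R).
Hypotheses (s0 : 0 < s) (p1 : 1 < p) (e0 : 0 < e) (n0 : (0 < n)%N).
Local Notation K := (@bump_kernel R n e (fun=> 0)).

Let p0 : 0 < p. Proof. exact: lt_trans ltr01 p1. Qed.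

Lemma measurable_tuple_of_rV_add :
  measurable_fun setT (fun z : T * T =>
    tuple_of_rV ((z.1 : 'rV[R]_n) + (z.2 : 'rV[R]_n))).
Proof.
apply/measurable_fun_tnthP => i.
rewrite (_ : _ \o _ = fun z : T * T => (z.1 : 'rV[R]_n) ord0 i + (z.2 : 'rV[R]_n) ord0 i).
  by apply: measurable_funD; apply: (measurableT_comp (measurable_coord i)).
by apply/funext => z /=; rewrite tnth_mktuple mxE.
Qed.

Section average.
Variables (rho : T -> R) (M : R) (g : n.-tuple (measurableTypeR R) -> R).
Hypotheses (rho0 : forall h, 0 <= rho h) (rhoM : forall h, `|rho h| <= M)
  (mrho : measurable_fun setT rho) (rho1 : (\int[mu]_x (rho x)%:E = 1)%E)
  (mg : measurable_fun setT g).

Let w (x : T) : R := g (tuple_of_rV x).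
Let W (x : T) : R := Rintegral mu setT (fun h => rho h * w (rV_shift x h)).

Hypothesis iw : mu.-integrable setT (EFin \o w).

Let mw : measurable_fun setT w.
Proof. exact: (measurableT_comp mg (@measurable_tuple_of_rV R n)). Qed.

Let mws (x : T) : measurable_fun setT (w \o rV_shift x).
Proof. exact: (measurableT_comp mw (measurable_rV_shift x)). Qed.

Lemma integrable_rV_shift (f : T -> R) (x : T) : mu.-integrable setT (EFin \o f) ->
  mu.-integrable setT (EFin \o (f \o rV_shift x)).
Proof.
move/integrableP => [mf ff]; apply/integrableP; split.
  exact: (measurableT_comp mf (measurable_rV_shift x)).
apply: le_lt_trans ff; apply: le_of_eq.
apply: (ge0_integral_shift x (fun y => `|(EFin \o f) y|)%E).
  exact: (measurableT_comp (@abse_measurable R setT) mf).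
by move=> y; exact: abse_ge0.
Qed.

Let W_dist (x y : T) :
  ((`|W x - W y| `^ p)%:E <=
   \int[mu]_h (rho h * `|w (rV_shift x h) - w (rV_shift y h)| `^ p)%:E)%E.
Proof.
have [ix _] := Rintegral_bounded_mul _ (integrable_rV_shift w x iw) _ _ mrho rhoM.
have [iy _] := Rintegral_bounded_mul _ (integrable_rV_shift w y iw) _ _ mrho rhoM.
rewrite /W -RintegralB; [|exact: measurableT|exact: ix|exact: iy].
under eq_Rintegral do rewrite -mulrBr.
apply: (jensen_powR mu rho (fun h => w (rV_shift x h) - w (rV_shift y h)) p p1 rho0 mrho).
- by apply: measurable_funB; exact: mws.
- exact: rho1.
rewrite (_ : _ \o _ = (EFin \o (fun h : T => (rho h * (w \o rV_shift x) h)%R)) \-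
   (EFin \o (fun h : T => (rho h * (w \o rV_shift y) h)%R)))%E.
  exact: (integrableB measurableT ix iy).
by apply/funext => h /=; rewrite mulrBr.
Qed.

Let G (z : (T * T) * T) : R :=
  rho z.2 * (`|w (rV_shift z.1.1 z.2) - w (rV_shift z.1.2 z.2)| `^ p /
    edist z.1.1 z.1.2 `^ (n%:R + s * p)).

Let mG : measurable_fun setT G.
Proof.
have mwf (f : (T * T) * T -> T) : measurable_fun setT f ->
    measurable_fun setT (fun z : (T * T) * T => w (rV_shift (f z) z.2)).
  move=> mf; have m2 : measurable_fun setT (fun z : (T * T) * T => (z.2, f z)).
    by apply: measurable_fun_pair => //; exact: measurable_snd.
  exact: (measurableT_comp mg (measurableT_comp measurable_tuple_of_rV_add m2)).
apply: measurable_funM; first exact: (measurableT_comp mrho measurable_snd).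
apply: measurable_funM.
  apply: (measurableT_comp (measurable_powR _)).
  apply: (measurableT_comp (@normr_measurable R setT)).
  apply: measurable_funB; apply: mwf.
    exact: (measurableT_comp measurable_fst measurable_fst).
  exact: (measurableT_comp measurable_snd measurable_fst).
apply: measurable_funV_ge0; first by move=> z; rewrite powR_ge0.
apply: (measurableT_comp (measurable_powR _)).
exact: (measurableT_comp (measurable_edist2) measurable_fst).
Qed.

(** An average of translates has at most the average of their energies:
   Jensen's inequality for the integrand, then Tonelli's theorem. The
   factorisation of [w] through tuples makes the integrand jointly measurable.
   *)
Lemma energy_average (B B' : set T) : measurable B -> measurable B' ->
  (forall x h, B x -> rho h != 0 -> B' (rV_shift h x)) ->
  measurable_fun setT W -> (energy s p B W <= energy s p B' w)%E.
Proof.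
move=> mB mB' BB' mm.
have E0 := energy_ge0 s p B' w.
rewrite (energyE s p B _ mB mm).
have mBB : measurable (B `*` B) by exact: measurableX.
pose F (z : (T * T) * T) : \bar R := (\1_(B `*` B) z.1 * G z)%:E.
have G0 z : 0 <= G z by rewrite mulr_ge0 ?rho0// divr_ge0 ?powR_ge0.
have F0 z : (0 <= F z)%E by rewrite lee_fin mulr_ge0.
have mF : measurable_fun setT F.
  apply/measurable_EFinP; apply: measurable_funM; last exact: mG.
  have mI : measurable_fun setT (\1_(B `*` B) : T * T -> R) by exact: measurable_indic.
  exact: (measurableT_comp mI measurable_fst).
have [swap mI1 mI2] := tonelli_square mu F mF F0.
have step1 : (\int[mu2]_(z in B `*` B) (energy_density s p (W) z)%:E <=
    \int[mu2]_z \int[mu]_h F (z, h))%E.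
  rewrite [leLHS]integral_mkcond; apply: ge0_le_integral.
  - exact: measurableT.
  - by move=> z _; rewrite patchE; case: ifP => // _; rewrite lee_fin energy_density_ge0.
  - apply/(measurable_restrictT _ _).1; first exact: mBB.
    by apply: measurable_funTS; apply/measurable_EFinP; exact: measurable_energy_density.
  - exact: mI1.
  move=> z _; rewrite patchE; case: ifPn => zB; last by apply: integral_ge0 => h _; exact: F0.
  have -> : (\int[mu]_h F (z, h) = \int[mu]_h ((rho h *
      `|w (rV_shift z.1 h) - w (rV_shift z.2 h)| `^ p)%:E *
      ((edist z.1 z.2 `^ (n%:R + s * p))^-1)%:E))%E.
    apply: eq_integral => h _; rewrite /F /G /= indicE zB mul1r -EFinM.
    by rewrite mulrA.
  rewrite ge0_integralZr.
  - rewrite /energy_density EFinM; apply: lee_wpmul2r; first by rewrite lee_fin invr_ge0 powR_ge0.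
    exact: W_dist.
  - exact: measurableT.
  - apply/measurable_EFinP; apply: measurable_funM; first exact: mrho.
    apply: (measurableT_comp (measurable_powR _)).
    apply: (measurableT_comp (@normr_measurable R setT)).
    by apply: measurable_funB; exact: (measurableT_comp mw (measurable_rV_shift _)).
  - by move=> h _; rewrite lee_fin mulr_ge0 ?rho0 ?powR_ge0.
  - by rewrite lee_fin invr_ge0 powR_ge0.
apply: (le_trans step1).
rewrite swap.
have step2 h : (\int[mu2]_z F (z, h) <= (rho h)%:E * energy s p B' w)%E.
  have -> : (\int[mu2]_z F (z, h) = (rho h)%:E * energy s p B (w \o rV_shift h))%E.
    rewrite (energyE s p B _ mB (mws h)) -ge0_integralZl.
    - rewrite [RHS]integral_mkcond; apply: eq_integral => z _; rewrite patchE /F /G/= indicE.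
      case: ifPn => zB; last by rewrite mul0r.
      by rewrite mul1r -EFinM /energy_density /= /rV_shift (addrC h) (addrC h).
    - exact: mBB.
    - by apply: measurable_funTS; apply/measurable_EFinP; exact: measurable_energy_density.
    - by move=> z _; rewrite lee_fin energy_density_ge0.
    - by rewrite lee_fin rho0.
  have [->|rn] := eqVneq (rho h) 0; first by rewrite !mul0e.
  apply: lee_wpmul2l; first by rewrite lee_fin rho0.
  apply: (energy_shift_le s p h w B B' mB mB' mw) => x Bx.
  exact: BB'.
apply: (@le_trans _ _ (\int[mu]_h ((rho h)%:E * energy s p B' w))%E).
  apply: ge0_le_integral.
  - exact: measurableT.
  - by move=> h _; apply: integral_ge0 => z _; exact: F0.
  - exact: mI2.
  - by apply: emeasurable_funM; [exact/measurable_EFinP|exact: measurable_cst].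
  by move=> h _; exact: step2.
rewrite ge0_integralZr; first by rewrite rho1 mul1e.
- exact: measurableT.
- exact/measurable_EFinP.
- by move=> h _; rewrite lee_fin rho0.
- exact: E0.
Qed.

End average.

Variable v : T -> R.
Hypothesis iv : mu.-integrable setT (EFin \o v).

Lemma ae_eq_integrable (w : T -> R) : measurable_fun setT w ->
  {ae mu, forall x, v x = w x} -> mu.-integrable setT (EFin \o w).
Proof.
move=> mw vw; move/integrableP : iv => [mEv fv].
have mEw : measurable_fun setT (EFin \o w) by exact/measurable_EFinP.
apply/integrableP; split; first exact: mEw.
apply: le_lt_trans fv; apply: le_of_eq.
apply: ge0_ae_eq_integral.
- exact: measurableT.
- exact: (measurableT_comp (@abse_measurable R setT) mEw).
- exact: (measurableT_comp (@abse_measurable R setT) mEv).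
- by move=> x _; exact: abse_ge0.
- by move=> x _; exact: abse_ge0.
by apply: filterS vw => x /= -> _.
Qed.

Let c : R := (Rintegral mu setT (K : T -> R))^-1.

Lemma mollifyE (w : T -> R) (x : T) : measurable_fun setT w ->
  {ae mu, forall x, v x = w x} ->
  mollify e v x = Rintegral mu setT (fun h : T => c * K h * w (rV_shift x h)).
Proof.
move=> mw vw; have iw := ae_eq_integrable w mw vw.
have mv : measurable_fun setT v by apply/measurable_EFinP; exact: (measurable_int mu iv).
rewrite /mollify -/c /convolve.
have [M M0 HM] := bump_kernel_bound (n := n) _ e0 (fun=> 0).
have mK := measurable_bump_kernel (R := R) (n := n) e (fun=> 0).
have [i1 _] := Rintegral_bounded_mul _ (integrable_rV_shift w x iw) _ M mK (fun y => HM _).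
have mKx := measurable_kernel_shift (R := R) (n := n) e (fun=> 0) x.
have mKv : measurable_fun setT (fun y : T => (K ((y : 'rV[R]_n) - x) * v y)%:E).
  by apply/measurable_EFinP; apply: measurable_funM; [exact: mKx|exact: mv].
have mKw : measurable_fun setT (fun y : T => (K ((y : 'rV[R]_n) - x) * w y)%:E).
  by apply/measurable_EFinP; apply: measurable_funM; [exact: mKx|exact: mw].
have -> : Rintegral mu setT (fun y : T => K ((y : 'rV[R]_n) - x) * v y) =
    Rintegral mu setT (fun h : T => K h * w (rV_shift x h)).
  congr fine.
  have -> : (\int[mu]_y (K ((y : 'rV[R]_n) - x) * v y)%:E =
      \int[mu]_y (K ((y : 'rV[R]_n) - x) * w y)%:E)%E.
    apply: ae_eq_integral.
    - exact: measurableT.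
    - exact: mKv.
    - exact: mKw.
    by apply: filterS vw => y /= -> _.
  rewrite -(integral_shift x _ mKw).
  by apply: eq_integral => h _; rewrite {1}/rV_shift addrK.
rewrite -RintegralZl; [|exact: measurableT|exact: i1].
by apply: eq_Rintegral => h _; rewrite mulrA.
Qed.

Lemma energy_mollify (B B' : set T) : measurable B -> measurable B' ->
  (forall x h : 'rV[R]_n, B x -> (forall i, `|h ord0 i| < e) -> B' (x + h)) ->
  (energy s p B (mollify e v) <= energy s p B' v)%E.
Proof.
move=> mB mB' BB'.
have mv : measurable_fun setT v by apply/measurable_EFinP; exact: (measurable_int mu iv).
have [g [mg vg]] := borel_representative v mv.
have mw := measurableT_comp mg (@measurable_tuple_of_rV R n).
have iw := ae_eq_integrable _ mw vg.
have mm : measurable_fun setT (mollify e v : T -> R).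
  by apply: continuous_measurable_rV; have [] := Ck_mollify e e0 v iv 0.
have c0 : 0 < c by rewrite invr_gt0; exact: Rintegral_bump_kernel_gt0.
have [M M0 HM] := bump_kernel_bound (n := n) _ e0 (fun=> 0).
pose rho (h : T) : R := c * K h.
have rho0 h : 0 <= rho h by rewrite mulr_ge0 ?bump_kernel0_ge0// ltW.
have rhoM h : `|rho h| <= c * M by rewrite normrM (gtr0_norm c0) ler_wpM2l// ltW.
have mK := measurable_bump_kernel (R := R) (n := n) e (fun=> 0).
have mrho : measurable_fun setT rho.
  by apply: measurable_funM; [exact: measurable_cst|exact: mK].
have rho1 : (\int[mu]_x (rho x)%:E = 1)%E.
  under eq_integral do rewrite EFinM.
  rewrite ge0_integralZl.
  - have iK := integrable_bump_kernel (n := n) e e0.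
    rewrite -(fineK (integrable_fin_num measurableT iK)) -EFinM.
    by rewrite (_ : c * _ = 1)// mulVf// gt_eqF//; exact: Rintegral_bump_kernel_gt0.
  - exact: measurableT.
  - exact/measurable_EFinP.
  - by move=> x _; rewrite lee_fin bump_kernel0_ge0.
  - by rewrite lee_fin ltW.
have mE : mollify e v = (fun x : T => Rintegral mu setT (fun h => rho h * g (tuple_of_rV (rV_shift x h)))).
  by apply/funext => x; rewrite (mollifyE _ x mw vg).
rewrite mE in mm *.
have := ae_eq_energy s p v _ B' mB' mv mw vg => ->.
apply: (energy_average rho _ g rho0 rhoM mrho rho1 mg iw B B' mB mB' _ mm) => x h Bx rh.
apply: BB' => // i; rewrite ltNge; apply/negP => eh; move/eqP: rh; apply.
by rewrite /rho (bump_kernel0_eq0 e _ i eh) mulr0.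
Qed.

End energy_mollify.

(** Uniform continuity of [g] and the positive distance from [K] to the
   complement of [U], by one compactness argument. *)
Lemma compact_uniform_box {R : realType} {n : nat} (K U : set 'rV[R]_n)
    (g : 'rV[R]_n -> R) (t : R) :
  compact K -> open U -> K `<=` U -> continuous g -> 0 < t ->
  exists2 e : R, 0 < e & forall x y : 'rV[R]_n, K x ->
    (forall i, `|y ord0 i - x ord0 i| < e) -> U y /\ g x - t <= g y.
Proof.
move=> cK oU KU cg t0.
pose P (e : R) (x : 'rV[R]_n) := forall y : 'rV[R]_n,
  (forall i, `|y ord0 i - x ord0 i| < e) -> U y /\ g x - t <= g y.
have H : \forall e \near (0 : R)^'+, K `<=` P e.
  move/compact_near_coveringP : cK; apply => x Kx.
  have : nbhs x (U `&` g @^-1` ball (g x) (t / 2)).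
    apply: filterI; first by apply: open_nbhs_nbhs; split => //; exact: KU.
    by apply: cg; apply: nbhsx_ballx; rewrite divr_gt0.
  move=> /nbhs_ballP[d /= d0 xd]; have d20 : 0 < d / 2 by rewrite divr_gt0.
  exists (ball x (d / 2), [set e | e < d / 2]).
    by split => /=; [exact: (@nbhsx_ballx R 'rV[R]_n x)|exact: nbhs_right_lt].
  move=> [x' e] /= [[_ xx'] ed] y yx'.
  have [_ gx'] : (U `&` g @^-1` ball (g x) (t / 2)) x'.
    by apply: xd; split => // i j; apply: lt_trans (xx' i j) _; lra.
  have [Uy gy] : (U `&` g @^-1` ball (g x) (t / 2)) y.
    apply: xd; split => // i j; rewrite (ord1 i); have := xx' ord0 j; have := yx' j.
    move=> h1 h2; have {h2} : `|x ord0 j - x' ord0 j| < d / 2 by exact: h2.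
    suff : `|x ord0 j - x' ord0 j| < d / 2 -> `|x ord0 j - y ord0 j| < d by [].
    move: h1; move: (y ord0 j) (x ord0 j) (x' ord0 j) => b a a'.
    by rewrite !ltr_norml => /andP[? ?] /andP[? ?]; apply/andP; split; lra.
  split => //; move: gx' gy; rewrite /ball/= !ltr_norml => /andP[? ?] /andP[? ?].
  by lra.
have e0 : \forall e \near (0 : R)^'+, 0 < e by exact: nbhs_right_gt.
have [e [He ee]] := @filter_ex _ ((0 : R)^'+) _ _ (filterI H e0).
by exists e => // x y Kx; exact: He.
Qed.

Section smoothing.
Context {R : realType} {n : nat}.
Local Notation mu := (@lebesgue_rV R n).
Local Notation T := (Rn R n).
Local Notation mu2 := (mu \x mu)%E.
Variables (s p : R).
Hypotheses (s0 : 0 < s) (p1 : 1 < p) (n0 : (0 < n)%N).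

Let p0 : 0 < p. Proof. exact: lt_trans ltr01 p1. Qed.

Lemma lp_mass_enlarge (v : T -> R) (B B' : set T) : measurable B -> measurable B' ->
  B `<=` B' -> (forall x, ~ B x -> v x = 0) -> lp_mass p B' v = lp_mass p B v.
Proof.
move=> mB mB' BB' v0; rewrite !lp_massE [LHS]integral_mkcond [RHS]integral_mkcond.
apply: eq_integral => x _; rewrite !patchE; case: ifPn => xB'.
  case: ifPn => // xB; rewrite v0 ?normr0 ?powR0 ?gt_eqF//.
  by move=> /mem_set Bx; rewrite Bx in xB.
case: ifPn => // xB; exfalso; move/negP : xB'; apply.
by apply/mem_set/BB'; exact: set_mem.
Qed.

Lemma integral_pair_sum (v : T -> R) (B : set T) : measurable B ->
  measurable_fun setT v ->
  (\int[mu2]_(z in B `*` B) (`|v z.1| `^ p + `|v z.2| `^ p)%:E =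
    2%:E * mu B * lp_mass p B v)%E.
Proof.
move=> mB mv; pose f (x : T) : R := `|v x| `^ p.
have mf : measurable_fun setT f by exact: measurable_powR_norm.
have mfB : measurable_fun B (EFin \o f) by apply/measurable_EFinP; exact: measurable_funTS.
have f0 x : (0 <= (f x)%:E)%E by rewrite lee_fin powR_ge0.
have mF : measurable_fun setT (fun z : T * T => (f z.1 + f z.2)%:E).
  apply/measurable_EFinP; apply: measurable_funD.
    exact: (measurableT_comp mf measurable_fst).
  exact: (measurableT_comp mf measurable_snd).
rewrite -(iterated_integral_restrict (fun z : T * T => (f z.1 + f z.2)%:E) B B mB mB mF); last first.
  by move=> z; rewrite EFinD adde_ge0.
have E x : (\int[mu]_(y in B) (f x + f y)%:E = (f x)%:E * mu B + lp_mass p B v)%E.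
  under eq_integral do rewrite EFinD.
  rewrite ge0_integralD.
  - by rewrite integral_cst// lp_massE.
  - exact: mB.
  - by move=> y _; exact: f0.
  - exact: measurable_cst.
  - by move=> y _; exact: f0.
  - exact: mfB.
have L0 : (0 <= lp_mass p B v)%E by exact: lp_mass_ge0.
have mB0 : (0 <= mu B)%E by exact: measure_ge0.
rewrite (eq_integral _ _ (fun x _ => E x)) ge0_integralD.
- rewrite integral_cst// ge0_integralZr.
  + rewrite -lp_massE [X in (X + _)%E]muleC.
    rewrite (_ : 2%:E = 1 + 1)%E// [X in (_ = X * _)%E]ge0_muleDl// mul1e.
    by rewrite [RHS]ge0_muleDl// [X in (_ + X)%E]muleC.
  + exact: mB.
  + exact: mfB.
  + by move=> y _; exact: f0.
  + exact: mB0.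
- exact: mB.
- by move=> x _; rewrite mule_ge0.
- by apply: emeasurable_funM; [exact: mfB|exact: measurable_cst].
- by move=> x _; exact: L0.
- exact: measurable_cst.
Qed.

(** A pair with one point outside the ball contributes only when the other
   point is in the support of [v], hence at distance at least [r / 4]. *)
Lemma energy_enlarge : exists2 C : R, 0 < C & forall x0 (r : R) (v : T -> R), 0 < r ->
  measurable_fun setT v -> (forall x, 3 / 4 * r <= edist x x0 -> v x = 0) ->
  (energy s p (eball x0 (5 / 4 * r)) v <=
    energy s p (eball x0 r) v + (C * r `^ (- (s * p)))%:E * lp_mass p (eball x0 r) v)%E.
Proof.
exists (4 `^ (n%:R + s * p) * (2 * (5 / 2) ^+ n)) => [|x0 r v r0 mv v0].
  by rewrite mulr_gt0 ?powR_gt0// mulr_gt0// exprn_gt0.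
pose B : set T := eball x0 r; pose B' : set T := eball x0 (5 / 4 * r); rewrite -/B -/B'.
have mB : measurable B by exact: measurable_eball.
have mB' : measurable B' by exact: measurable_eball.
have BB' : B `<=` B' by apply: sub_eball; lra.
have r40 : 0 < r / 4 by rewrite divr_gt0.
pose k : R := ((r / 4) `^ (n%:R + s * p))^-1.
have k0 : 0 <= k by rewrite invr_ge0 powR_ge0.
have mBB : measurable (B `*` B) by exact: measurableX.
have mBB' : measurable (B' `*` B') by exact: measurableX.
have nsp : 0 <= n%:R + s * p by rewrite addr_ge0// mulr_ge0// ltW.
have md : measurable_fun setT (energy_density s p v) by exact: measurable_energy_density.
pose d1 (z : T * T) : R := \1_(B `*` B) z * energy_density s p v z.
have mI : measurable_fun setT (\1_(B `*` B) : T * T -> R) by exact: measurable_indic.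
have md1 : measurable_fun setT d1 by exact: measurable_funM.
have d10 z : 0 <= d1 z by rewrite mulr_ge0// energy_density_ge0.
have mvp : measurable_fun setT (fun x => `|v x| `^ p) by exact: measurable_powR_norm.
pose h (z : T * T) : R := `|v z.1| `^ p + `|v z.2| `^ p.
have mh : measurable_fun setT h.
  apply: measurable_funD; first exact: (measurableT_comp mvp measurable_fst).
  exact: (measurableT_comp mvp measurable_snd).
have h0 z : 0 <= h z by rewrite addr_ge0 ?powR_ge0.
have out x : ~ B x -> v x = 0 /\ r <= edist x x0.
  move=> nB; have rx : r <= edist x x0 by rewrite leNgt; apply/negP.
  by split => //; apply: v0; apply: le_trans rx; lra.
have far x y : ~ B x -> energy_density s p v (x, y) <= k * `|v y| `^ p.
  move=> /out[vx rx]; rewrite /energy_density/= vx sub0r normrN mulrC.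
  have [vy|vy] := eqVneq (v y) 0.
    by rewrite vy normr0 powR0 ?gt_eqF// !mulr0.
  rewrite ler_wpM2r ?powR_ge0//.
  have dy : edist y x0 < 3 / 4 * r.
    by rewrite ltNge; apply/negP => /v0 vy0; rewrite vy0 eqxx in vy.
  have dxy : r / 4 <= edist x y by have := euclid_triangle y x x0; lra.
  have dxy0 : 0 < edist x y by exact: lt_le_trans dxy.
  rewrite lef_pV2 ?posrE ?powR_gt0//.
  by apply: ge0_ler_powR; rewrite ?nnegrE ?(ltW r40) ?(ltW dxy0).
have pt z : energy_density s p v z <= 1 * d1 z + k * h z.
  rewrite mul1r /d1 indicE; have [zB|zB] := boolP (z \in _).
    by rewrite mul1r lerDl mulr_ge0.
  rewrite mul0r add0r /h mulrDr.
  have [Bx|nBx] := pselect (B z.1); last first.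
    case: z {zB} nBx => x y /= nBx; apply: (le_trans (far x y nBx)).
    by rewrite lerDr mulr_ge0 ?powR_ge0.
  have nBy : ~ B z.2.
    by move=> By; move/negP : zB; apply; apply/mem_set.
  case: z {zB Bx} nBy => x y /= nBy.
  have -> : energy_density s p v (x, y) = energy_density s p v (y, x).
    by rewrite /energy_density/= distrC euclid_sym.
  apply: (le_trans (far y x nBy)).
  by rewrite lerDl mulr_ge0 ?powR_ge0.
rewrite (energyE s p B' v mB' mv).
have H : (\int[mu2]_(z in B' `*` B') (energy_density s p v z)%:E <=
  1%:E * \int[mu2]_(z in B' `*` B') (d1 z)%:E + k%:E * \int[mu2]_(z in B' `*` B') (h z)%:E)%E.
  apply: ge0_integral_le_comb.
  - exact: mBB'.
  - exact: ler01.
  - exact: k0.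
  - by move=> z; exact: energy_density_ge0.
  - exact: d10.
  - exact: h0.
  - exact: measurable_funTS.
  - exact: measurable_funTS.
  - exact: measurable_funTS.
  - by move=> z _; exact: pt.
apply: (le_trans H); rewrite mul1e; apply: leeD.
  rewrite (energyE s p B v mB mv) [leRHS]integral_mkcond.
  apply: (@le_trans _ _ (\int[mu2]_z (d1 z)%:E)%E).
    apply: ge0_subset_integral.
    - exact: mBB'.
    - exact: measurableT.
    - exact/measurable_EFinP.
    - by move=> z _; rewrite lee_fin.
    - by [].
  apply: le_of_eq; apply: eq_integral => z _.
  rewrite patchE /d1 indicE; case: ifPn => _; first by rewrite mul1r.
  by rewrite mul0r.
rewrite (integral_pair_sum v B' mB' mv).
rewrite (lp_mass_enlarge v B B' mB mB' BB'); last by move=> x /out[].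
have L0 : (0 <= lp_mass p B v)%E by exact: lp_mass_ge0.
rewrite !muleA; apply: lee_wpmul2r; first exact: L0.
have HB := eball_volume_le x0 (5 / 4 * r); rewrite -/B' in HB.
have {}HB : (mu B' <= ((5 / 2 * r) ^+ n)%:E)%E.
  rewrite (_ : 5 / 2 * r = 2 * (5 / 4 * r)); last by field.
  by apply: HB; rewrite mulr_ge0// ltW.
apply: (@le_trans _ _ (k%:E * 2%:E * ((5 / 2 * r) ^+ n)%:E)%E).
  by apply: lee_wpmul2l => //; rewrite -EFinM lee_fin mulr_ge0.
rewrite -!EFinM lee_fin /k powRM ?(ltW r0) ?invr_ge0//.
rewrite -(powR_inv1 (_ : 0 <= 4))// -powRrM mulN1r !powRN.
rewrite powRD ?(gt_eqF r0) ?implybT// powR_mulrn ?(ltW r0)// exprMn.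
have h1 : 4 `^ (n%:R + s * p) != 0 :> R by rewrite gt_eqF ?powR_gt0.
have h2 : r `^ (s * p) != 0 by rewrite gt_eqF ?powR_gt0.
have h3 : r ^+ n != 0 by rewrite gt_eqF ?exprn_gt0.
apply: le_of_eq; move: h1 h2 h3 => h1 h2 h3.
by field; rewrite h1 h2 h3.
Qed.

Lemma integrable_of_lp_mass (v : T -> R) (B : set T) : measurable B ->
  (mu B < +oo)%E -> measurable_fun setT v -> (forall x, ~ B x -> v x = 0) ->
  (lp_mass p B v < +oo)%E -> mu.-integrable setT (EFin \o v).
Proof.
move=> mB fB mv v0 fv; apply/integrableP; split; first exact/measurable_EFinP.
have mvp : measurable_fun setT (fun x => `|v x| `^ p) by exact: measurable_powR_norm.
have H : (\int[mu]_(x in B) (`|v x|)%:E <=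
    1%:E * \int[mu]_(x in B) (1%R)%:E + 1%:E * \int[mu]_(x in B) (`|v x| `^ p)%:E)%E.
  apply: ge0_integral_le_comb.
  - exact: mB.
  - exact: ler01.
  - exact: ler01.
  - by move=> x; exact: normr_ge0.
  - by move=> x; exact: ler01.
  - by move=> x; exact: powR_ge0.
  - by apply: measurable_funTS; exact: (measurableT_comp (@normr_measurable R setT) mv).
  - exact: measurable_cst.
  - exact: measurable_funTS.
  move=> x _; rewrite !mul1r; have [v1|v1] := leP `|v x| 1.
    by apply: (le_trans v1); rewrite lerDl powR_ge0.
  rewrite -[leLHS]add0r lerD// -[leLHS]powRr1 ?normr_ge0//.
  by apply: ler_powR; exact: ltW.
rewrite [ltLHS](_ : _ = \int[mu]_(x in B) (`|v x|)%:E)%E.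
  apply: (le_lt_trans H); rewrite !mul1e integral_cst// mul1e -lp_massE.
  exact: lte_add_pinfty.
rewrite [RHS]integral_mkcond; apply: eq_integral => x _; rewrite patchE.
case: ifPn => // xB; rewrite /= v0 ?normr0//.
by move=> /mem_set Bx; rewrite Bx in xB.
Qed.

(** The support of [v] keeps a distance from the sphere, so a mollification at
   a small scale is a test function on the ball. Its energy is that of [v] on
   a slightly larger ball, and on [K] it averages values of [v] over boxes
   contained in [U]. *)
Lemma smoothing : exists2 C : R, 0 < C & forall x0 (r : R) (v : T -> R)
    (K U : set 'rV[R]_n) (g : 'rV[R]_n -> R) (t : R), 0 < r ->
  measurable_fun setT v -> (forall x, 3 / 4 * r <= edist x x0 -> v x = 0) ->
  (lp_mass p (eball x0 r) v < +oo)%E ->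
  compact K -> open U -> K `<=` U -> continuous g -> (forall x, U x -> g x <= v x) ->
  0 < t ->
  exists w : 'rV[R]_n -> R, [/\ Cc_infty (eball x0 r) w,
    (forall x, K x -> g x - t <= w x) &
    (energy s p (eball x0 r) w <= energy s p (eball x0 r) v +
       (C * r `^ (- (s * p)))%:E * lp_mass p (eball x0 r) v)%E].
Proof.
have [C C0 HC] := energy_enlarge.
exists C => // x0 r v K U g t r0 mv v0 fv cK oU KU cg gv t0.
pose B : set T := eball x0 r; rewrite -/B in fv *.
have mB : measurable B by exact: measurable_eball.
have fB : (mu B < +oo)%E.
  by apply: (le_lt_trans (eball_volume_le x0 r (ltW r0))); rewrite ltry.
have out x : ~ B x -> v x = 0.
  by move=> nB; apply: v0; have : r <= edist x x0 by [rewrite leNgt; apply/negP]; lra.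
have iv : mu.-integrable setT (EFin \o v) by exact: (integrable_of_lp_mass v B).
have [e1 e10 He1] := compact_uniform_box K U g t cK oU KU cg t0.
pose e := Num.min e1 (r / 8 / n%:R).
have n0' : 0 < n%:R :> R by rewrite ltr0n.
have e0 : 0 < e by rewrite lt_min e10 !divr_gt0.
have small (z : 'rV[R]_n) : (forall i, `|z ord0 i| < e) -> edist z 0 < r / 8.
  move=> ze; have nr : n%:R * (r / 8 / n%:R) = r / 8 by field; rewrite gt_eqF.
  apply: (le_lt_trans (edist_le_sum _ _)); rewrite -nr.
  have -> : n%:R * (r / 8 / n%:R) = \sum_(i < n) (r / 8 / n%:R).
    by rewrite sumr_const card_ord mulr_natl.
  apply: ltr_sum; first by apply/hasP; exists (Ordinal n0); rewrite ?mem_index_enum.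
  move=> i _; rewrite mxE subr0; apply: (lt_le_trans (ze i)).
  by rewrite ge_min lexx orbT.
have small2 (x y : 'rV[R]_n) : (forall i, `|y ord0 i - x ord0 i| < e) -> edist y x < r / 8.
  by move=> yx; rewrite edist_subr; apply: small => i; rewrite !mxE.
have supp : closure [set x | mollify e v x != 0] `<=` cball x0 (7 / 8 * r).
  rewrite (closure_id (cball x0 (7 / 8 * r))).1; last exact: closed_cball.
  apply: closureS => x /= mx; rewrite /cball/= leNgt; apply/negP => rx.
  move/eqP : mx; apply; apply: (mollify_eq0 e v) => y yx; apply: v0.
  by have := euclid_triangle y x x0; have := small2 _ _ yx; rewrite (euclid_sym x y); lra.
exists (mollify e v); split.
- split.
  + by move=> k; exact: (Ck_mollify e e0 v iv k).
  + exact: (subclosed_compact (@closed_closure _ _) (compact_cball x0 (7 / 8 * r))).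
  + by apply: (subset_trans supp) => x; rewrite /cball /B /eball/=; lra.
- move=> x Kx; apply: (mollify_ge e e0 n0 v iv) => y yx.
  have [Uy gy] : U y /\ g x - t <= g y.
    apply: He1 => // i; apply: (lt_le_trans (yx i)).
    by rewrite ge_min lexx.
  by apply: (le_trans gy); exact: gv.
apply: le_trans (HC x0 r v r0 mv v0).
apply: (energy_mollify s p e p1 e0 n0 v iv B (eball x0 (5 / 4 * r)) mB).
  exact: measurable_eball.
move=> x h Bx he; rewrite /eball/=.
apply: (le_lt_trans (euclid_triangle x _ _)).
have : edist (x + h) x < r / 8 by apply: small2 => i; rewrite mxE (addrC (x _ _)) addrK.
by move: Bx; rewrite /B /eball/=; lra.
Qed.

End smoothing.

(** * Test functions and capacity *)

Section test_functions.
Context {R : realType} {n : nat}.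
Implicit Types (u v : 'rV[R]_n -> R) (Om : set 'rV[R]_n).

Lemma Ck_comb k u v (a b : R) : Ck k u -> Ck k v -> Ck k (fun x => a * u x + b * v x).
Proof.
have cont u' v' : continuous u' -> continuous v' ->
    continuous (fun x : 'rV[R]_n => a * u' x + b * v' x).
  move=> cu cv x; apply: (@continuousD R R 'rV[R]_n (fun x => a * u' x) (fun x => b * v' x)).
    by apply: (@continuousM R 'rV[R]_n (cst a) u'); [exact: cst_continuous|exact: cu].
  by apply: (@continuousM R 'rV[R]_n (cst b) v'); [exact: cst_continuous|exact: cv].
elim: k u v => [|k IHk] u v [cu Hu] [cv Hv]; split; try exact: cont.
  by [].
move=> i; have [du Du] := Hu i; have [dv Dv] := Hv i.
have D x : is_derive x (delta_mx ord0 i : 'rV[R]_n) (fun x => a * u x + b * v x)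
    (a * 'D_(delta_mx ord0 i) u x + b * 'D_(delta_mx ord0 i) v x).
  have du' : is_derive x (delta_mx ord0 i : 'rV[R]_n) u ('D_(delta_mx ord0 i) u x).
    exact/derivableP.
  have dv' : is_derive x (delta_mx ord0 i : 'rV[R]_n) v ('D_(delta_mx ord0 i) v x).
    exact/derivableP.
  exact: (is_deriveD (is_deriveZ a du') (is_deriveZ b dv')).
split=> [x|]; first by have [] := D x.
rewrite (_ : (fun x => _) = fun x => a * 'D_(delta_mx ord0 i) u x + b * 'D_(delta_mx ord0 i) v x).
  exact: IHk.
by apply/funext => x; rewrite derive_val.
Qed.

Lemma Cc_infty_comb Om u v (a b : R) :
  Cc_infty Om u -> Cc_infty Om v -> Cc_infty Om (fun x => a * u x + b * v x).
Proof.
move=> [su cu uO] [sv cv vO].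
have sub : closure [set x | a * u x + b * v x != 0] `<=`
    closure [set x | u x != 0] `|` closure [set x | v x != 0].
  rewrite -closureU; apply: closureS => x /=; apply: contraNP => /not_orP[].
  by move=> /negP/negPn/eqP -> /negP/negPn/eqP ->; rewrite !mulr0 addr0.
split; first by move=> k; exact: Ck_comb.
- by apply: (subclosed_compact (@closed_closure _ _) _ sub); exact: compactU.
- by apply: (subset_trans sub) => x [/uO|/vO].
Qed.

Lemma Cc_infty_scale Om u (a : R) : Cc_infty Om u -> Cc_infty Om (fun x => a * u x).
Proof.
move=> su; have := Cc_infty_comb Om u u a 0 su su.
by rewrite (_ : (fun x => _) = fun x => a * u x)//; apply/funext => x; rewrite mul0r addr0.
Qed.

Lemma Cc_infty_measurable Om u : Cc_infty Om u ->
  measurable_fun setT (u : Rn R n -> R).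
Proof. by move=> [su _ _]; apply: continuous_measurable_rV; have [] := su 0%N. Qed.

End test_functions.

Section capacity.
Context {R : realType} {n : nat}.
Local Notation mu := (@lebesgue_rV R n).
Local Notation T := (Rn R n).
Variables (s p : R).
Hypotheses (n0 : (0 < n)%N) (s0 : 0 < s) (s1 : s < 1) (p1 : 1 < p).

Let p0 : 0 < p. Proof. exact: lt_trans ltr01 p1. Qed.

Lemma cap_compact_ge0 (B K : set 'rV[R]_n) : (0 <= cap_compact s p B K)%E.
Proof.
by apply: le_ereal_inf_tmp => _ [u _ <-]; rewrite -energy_gagliardo; exact: energy_ge0.
Qed.

Lemma cap_compact_le (B K : set 'rV[R]_n) (w : 'rV[R]_n -> R) (a : R) :
  measurable (B : set T) -> 0 < a -> Cc_infty B w -> (forall x, K x -> a <= w x) ->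
  (cap_compact s p B K <= (a^-1 `^ p)%:E * energy s p B w)%E.
Proof.
move=> mB a0 sw aw; have mw := Cc_infty_measurable B w sw.
have H := energy_affine s p B w a^-1 0 mB mw.
rewrite (gtr0_norm (_ : 0 < a^-1)) ?invr_gt0// in H.
apply: le_trans H; rewrite energy_gagliardo; apply: ereal_inf_lbound.
exists (fun x => a^-1 * w x + 0) => //; split.
  rewrite (_ : (fun x => _) = fun x => a^-1 * w x); first exact: Cc_infty_scale.
  by apply/funext => x; rewrite addr0.
by move=> x Kx; rewrite addr0 mulrC ler_pdivlMr// mul1r; exact: aw.
Qed.

(** Multiplication by the cutoff supplies the compact support required by
   [smoothing] without changing [h] near [K]. *)
Lemma cutoff_smoothing : exists2 C : R, 0 < C & forall x0 (r : R) (h : T -> R)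
    (K U : set 'rV[R]_n) (g : 'rV[R]_n -> R) (t : R), 0 < r ->
  measurable_fun setT h -> (lp_mass p (eball x0 r) h < +oo)%E ->
  compact K -> (forall x, K x -> edist x x0 <= r / 2) ->
  open U -> K `<=` U -> continuous g -> (forall x, U x -> g x <= h x) -> 0 < t ->
  exists w : 'rV[R]_n -> R, [/\ Cc_infty (eball x0 r) w,
    (forall x, K x -> g x - t <= w x) &
    (energy s p (eball x0 r) w <= C%:E * (energy s p (eball x0 r) h +
       (r `^ (- (s * p)))%:E * lp_mass p (eball x0 r) h))%E].
Proof.
have [C1 C10 H1] := smoothing s p s0 p1 n0.
have [C2 C20 H2] := energy_cutoff s p n0 s0 s1 p1.
exists (C2 + C1) => [|x0 r h K U g t r0 mh fh cK Kr oU KU cg gh t0]; first exact: addr_gt0.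
pose B : set T := eball x0 r; rewrite -/B in fh *.
have mB : measurable B by exact: measurable_eball.
pose v (x : T) : R := cutoff x0 r x * h x.
have mv : measurable_fun setT v by apply: measurable_funM; [exact: measurable_cutoff|exact: mh].
have v0 x : 3 / 4 * r <= edist x x0 -> v x = 0.
  by move=> xr; rewrite /v cutoff_eq0// mul0r.
have vh : (lp_mass p B v <= lp_mass p B h)%E.
  apply: (le_lp_mass p p1) => //; try exact: measurable_funTS.
  move=> x _; rewrite normrM ler_piMl// ger0_norm ?cutoff_ge0//.
  exact: cutoff_le1.
have oU' : open (U `&` eball x0 (5 / 8 * r)) by apply: openI => //; exact: open_eball.
have KU' : K `<=` U `&` eball x0 (5 / 8 * r).
  move=> x Kx; split; first exact: KU.
  by rewrite /eball/=; apply: (le_lt_trans (Kr x Kx)); lra.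
have gv x : (U `&` eball x0 (5 / 8 * r)) x -> g x <= v x.
  by move=> [Ux xr]; rewrite /v cutoff_eq1 ?mul1r//; [exact: gh|exact: ltW].
have [w [sw gw Ew]] := H1 x0 r v K _ g t r0 mv v0 (le_lt_trans vh fh) cK oU' KU' cg gv t0.
exists w; split => //; apply: (le_trans Ew); rewrite -/B.
have Ev := H2 x0 r r0 h mh; rewrite -/B -/v in Ev.
have E0 := energy_ge0 s p B h; have L0 := lp_mass_ge0 p B h.
have rs : 0 <= r `^ (- (s * p)) by exact: powR_ge0.
apply: (le_trans (leeD Ev (lee_wpmul2l _ vh))).
  by rewrite lee_fin mulr_ge0// ltW.
move: (energy s p B h) (lp_mass p B h) (r `^ _) E0 L0 rs fh => [Eh| |] [Lh| |] k //.
  rewrite !lee_fin => E0 L0 k0 _.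
  suff H : C2 * (Eh + k * Lh) + C1 * k * Lh <= (C2 + C1) * (Eh + k * Lh) by exact: H.
  have h1 : 0 <= C1 * Eh by rewrite mulr_ge0// ltW.
  by rewrite mulrDl !mulrDr !mulrA; lra.
move=> _ _ _ _; rewrite [X in (_ <= _ * X)%E]addye// [leRHS]mulry gtr0_sg ?addr_gt0// mul1e.
exact: leey.
Qed.


(** A smoothing of [h] is at least [a / 2] on [K]; divided by [a / 2] it is
   admissible. *)
Lemma cap_compact_le_energy : exists2 C : R, 0 < C & forall x0 (r : R) (h : T -> R)
    (K U : set 'rV[R]_n) (a : R), 0 < r ->
  measurable_fun setT h -> (lp_mass p (eball x0 r) h < +oo)%E ->
  compact K -> (forall x, K x -> edist x x0 <= r / 2) ->
  open U -> K `<=` U -> 0 < a -> (forall x, U x -> a <= h x) ->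
  (cap_compact s p (eball x0 r) K <= (C * a^-1 `^ p)%:E * (energy s p (eball x0 r) h +
     (r `^ (- (s * p)))%:E * lp_mass p (eball x0 r) h))%E.
Proof.
have [C C0 H] := cutoff_smoothing; exists (2 `^ p * C).
  by rewrite mulr_gt0// powR_gt0.
move=> x0 r h K U a r0 mh fh cK Kr oU KU a0 ah.
have a20 : 0 < a / 2 by rewrite divr_gt0.
have ca : continuous (fun _ : 'rV[R]_n => a) by exact: cst_continuous.
have [w [sw aw Ew]] := H x0 r h K U (fun=> a) (a / 2) r0 mh fh cK Kr oU KU ca ah a20.
have {}aw x : K x -> a / 2 <= w x by move=> /aw; lra.
have mB : measurable (eball x0 r : set T) by exact: measurable_eball.
apply: (le_trans (cap_compact_le _ K w (a / 2) mB a20 sw aw)).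
have -> : (a / 2)^-1 `^ p = 2 `^ p * a^-1 `^ p.
  by rewrite invf_div -powRM ?invr_ge0 ?(ltW a0).
rewrite [X in (_ <= X%:E * _)%E]mulrAC [X in (_ <= X * _)%E]EFinM -[leRHS]muleA; apply: lee_wpmul2l; last exact: Ew.
by rewrite lee_fin mulr_ge0 ?powR_ge0.
Qed.

(** Tested with the constant [1], whose energy vanishes. *)
Lemma cap_compact_le_radius : exists2 C : R, 0 < C & forall x0 (r : R) (K : set 'rV[R]_n),
  0 < r -> compact K -> (forall x, K x -> edist x x0 <= r / 2) ->
  (cap_compact s p (eball x0 r) K <= (C * r `^ (n%:R - s * p))%:E)%E.
Proof.
have [C C0 H] := cap_compact_le_energy; exists (C * 2 ^+ n).
  by rewrite mulr_gt0// exprn_gt0.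
move=> x0 r K r0 cK Kr; pose B : set T := eball x0 r; rewrite -/B in H *.
have mB : measurable B by exact: measurable_eball.
have vB : (mu B <= ((2 * r) ^+ n)%:E)%E by exact: eball_volume_le (ltW r0).
have m1 : measurable_fun setT ((fun=> 1) : T -> R) by exact: measurable_cst.
have L1 : (lp_mass p B (fun=> 1%R) <= ((2 * r) ^+ n)%:E)%E.
  by rewrite lp_mass_cst// normr1 powR1 mul1e.
have E1 : (energy s p B (fun=> 1%R) <= 0)%E.
  have m0 : measurable_fun setT ((fun=> 0) : T -> R) by exact: measurable_cst.
  have := energy_affine s p B (fun=> 0) 0 1 mB m0.
  by rewrite normr0 powR0 ?gt_eqF// mul0e (_ : (fun=> _) = fun=> 1)//; apply/funext => x; rewrite mul0r add0r.
have := H x0 r (fun=> 1) K setT 1 r0 m1 (le_lt_trans L1 (ltry _)) cK Kr openT _ ltr01.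
move=> /(_ (@subsetT _ _) (fun _ _ => lexx _)) /le_trans; apply.
rewrite invr1 powR1 mulr1 -/B.
apply: (@le_trans _ _ (C%:E * (0 + (r `^ (- (s * p)))%:E * ((2 * r) ^+ n)%:E))%E).
  apply: lee_wpmul2l; first by rewrite lee_fin ltW.
  by apply: leeD => //; apply: lee_wpmul2l => //; rewrite lee_fin powR_ge0.
rewrite add0e -!EFinM lee_fin exprMn; apply: le_of_eq.
rewrite powRD ?(gt_eqF r0) ?implybT// powR_mulrn ?(ltW r0)//; ring.
Qed.

(** Let [m] be the Poincare constant of [f]. Adding to [f] a smoothing of [m -
   f] yields, for positive [m], a test function that is at least [m / 2] on
   [K] and whose energy is comparable with that of [f]. Hence [m^p] is at most
   the energy over the capacity, up to a constant. *)
Lemma friedrichs x0 (r : R) (K : set 'rV[R]_n) : 0 < r -> compact K ->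
  (forall x, K x -> edist x x0 <= r / 2) ->
  (0 < cap_compact s p (eball x0 r) K)%E ->
  exists2 M : R, 0 < M & forall (f : 'rV[R]_n -> R) (k : R),
    Cc_infty (eball x0 r) f -> (energy s p (eball x0 r) f < k%:E)%E ->
    (lp_mass p (eball x0 r) f <= (M * k)%:E)%E.
Proof.
move=> r0 cK Kr cap0; pose B : set T := eball x0 r; rewrite -/B in cap0 *.
have mB : measurable B by exact: measurable_eball.
have vB : (mu B <= ((2 * r) ^+ n)%:E)%E by exact: eball_volume_le (ltW r0).
have [C1 C10 HP] := poincare (n := n) s p n0 s0 p1.
have [C2 C20 HS] := cutoff_smoothing.
have [C3 C30 HC] := cap_compact_le_radius.
have capE : cap_compact s p B K = (fine (cap_compact s p B K))%:E.
  rewrite fineK// ge0_fin_numE ?(ltW cap0)//.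
  by apply: (le_lt_trans (HC x0 r K r0 cK Kr)); rewrite ltry.
set c := fine _ in capE.
have c0 : 0 < c by rewrite -lte_fin -capE.
pose k1 := C1 * r `^ (s * p).
have k10 : 0 < k1 by rewrite mulr_gt0 ?powR_gt0.
pose k2 := 2 `^ p * (2 `^ p * (1 + C2 * (1 + r `^ (- (s * p)) * k1))).
have k20 : 0 < k2.
  rewrite !mulr_gt0 ?powR_gt0// ltr_wpDr// mulr_ge0 ?(ltW C20)// addr_ge0//.
  by rewrite mulr_ge0 ?powR_ge0// ltW.
have mean (f : 'rV[R]_n -> R) (k m : R) : Cc_infty B f -> (energy s p B f < k%:E)%E ->
    (lp_mass p B (fun x => (m - f x)%R) <= (k1 * k)%:E)%E -> 0 < m ->
    m `^ p * c <= k2 * k.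
  move=> sf Ef Lf m0; have mf := Cc_infty_measurable B f sf.
  have mmf : measurable_fun setT (fun x : T => m - f x).
    by apply: measurable_funB; [exact: measurable_cst|exact: mf].
  have cmf : continuous (fun x : 'rV[R]_n => m - f x).
    move=> x; apply: (@continuousB R R 'rV[R]_n (cst m) f); first exact: cst_continuous.
    by have [sf0 _ _] := sf; have [cf _] := sf0 0%N; exact: cf.
  have m20 : 0 < m / 2 by rewrite divr_gt0.
  have [w [sw gw Ew]] := HS x0 r _ K setT _ (m / 2) r0 mmf (le_lt_trans Lf (ltry _)) cK Kr
    openT (@subsetT _ _) cmf (fun x _ => lexx _) m20.
  have mw := Cc_infty_measurable _ w sw.
  have sfw : Cc_infty B (fun x => f x + w x).
    have := Cc_infty_comb B f w 1 1 sf sw.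
    by rewrite (_ : (fun x => _) = fun x => f x + w x)//; apply/funext => x; rewrite !mul1r.
  have fw x : K x -> m / 2 <= f x + w x by move=> /gw; lra.
  have := cap_compact_le B K _ (m / 2) mB m20 sfw fw.
  rewrite capE => Hc.
  have Emf : (energy s p B (fun x => (m - f x)%R) <= k%:E)%E.
    have := energy_affine s p B f (-1) m mB mf.
    rewrite normrN1 powR1 mul1e (_ : (fun x => _) = fun x => m - f x).
      by move=> /le_trans; apply; exact: ltW.
    by apply/funext => x; rewrite mulN1r addrC.
  have rs0 : 0 <= r `^ (- (s * p)) by exact: powR_ge0.
  have {}Ew : (energy s p B w <= (C2 * (1 + r `^ (- (s * p)) * k1) * k)%:E)%E.
    apply: (le_trans Ew); rewrite -/B.
    apply: (@le_trans _ _ (C2%:E * (k%:E + (r `^ (- (s * p)))%:E * (k1 * k)%:E))%E).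
      apply: lee_wpmul2l; first by rewrite lee_fin ltW.
      by apply: leeD => //; exact: lee_wpmul2l.
    rewrite -EFinM lee_fin; apply: le_of_eq; ring.
  have Efw := energyD s p p1 B f w mB mf mw.
  have {}Efw : (energy s p B (fun x => (f x + w x)%R) <= (2 `^ p * (1 + C2 * (1 + r `^ (- (s * p)) * k1)) * k)%:E)%E.
    apply: (le_trans Efw).
    apply: (@le_trans _ _ ((2 `^ p)%:E * (k%:E + (C2 * (1 + r `^ (- (s * p)) * k1) * k)%:E))%E).
      apply: lee_wpmul2l; first by rewrite lee_fin powR_ge0.
      by apply: leeD; [exact: ltW|exact: Ew].
    rewrite -EFinM lee_fin; apply: le_of_eq; ring.
  have m2p : 0 <= (m / 2)^-1 `^ p by exact: powR_ge0.
  have {}Hc := le_trans Hc (lee_wpmul2l (_ : (0 <= ((m / 2)^-1 `^ p)%:E)%E) Efw).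
  have : c <= (m / 2)^-1 `^ p * (2 `^ p * (1 + C2 * (1 + r `^ (- (s * p)) * k1)) * k).
    by rewrite -lee_fin EFinM; apply: Hc; rewrite lee_fin.
  move=> /(ler_wpM2l (powR_ge0 m p)) /le_trans; apply.
  rewrite invf_div powRM ?invr_ge0 ?(ltW m0)//.
  rewrite -(powR_inv1 (ltW m0)) -powRrM mulN1r (powRN m) /k2.
  have mp : m `^ p != 0 by rewrite gt_eqF ?powR_gt0.
  apply: le_of_eq; field; exact: mp.
exists (2 `^ p * (k1 + (2 * r) ^+ n * (k2 / c))) => [|f k sf Ef].
  rewrite mulr_gt0 ?powR_gt0// ltr_wpDr// mulr_ge0 ?divr_ge0 ?(ltW k20) ?(ltW c0)//.
  by rewrite exprn_ge0// mulr_ge0// ltW.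
have mf := Cc_infty_measurable B f sf.
have k0 : 0 <= k.
  by rewrite -lee_fin; apply: (le_trans (energy_ge0 s p B f)); exact: ltW.
have [m Hm] := HP x0 r f k r0 mf Ef; rewrite -/B in Hm.
have mfm : measurable_fun setT (fun x : T => f x - m).
  by apply: measurable_funB; [exact: mf|exact: measurable_cst].
have mmf : measurable_fun setT (fun x : T => m - f x).
  by apply: measurable_funB; [exact: measurable_cst|exact: mf].
have Hm' : (lp_mass p B (fun x => (m - f x)%R) <= (k1 * k)%:E)%E.
  apply: le_trans Hm; rewrite !lp_massE; apply: le_of_eq.
  by apply: eq_integral => x _; rewrite distrC.
have mk : `|m| `^ p <= k2 / c * k.
  rewrite mulrAC ler_pdivlMr//; have [m0|m0|->] := ltgtP m 0; last first.
  - by rewrite normr0 powR0 ?gt_eqF// mul0r mulr_ge0// ltW.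
  - by rewrite gtr0_norm//; exact: (mean f).
  rewrite ltr0_norm//; apply: (mean (fun x => (-1) * f x)).
  - exact: Cc_infty_scale.
  - apply: le_lt_trans Ef; have := energy_affine s p B f (-1) 0 mB mf.
    rewrite normrN1 powR1 mul1e (_ : (fun x => _) = fun x => -1 * f x)//.
    by apply/funext => x; rewrite addr0.
  - apply: le_trans Hm; rewrite (_ : (fun x => _) = fun x => f x - m)//.
    by apply/funext => x; rewrite mulN1r opprK addrC.
  - by rewrite oppr_gt0.
have mm : measurable_fun B ((fun=> m) : T -> R) by exact: measurable_cst.
have := lp_massD p p1 B (fun x => f x - m) (fun=> m) mB (measurable_funTS mfm) mm.
rewrite (_ : (fun x => _) = f); last by apply/funext => x; rewrite subrK.
move=> /le_trans; apply; rewrite (lp_mass_cst p B m mB).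
apply: (@le_trans _ _ ((2 `^ p)%:E * ((k1 * k)%:E + (k2 / c * k)%:E * ((2 * r) ^+ n)%:E))%E).
  apply: lee_wpmul2l; first by rewrite lee_fin powR_ge0.
  apply: leeD; first exact: Hm.
  apply: lee_pmul; [by rewrite lee_fin powR_ge0|exact: measure_ge0|by rewrite lee_fin|exact: vB].
rewrite -EFinM lee_fin; apply: le_of_eq; ring.
Qed.

End capacity.

(** * Capacitary functions of open sets *)

Lemma cvg_powR {R : realType} (u : nat -> R) (l p : R) : 0 < p ->
  (forall j, 0 <= u j) -> u @ \oo --> l -> (fun j => u j `^ p) @ \oo --> l `^ p.
Proof.
move=> p0 u0 ul; have l0 : 0 <= l.
  rewrite -(cvg_lim (@Rhausdorff R) ul); apply: limr_ge; last exact: nearW.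
  by apply/cvg_ex; exists l.
move: l0; rewrite le_eqVlt => /predU1P[l0|l0]; last first.
  have cont : {for l, continuous (fun x : R => x `^ p)}.
    apply: differentiable_continuous; apply/derivable1_diffP.
    by have [] := is_derive1_powR p l0.
  exact: (cvg_comp _ _ ul cont).
rewrite -l0 powR0 ?gt_eqF//; apply/cvgrPdist_lt => e e0.
have e1 : 0 < e `^ p^-1 by rewrite powR_gt0.
rewrite -l0 in ul; move/cvgrPdist_lt : ul => /(_ _ e1); apply: filterS => j.
rewrite !sub0r !normrN (ger0_norm (u0 j)) (ger0_norm (powR_ge0 _ _)) => uj.
have := gt0_ltr_powR p0 (u0 j) (powR_ge0 _ _) uj.
by rewrite -powRrM mulVf ?gt_eqF// powRr1// ltW.
Qed.

Lemma fatou_le {d} {T : measurableType d} {R : realType}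
    (m : {measure set T -> \bar R}) (D : set T) (f : nat -> T -> R) (g : T -> R)
    (b : \bar R) : measurable D ->
  (forall j, measurable_fun D (f j)) -> (forall j x, 0 <= f j x) ->
  (forall x, D x -> (fun j => f j x) @ \oo --> g x) ->
  (forall j, (\int[m]_(x in D) (f j x)%:E <= b)%E) ->
  (\int[m]_(x in D) (g x)%:E <= b)%E.
Proof.
move=> mD mf f0 fg fb.
have mEf j : measurable_fun D (EFin \o f j) by exact/measurable_EFinP.
have Ef0 j x : D x -> (0 <= (EFin \o f j) x)%E by move=> _; rewrite lee_fin.
have -> : (\int[m]_(x in D) (g x)%:E = \int[m]_(x in D) limn_einf (fun j => (EFin \o f j) x))%E.
  apply: eq_integral => x /set_mem Dx.
  have /cvg_limn_einf_sup[-> _] // : (fun j => (EFin \o f j) x) @ \oo --> (g x)%:E.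
  by apply/fine_cvgP; split; [exact: nearW|exact: fg].
apply: (le_trans (fatou m mD mEf Ef0)).
rewrite limn_einf_lim; apply: lime_le; first exact: is_cvg_einfs.
apply: nearW => j; apply: le_trans (fb j).
by apply: ereal_inf_lbound; exists j => /=.
Qed.

Section capacitary.
Context {R : realType} {n : nat}.
Local Notation mu := (@lebesgue_rV R n).
Local Notation T := (Rn R n).
Variables (s p : R) (B : set T).
Hypotheses (p1 : 1 < p) (mB : measurable B).

Implicit Types u v : T -> R.

Let p0 : 0 < p. Proof. exact: lt_trans ltr01 p1. Qed.

(** The [p]-th power of the norm of [W^(s,p)(B)]. *)
Definition sobolev_norm (v : T -> R) : \bar R := (energy s p B v + lp_mass p B v)%E.

(** Measurable competitors, instead of smooth ones, are stable under minimum and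
    maximum. *)
Definition competitor (L : set T) : set (T -> R) :=
  [set v : T -> R | [/\ measurable_fun setT v, forall x, 0 <= v x, forall x, v x <= 1 &
    forall x, L x -> v x = 1]].

Let F0 v : (0 <= sobolev_norm v)%E.
Proof. by rewrite adde_ge0//; [exact: energy_ge0|exact: lp_mass_ge0]. Qed.

Lemma competitor_max L L' u v : competitor L u -> competitor L' v ->
  competitor (L `|` L') (fun x => Num.max (u x) (v x)).
Proof.
move=> [mfu u0 u1 uL] [mfv v0 v1 vL]; split.
- exact: measurable_maxr.
- by move=> x; rewrite le_max u0.
- by move=> x; rewrite ge_max u1 v1.
- by move=> x [/uL ->|/vL ->]; [rewrite max_l|rewrite max_r].
Qed.

Lemma competitor_min L L' u v : competitor L u -> competitor L' v ->
  competitor (L `&` L') (fun x => Num.min (u x) (v x)).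
Proof.
move=> [mfu u0 u1 uL] [mfv v0 v1 vL]; split.
- exact: measurable_minr.
- by move=> x; rewrite le_min u0 v0.
- by move=> x; rewrite ge_min u1.
- by move=> x [/uL -> /vL ->]; rewrite min_l.
Qed.

Lemma sobolev_norm_strong_subadditive u v : measurable_fun setT u -> measurable_fun setT v ->
  (sobolev_norm (fun x => Num.max (u x) (v x)) + sobolev_norm (fun x => Num.min (u x) (v x)) <=
   sobolev_norm u + sobolev_norm v)%E.
Proof.
move=> mfu mfv; rewrite /sobolev_norm.
have H1 := energy_strong_subadditive s p p1 B u v mB mfu mfv.
have mpw (w : T -> R) : measurable_fun setT w -> measurable_fun B (fun x => `|w x| `^ p).
  by move=> mw; apply: measurable_powR_norm; exact: measurable_funTS.
have H2 : (lp_mass p B (fun x => Num.max (u x) (v x)) + lp_mass p B (fun x => Num.min (u x) (v x)) <=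
   lp_mass p B u + lp_mass p B v)%E.
  rewrite !lp_massE; apply: ge0_integral_le_add.
  - exact: mB.
  - by move=> x; exact: powR_ge0.
  - by move=> x; exact: powR_ge0.
  - by move=> x; exact: powR_ge0.
  - by move=> x; exact: powR_ge0.
  - by apply: mpw; exact: measurable_maxr.
  - by apply: mpw; exact: measurable_minr.
  - exact: mpw.
  - exact: mpw.
  move=> x _; have [_|_] := leP (u x) (v x); last by [].
  by rewrite addrC.
have := leeD H1 H2.
by rewrite addeACA [X in (_ <= X)%E -> _]addeACA.
Qed.

Lemma sobolev_norm_cvg_le (f : nat -> T -> R) (g : T -> R) (b : \bar R) :
  (forall j, measurable_fun setT (f j)) -> measurable_fun setT g ->
  (forall x, (fun j => f j x) @ \oo --> g x) ->
  (forall j, (sobolev_norm (f j) <= b)%E) -> (sobolev_norm g <= b + b)%E.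
Proof.
move=> mf mg fg fb; apply: leeD.
  rewrite (energyE s p B g mB mg).
  apply: (fatou_le _ _ (fun j => energy_density s p (f j))).
  - exact: measurableX.
  - by move=> j; apply: measurable_funTS; exact: measurable_energy_density.
  - by move=> j z; exact: energy_density_ge0.
  - move=> [x y] _; rewrite /energy_density/=.
    apply: cvgM; last exact: cvg_cst.
    apply: cvg_powR => //; apply: cvg_norm; apply: cvgB; exact: fg.
  move=> j; rewrite -(energyE s p B (f j) mB (mf j)).
  by apply: le_trans (fb j); rewrite /sobolev_norm leeDl// lp_mass_ge0.
rewrite lp_massE; apply: (fatou_le _ _ (fun j x => `|f j x| `^ p)).
- exact: mB.
- by move=> j; apply: measurable_powR_norm; exact: measurable_funTS.
- by move=> j x; exact: powR_ge0.
- by move=> x _; apply: cvg_powR => //; apply: cvg_norm; exact: fg.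
move=> j; rewrite -lp_massE.
by apply: le_trans (fb j); rewrite /sobolev_norm leeDr// energy_ge0.
Qed.

(** The strong subadditivity makes the defects of almost minimisers add up, hence
    summable when the minimisers are taken for an increasing sequence of sets. *)
Lemma competitor_bigcup (L : nat -> set T) (a d : R) : 0 < d ->
  (forall i j, (i <= j)%N -> L i `<=` L j) ->
  (forall j, exists2 v, competitor (L j) v & (sobolev_norm v <= a%:E)%E) ->
  exists2 v, competitor (\bigcup_j L j) v & (sobolev_norm v <= (2 * (a + d))%:E)%E.
Proof.
move=> d0 ndL HL.
pose c j := ereal_inf (sobolev_norm @` competitor (L j)).
have c0 j : (0 <= c j)%E by apply: le_ereal_inf_tmp => _ [v _ <-]; exact: F0.
have ca j : (c j <= a%:E)%E.
  have [v Lv va] := HL j; apply: le_trans va.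
  by apply: ereal_inf_lbound; exists v.
have cE j : c j = (fine (c j))%:E.
  by rewrite fineK// ge0_fin_numE// (le_lt_trans (ca j))// ltry.
pose e j : R := d * (2^-1) ^+ j.+1.
have e0 j : 0 < e j by rewrite mulr_gt0// exprn_gt0// invr_gt0.
have Hf j : exists v, competitor (L j) v /\ (sobolev_norm v <= c j + (e j)%:E)%E.
  have cfin : c j \is a fin_num by rewrite cE.
  have [_ [v Lv <-] vc] := lb_ereal_inf_adherent (e0 j) cfin.
  by exists v; split => //; exact: ltW.
have [f Hf'] := choice Hf.
pose g := fix g j := if j is j'.+1 then (fun x => Num.max (g j' x) (f j'.+1 x)) else f 0%N.
have Lg j : competitor (L j) (g j).
  elim: j => [|j IHj]; first by have [] := Hf' 0%N.
  have [Lf _] := Hf' j.+1; have := competitor_max _ _ _ _ IHj Lf.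
  by rewrite (setUidr (ndL _ _ (leqnSn j))).
(* the sum of [e 0], ..., [e j] *)
pose b j : R := d * (1 - (2^-1) ^+ j.+1).
have gb j : (sobolev_norm (g j) <= c j + (b j)%:E)%E.
  elim: j => [|j IHj].
    have [_] := Hf' 0%N; rewrite /= (_ : e 0%N = b 0%N)// /e /b expr1.
    by field.
  have [Lf Ff] := Hf' j.+1; have Lj := Lg j.
  have [mgj _ _ _] := Lj; have [mfj _ _ _] := Lf.
  have cmin : (c j <= sobolev_norm (fun x => Num.min (g j x) (f j.+1 x)))%E.
    apply: ereal_inf_lbound; exists (fun x => Num.min (g j x) (f j.+1 x)); last reflexivity.
    have := competitor_min _ _ _ _ Lj Lf.
    by rewrite (setIidl (ndL _ _ (leqnSn j))).
  have := sobolev_norm_strong_subadditive (g j) (f j.+1) mgj mfj.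
  have := leeD IHj Ff; move: cmin (F0 (fun x => Num.max (g j x) (f j.+1 x))).
  rewrite -/(g j.+1) (_ : b j.+1 = b j + e j.+1); last first.
    by rewrite /b /e [in LHS]exprS [in RHS](exprS _ j.+1); field.
  rewrite (cE j) (cE j.+1) -!EFinD.
  move: (sobolev_norm (g j)) (sobolev_norm (f j.+1)) => A1 A2.
  move: (sobolev_norm (fun x => Num.min _ _)) => A3.
  move: (sobolev_norm (g j.+1)) => A4.
  move: A4 A3 => [a4| |] [a3| |] // h1 h2 h3 h4; have := le_trans h4 h3;
    rewrite ?addye ?addey// -?EFinD ?leye_eq ?lee_fin => h; move: h1; rewrite ?lee_fin; lra.
have gb2 j : (sobolev_norm (g j) <= (a + d)%:E)%E.
  apply: (le_trans (gb j)); rewrite EFinD; apply: leeD => //.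
  by rewrite lee_fin /b ger_pMr// gerBl exprn_ge0// invr_ge0.
pose v x := sup (range (fun j => g j x)).
have ndg x : nondecreasing_seq (fun j => g j x).
  by apply/nondecreasing_seqP => j /=; rewrite le_max lexx.
have ubg x : has_ubound (range (fun j => g j x)).
  by exists 1 => _ [j _ <-]; have [_ _ + _] := Lg j.
have gv x : (fun j => g j x) @ \oo --> v x by exact: nondecreasing_cvgn.
have mg j : measurable_fun setT (g j) by have [] := Lg j.
have mv : measurable_fun setT v.
  by apply: (measurable_fun_cvg mg) => x _; exact: gv.
exists v; last first.
  by have := sobolev_norm_cvg_le g v _ mg mv gv gb2; rewrite -EFinD mulr_natl mulr2n.
have gle j x : g j x <= v x by apply: ub_le_sup => //; exists j.
split => //.
- by move=> x; apply: le_trans (gle 0%N x); have [_ + _ _] := Lg 0%N.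
- by move=> x; apply: ge_sup; [exists (g 0%N x); exists 0%N|
    move=> _ [j _ <-]; have [_ _ + _] := Lg j].
- move=> x [j _ Ljx]; apply/eqP; rewrite eq_le; apply/andP; split.
    by apply: ge_sup; [exists (g 0%N x); exists 0%N|
      move=> _ [i _ <-]; have [_ _ + _] := Lg i].
  by apply: le_trans (gle j x); have [_ _ _ ->] := Lg j.
Qed.

End capacitary.

(** * The mean value is controlled by the capacity of the zero set *)

Section mean_value.
Context {R : realType} {n : nat}.
Local Notation mu := (@lebesgue_rV R n).
Local Notation T := (Rn R n).
Variables (s p : R).
Hypotheses (n0 : (0 < n)%N) (s0 : 0 < s) (s1 : s < 1) (p1 : 1 < p).

Let p0 : 0 < p. Proof. exact: lt_trans ltr01 p1. Qed.

Lemma cap_compact_lt (B E L : set 'rV[R]_n) (d : R) : open E ->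
  (cap s p E B < d%:E)%E -> compact L -> L `<=` E ->
  (cap_compact s p B L < d%:E)%E.
Proof.
move=> oE; rewrite /cap; case: asboolP => [_|_] Ed cL LE.
  apply: le_lt_trans Ed; apply: ereal_inf_le_tmp => _ [u [su u1] <-].
  by exists u => //; split => // x /LE; exact: u1.
move: Ed; case: asboolP => // _; apply: le_lt_trans.
by apply: ereal_sup_ubound; exists L.
Qed.

(** Almost minimisers for the capacities of the compact subsets that exhaust
   [E] have small full norm by [friedrichs]; truncated to values between [0]
   and [1] they are the competitors that [competitor_bigcup] combines. *)
Lemma capacitary_function x0 (r : R) (K : set 'rV[R]_n) : 0 < r -> compact K ->
  (forall x, K x -> edist x x0 <= r / 2) ->
  (0 < cap_compact s p (eball x0 r) K)%E ->
  exists2 M : R, 0 < M & forall (E : set 'rV[R]_n) (d : R), open E -> 0 < d ->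
    (cap s p E (eball x0 r) < d%:E)%E ->
    exists2 v, competitor E v & (sobolev_norm s p (eball x0 r) v <= (M * d)%:E)%E.
Proof.
move=> r0 cK Kr cap0; have [M M0 HM] := friedrichs s p n0 s0 s1 p1 x0 r K r0 cK Kr cap0.
pose B : set T := eball x0 r; rewrite -/B in HM *.
have mB : measurable B by exact: measurable_eball.
exists (2 * (2 + M)) => [|E d oE d0 Ed]; first by rewrite mulr_gt0// addr_gt0.
pose L := fix L j : set T := if j is j'.+1 then L j' `|` inner_box E j' else set0.
have LE j : L j `<=` E.
  elim: j => [|j IHj] //=; rewrite subUset; split => // x Ex.
  by rewrite -(bigcup_inner_box E oE); exists j.
have cL j : compact (L j : set 'rV[R]_n).
  by elim: j => [|j IHj]; [exact: compact0|apply: compactU => //; exact: compact_inner_box].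
have ndL i j : (i <= j)%N -> L i `<=` L j.
  move=> /subnKC <-; elim: (j - i)%N => [|k IHk]; first by rewrite addn0.
  by rewrite addnS => x /IHk; left.
have EL : \bigcup_j L j = E.
  apply/seteqP; split => [x [j _ /LE//]|x].
  by rewrite -{1}(bigcup_inner_box E oE) => -[j _ Ex]; exists j.+1 => //; right.
have comp j : exists2 v, competitor (L j) v & (sobolev_norm s p B v <= ((1 + M) * d)%:E)%E.
  have /ereal_inf_lt[_ [f [sf f1] <-]] := cap_compact_lt B E (L j) d oE Ed (cL j) (LE j).
  rewrite -energy_gagliardo => Ef.
  have mf := Cc_infty_measurable B f sf.
  have Lf := HM f d sf Ef.
  pose v (x : T) : R := Num.min (Num.max (f x) 0) 1.
  have mv : measurable_fun setT v.
    apply: measurable_minr; last exact: measurable_cst.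
    by apply: measurable_maxr; [exact: mf|exact: measurable_cst].
  have mfB := measurable_funTS (D := B) mf.
  have mvB := measurable_funTS (D := B) mv.
  exists v.
    split => //.
    - by move=> x; rewrite le_min ler01 le_max lexx orbT.
    - by move=> x; rewrite ge_min lexx orbT.
    - by move=> x /f1 fx; rewrite /v min_r// le_max fx.
  have Ev : (energy s p B v <= energy s p B f)%E.
    apply: (le_energy s p p1 B v f mB mv mf) => x y _ _.
    exact: (le_trans (minr_cst_dist _ _ _) (maxr_cst_dist _ _ _)).
  have Lv : (lp_mass p B v <= lp_mass p B f)%E.
    apply: (le_lp_mass p p1 B v f mB mvB mfB) => x _.
    rewrite ger0_norm; last by rewrite le_min ler01 le_max lexx orbT.
    by rewrite ge_min ge_max ler_norm normr_ge0.
  rewrite /sobolev_norm mulrDl mul1r EFinD; apply: leeD.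
    by apply: (le_trans Ev); exact: ltW.
  exact: (le_trans Lv).
have [v] := competitor_bigcup s p B p1 mB L ((1 + M) * d) d d0 ndL comp.
rewrite EL => Ev Fv; exists v => //.
apply: (le_trans Fv); rewrite lee_fin; apply: le_of_eq; ring.
Qed.

(** For nonzero [c] the function [w = 1 - u / c] equals [1] on [K]. By quasi
   continuity it is at least [1/2] near [K], except on an open set [E] of
   capacity less than [d], where a capacitary function [v] of [E] takes over.
   So the maximum of [w] and [v] bounds the capacity of [K], and the
   contribution of [v] disappears as [d] tends to [0]. *)
Lemma mean_value_capacity : exists2 C : R, 0 < C & forall x0 (r : R) (u : T -> R)
    (K : set 'rV[R]_n) (c k a : R), 0 < r -> measurable_fun setT u ->
  quasi_continuous s p (eball x0 r) u ->
  compact K -> (forall x, K x -> edist x x0 <= r / 2) -> (forall x, K x -> u x = 0) ->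
  (energy s p (eball x0 r) u <= k%:E)%E ->
  (lp_mass p (eball x0 r) (fun x => (u x - c)%R) <= a%:E)%E ->
  ((`|c| `^ p)%:E * cap_compact s p (eball x0 r) K <= (C * (k + r `^ (- (s * p)) * a))%:E)%E.
Proof.
have [C C0 HC] := cap_compact_le_energy (n := n) s p n0 s0 s1 p1.
have [C3 C30 HC3] := cap_compact_le_radius (n := n) s p n0 s0 s1 p1.
exists (C * 2 `^ p) => [|x0 r u K c k a r0 mfu qu cK Kr Ku Eu Lu].
  by rewrite mulr_gt0// powR_gt0.
have cap0 := cap_compact_ge0 s p (eball x0 r) K.
have capfin := HC3 x0 r K r0 cK Kr.
have k0 : 0 <= k by rewrite -lee_fin; exact: le_trans (energy_ge0 _ _ _ _) Eu.
have a0 : 0 <= a by rewrite -lee_fin; exact: le_trans (lp_mass_ge0 _ _ _) Lu.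
have rs0 : 0 <= r `^ (- (s * p)) by exact: powR_ge0.
have rhs0 : 0 <= C * 2 `^ p * (k + r `^ (- (s * p)) * a).
  by rewrite !mulr_ge0 ?powR_ge0 ?addr_ge0 ?mulr_ge0// ltW.
have [->|cn] := eqVneq c 0; first by rewrite normr0 powR0 ?gt_eqF// mul0e lee_fin.
have [capE|capn] := eqVneq (cap_compact s p (eball x0 r) K) 0%E.
  by rewrite capE mule0 lee_fin.
have {capn}cap1 : (0 < cap_compact s p (eball x0 r) K)%E by rewrite lt_neqAle eq_sym capn.
have [M M0 HM] := capacitary_function x0 r K r0 cK Kr cap1.
have capE : cap_compact s p (eball x0 r) K = (fine (cap_compact s p (eball x0 r) K))%:E.
  by rewrite fineK// ge0_fin_numE// (le_lt_trans capfin)// ltry.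
move: HC HM Eu Lu capE qu; set cK' := fine _.
pose B : set T := eball x0 r; rewrite -/B => HC HM Eu Lu capE qu.
have mB : measurable B by exact: measurable_eball.
have cn0 : 0 < `|c| by rewrite normr_gt0.
pose X := `|c^-1| `^ p * (k + r `^ (- (s * p)) * a).
pose Y := (1 + r `^ (- (s * p))) * M.
have key (d : R) : 0 < d -> cK' <= C * 2 `^ p * (X + Y * d).
  move=> d0; have [E [oE EB Ed cE]] := qu d d0.
  have [v [mv v0 v1 vE] Fv] := HM E d oE d0 Ed.
  move/continuousP : cE => /(_ (ball (0 : R) (`|c| / 2)) (ball_open _ _)).
  move=> /open_subspaceP[U2 oU2 U2E].
  pose w (x : T) : R := - c^-1 * u x + 1.
  have mw : measurable_fun setT w.
    apply: measurable_funD; last exact: measurable_cst.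
    by apply: measurable_funM; [exact: measurable_cst|exact: mfu].
  pose h (x : T) : R := Num.max (w x) (v x).
  have mh : measurable_fun setT h by exact: measurable_maxr.
  have Ew : (energy s p B w <= (`|c^-1| `^ p * k)%:E)%E.
    have := energy_affine s p B u (- c^-1) 1 mB mfu; rewrite normrN => /le_trans; apply.
    by rewrite EFinM; apply: lee_wpmul2l => //; rewrite lee_fin powR_ge0.
  have Lw : (lp_mass p B w <= (`|c^-1| `^ p * a)%:E)%E.
    have muc : measurable_fun B (fun x => u x - c).
      by apply: measurable_funTS; apply: measurable_funB; [exact: mfu|exact: measurable_cst].
    have := lp_mass_affine_le p B (fun x => u x - c) (- c^-1) mB muc.
    have wE : (fun x : T => - c^-1 * (u x - c)) = w.
      by apply/funext => x; rewrite /w mulrBr (mulNr _ c) mulVf// opprK.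
    rewrite normrN wE.
    move=> /le_trans; apply.
    by rewrite EFinM; apply: lee_wpmul2l => //; rewrite lee_fin powR_ge0.
  have Ev : (energy s p B v <= (M * d)%:E)%E.
    by apply: le_trans Fv; rewrite /sobolev_norm leeDl// lp_mass_ge0.
  have Lv : (lp_mass p B v <= (M * d)%:E)%E.
    by apply: le_trans Fv; rewrite /sobolev_norm leeDr// energy_ge0.
  have Eh : (energy s p B h <= (`|c^-1| `^ p * k + M * d)%:E)%E.
    apply: (le_trans (energy_maxr s p p1 B w v mB mw mv)).
    by rewrite EFinD; exact: leeD.
  have Lh : (lp_mass p B h <= (`|c^-1| `^ p * a + M * d)%:E)%E.
    apply: (le_trans (lp_mass_maxr p B w v mB (measurable_funTS mw) (measurable_funTS mv))).
    by rewrite EFinD; exact: leeD.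
  pose U : set 'rV[R]_n := (E `|` U2) `&` B.
  have oU : open U by apply: openI; [exact: openU|exact: open_eball].
  have KB x : K x -> B x by move=> /Kr; rewrite /B /eball/=; lra.
  have KU : K `<=` U.
    move=> x Kx; split; last exact: KB.
    have [Ex|nEx] := pselect (E x); [by left|right].
    have : (u @^-1` ball (0 : R) (`|c| / 2) `&` (B `\` E)) x.
      split; last by split => //; exact: KB.
      by rewrite /preimage/= (Ku x Kx); apply: ballxx; rewrite divr_gt0.
    by rewrite -U2E => -[].
  have hU x : U x -> 2^-1 <= h x.
    move=> [EU Bx]; have [Ex|nEx] := pselect (E x).
      by rewrite /h le_max (vE x Ex); apply/orP; right; lra.
    have U2x : U2 x by case: EU.
    have : (U2 `&` (B `\` E)) x by split.
    rewrite U2E => -[] /= + _; rewrite /ball/= sub0r normrN => ux.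
    rewrite /h le_max; apply/orP; left.
    have : `|c^-1 * u x| <= 2^-1.
      by rewrite normrM normfV ler_pdivrMl// ltW.
    by rewrite /w mulNr ler_norml => /andP[? ?]; lra.
  have := HC x0 r h K U 2^-1 r0 mh (le_lt_trans Lh (ltry _)) cK Kr oU KU _ hU.
  rewrite -/B invr_gt0 invrK capE => /(_ (ltr0n _ 2)) H.
  have {}H := le_trans H (lee_wpmul2l (_ : 0 <= (C * 2 `^ p)%:E)%E
    (leeD Eh (lee_wpmul2l (_ : 0 <= (r `^ (- (s * p)))%:E)%E Lh))).
  have : cK' <= C * 2 `^ p * ((`|c^-1| `^ p * k + M * d) +
      r `^ (- (s * p)) * (`|c^-1| `^ p * a + M * d)).
    rewrite -lee_fin; apply: H; rewrite lee_fin//.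
    by rewrite mulr_ge0 ?powR_ge0// ltW.
  move=> /le_trans; apply; apply: le_of_eq.
  by rewrite /X /Y; ring.
have {key} : cK' <= C * 2 `^ p * X.
  apply/ler_addgt0Pr => e e0.
  have D0 : 0 < C * 2 `^ p * Y + 1.
    by rewrite ltr_wpDl// !mulr_ge0 ?powR_ge0 ?addr_ge0// ltW.
  have d0 : 0 < e / (C * 2 `^ p * Y + 1) by rewrite divr_gt0.
  apply: (le_trans (key _ d0)); rewrite mulrDr lerD2l mulrA mulrCA ler_piMr ?(ltW e0)//.
  by rewrite ler_pdivrMr// mul1r lerDl.
rewrite capE -EFinM lee_fin /X => H.
apply: (le_trans (ler_wpM2l (powR_ge0 _ _) H)).
apply: le_of_eq.
have -> : `|c^-1| `^ p = (`|c| `^ p)^-1.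
  by rewrite normfV -[`|c|^-1]powR_inv1 ?normr_ge0// -powRrM mulN1r powRN.
by field; rewrite gt_eqF ?powR_gt0.
Qed.

End mean_value.

(** * The Maz'ya type inequality *)

Lemma compact_zero_set {R : realType} {n : nat} (x0 : 'rV[R]_n) (r : R)
    (u : 'rV[R]_n -> R) (E : set 'rV[R]_n) : 0 < r -> open E ->
  {within eball x0 r `\` E, continuous u} ->
  compact (zero_set (eball x0 r) u E `&` closure (eball x0 (r / 2))) /\
  (forall x, (zero_set (eball x0 r) u E `&` closure (eball x0 (r / 2))) x ->
    edist x x0 <= r / 2 /\ u x = 0).
Proof.
move=> r0 oE cu; pose H : set 'rV[R]_n := closure (eball x0 (r / 2)).
have HB : H `<=` eball x0 r.
  by move=> x /closure_eball_sub; rewrite /cball /eball/=; lra.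
split; last by move=> x [[[_ ux] _] /closure_eball_sub].
have cH : {within H `\` E, continuous u}.
  by apply: continuous_subspaceW cu => x [Hx nEx]; split => //; exact: HB.
have cl0 : closed [set (0 : R)] by exact: closed_eq.
move/continuous_closedP : cH => /(_ [set 0] cl0) /closed_subspaceP[V cV VE].
apply: (subclosed_compact _ (compact_cball x0 (r / 2))); last first.
  by move=> x [_ /closure_eball_sub].
rewrite (_ : _ `&` _ = V `&` (H `\` E)).
  apply: closedI => //; apply: closedI; first exact: closed_closure.
  exact: open_closedC.
rewrite VE; apply/seteqP; split => x /=.
  by move=> [[[_ ux] [_ nEx]] Hx]; split.
by move=> [ux [Hx nEx]]; split => //; split; split => //; exact: HB.
Qed.

Section poincare_capacity.
Context {R : realType} {n : nat}.
Local Notation mu := (@lebesgue_rV R n).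
Local Notation T := (Rn R n).
Variables (s p Q a q : R).
Hypotheses (n0 : (0 < n)%N) (s0 : 0 < s) (s1 : s < 1) (p1 : 1 < p) (pQ : p < Q).
Hypotheses (aQ : a * Q = Q - p) (asp : a * n%:R <= s * p) (q1 : 1 <= q) (qQ : q <= Q).

Let p0 : 0 < p. Proof. exact: lt_trans ltr01 p1. Qed.
Let q0 : 0 < q. Proof. exact: lt_le_trans ltr01 q1. Qed.

(** Let [m] be the constant of [poincare_sobolev]. The difference [u - m] is
   controlled by the energy alone, which can be divided by the capacity since
   that is at most [C3 r^(n - sp)]; the constant [m] is controlled by
   [mean_value_capacity]. *)
Lemma lp_mass_capacity : exists2 C : R, 0 < C & forall x0 (r : R) (u : T -> R)
    (K : set 'rV[R]_n) (k c : R), 0 < r -> measurable_fun setT u ->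
  quasi_continuous s p (eball x0 r) u ->
  compact K -> (forall x, K x -> edist x x0 <= r / 2 /\ u x = 0) ->
  (energy s p (eball x0 r) u < k%:E)%E ->
  cap_compact s p (eball x0 r) K = c%:E -> 0 < c ->
  (lp_mass q (eball x0 r) u <= (C * r ^+ n * (k / c) `^ (q / p))%:E)%E.
Proof.
have [C1 C10 H1] := poincare_sobolev (n := n) s p Q a n0 s0 p1 pQ aQ asp q q1 qQ.
have [C2 C20 H2] := mean_value_capacity (n := n) s p n0 s0 s1 p1.
have [C3 C30 H3] := cap_compact_le_radius (n := n) s p n0 s0 s1 p1.
have qp0 : 0 < q / p by rewrite divr_gt0.
pose C4 := C2 * (1 + C1).
have C40 : 0 < C4 by rewrite mulr_gt0// addr_gt0.
exists (2 `^ q * (C1 * C3 `^ (q / p) + 2 ^+ n * C4 `^ (q / p))) => [|x0 r u K k c r0 mfu qu cK Ku Eu capE c0].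
  by rewrite mulr_gt0 ?powR_gt0// addr_gt0// mulr_gt0 ?powR_gt0// exprn_gt0.
pose B : set T := eball x0 r; rewrite -/B in Eu qu capE *.
have mB : measurable B by exact: measurable_eball.
have k0 : 0 < k by rewrite -lte_fin; exact: le_lt_trans (energy_ge0 _ _ _ _) Eu.
have Kr x : K x -> edist x x0 <= r / 2 by move=> /Ku[].
have Ku0 x : K x -> u x = 0 by move=> /Ku[].
have rn : r `^ (n%:R - s * p) * r `^ (s * p - n%:R) = 1.
  rewrite -powRD ?(gt_eqF r0) ?implybT// (_ : n%:R - s * p + (s * p - n%:R) = 0) ?powRr0//; ring.
pose k' := r `^ (s * p - n%:R) * k.
have k'0 : 0 < k' by rewrite mulr_gt0 ?powR_gt0.
have Eu' : (energy s p B u < (r `^ (n%:R - s * p) * k')%:E)%E.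
  by rewrite /k' mulrA rn mul1r.
have [m [Lp Lq]] := H1 x0 r u k' r0 k'0 mfu Eu'; rewrite -/B in Lp Lq.
have Hm := H2 x0 r u K m k _ r0 mfu qu cK Kr Ku0 (ltW Eu) Lp.
have kc0 : 0 < k / c by rewrite divr_gt0.
have mk : `|m| `^ p <= C4 * (k / c).
  move: Hm; rewrite -/B capE -EFinM lee_fin -ler_pdivlMr// => /le_trans; apply.
  rewrite [leRHS]mulrA ler_pM2r ?invr_gt0//; apply: le_of_eq.
  have -> : r `^ (- (s * p)) * (C1 * r ^+ n * k') =
      C1 * k * (r `^ (n%:R - s * p) * r `^ (s * p - n%:R)).
    by rewrite /k' [in RHS]powRD ?(gt_eqF r0) ?implybT// powR_mulrn ?(ltW r0)//; ring.
  by rewrite rn /C4; ring.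
have k'c : k' <= C3 * (k / c).
  have := H3 x0 r K r0 cK Kr; rewrite -/B capE lee_fin => cr.
  rewrite mulrA ler_pdivlMr// /k' mulrC mulrA.
  have := ler_wpM2r (powR_ge0 r (s * p - n%:R)) cr.
  by rewrite -(mulrA C3) rn mulr1 => /(ler_wpM2r (ltW k0)).
have mq : `|m| `^ q <= C4 `^ (q / p) * (k / c) `^ (q / p).
  have -> : `|m| `^ q = (`|m| `^ p) `^ (q / p).
    by rewrite -powRrM mulrCA mulfV ?gt_eqF// mulr1.
  rewrite -powRM ?(ltW C40) ?(ltW kc0)//.
  apply: ge0_ler_powR; rewrite ?nnegrE ?powR_ge0 ?(ltW qp0)//.
  by rewrite mulr_ge0 ?(ltW C40) ?(ltW kc0).
have k'q : k' `^ (q / p) <= C3 `^ (q / p) * (k / c) `^ (q / p).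
  rewrite -powRM ?(ltW C30) ?(ltW kc0)//.
  apply: ge0_ler_powR; rewrite ?nnegrE ?(ltW k'0) ?(ltW qp0)//.
  by rewrite mulr_ge0 ?(ltW C30) ?(ltW kc0).
have mum : measurable_fun B (fun x => u x - m).
  by apply: measurable_funTS; apply: measurable_funB; [exact: mfu|exact: measurable_cst].
have muB := measurable_funTS (D := B) mfu.
have mm : measurable_fun B ((fun=> m) : T -> R) by exact: measurable_cst.
have vB : (mu B <= ((2 * r) ^+ n)%:E)%E by exact: eball_volume_le (ltW r0).
have rn0 : 0 <= r ^+ n by rewrite exprn_ge0// ltW.
have q2 : 0 <= 2 `^ q :> R by exact: powR_ge0.
have main : (lp_mass q B u <= (2 `^ q)%:E * lp_mass q B (fun x => (u x - m)%R) +
    (2 `^ q * `|m| `^ q)%:E * mu B)%E.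
  have b0 : 0 <= 2 `^ q * `|m| `^ q by rewrite mulr_ge0// powR_ge0.
  apply: (lp_mass_le_comb q q B u (fun x => u x - m) _ _ mB q2 b0 muB mum) => x _.
  rewrite -mulrDr.
  by have := powR_normD q (ltW q0) (u x - m) m; rewrite subrK.
apply: (le_trans main).
apply: (@le_trans _ _ ((2 `^ q)%:E * (C1 * r ^+ n * k' `^ (q / p))%:E +
    (2 `^ q * `|m| `^ q)%:E * ((2 * r) ^+ n)%:E)%E).
  apply: leeD; apply: lee_wpmul2l; [by rewrite lee_fin|exact: Lq| |exact: vB].
  by rewrite lee_fin mulr_ge0// powR_ge0.
suff : 2 `^ q * (C1 * r ^+ n * k' `^ (q / p)) + 2 `^ q * `|m| `^ q * (2 * r) ^+ n <=
    2 `^ q * (C1 * C3 `^ (q / p) + 2 ^+ n * C4 `^ (q / p)) * r ^+ n * (k / c) `^ (q / p).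
  by [].
rewrite -!mulrA -mulrDr ler_wpM2l// exprMn.
have h1 := ler_wpM2l (mulr_ge0 (ltW C10) rn0) k'q.
have h2n : 0 <= 2 ^+ n * r ^+ n :> R by rewrite mulr_ge0// exprn_ge0.
have h2 := ler_wpM2r h2n mq.
have := lerD h1 h2; rewrite -!mulrA => /le_trans; apply.
by apply: le_of_eq; ring.
Qed.

End poincare_capacity.

Theorem theorem1p8 (R : realType) (n : nat) (s p q : R) :
  (0 < n)%N -> 0 < s -> s < 1 -> 1 < p -> 1 < s * p ->
  1 <= q -> (s * p < n%:R -> q <= n%:R * p / (n%:R - s * p)) ->
  exists C : R, 0 < C /\
    forall (x0 : 'rV[R]_n) (r : R) (u : 'rV[R]_n -> R) (E : set 'rV[R]_n),
      0 < r ->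
      let B := eball x0 r in
      let halfB := closure (eball x0 (r / 2)) in
      frac_sobolev s p B u ->
      quasi_continuous s p B u ->
      (exists2 eps : R, 0 < eps & exceptional_set s p B u eps E) ->
      let capZ := cap s p (zero_set B u E `&` halfB) B in
      (((lebesgue_rV B)^-1 * \int[lebesgue_rV]_(x in B) (`|u x| `^ q)%:E)
          `^ q^-1
       <= C%:E * (if capZ == 0 then +oo
                  else (capZ^-1 * gagliardo s p B u) `^ p^-1))%E.
Proof.
move=> n0 s0 s1 p1 sp1 q1 qs.
have p0 : 0 < p by exact: lt_trans ltr01 p1.
have q0 : 0 < q by exact: lt_le_trans ltr01 q1.
have n0' : 0 < n%:R :> R by rewrite ltr0n.
have [Q [a [pQ aQ asp qQ]]] : exists Q a : R,
    [/\ p < Q, a * Q = Q - p, a * n%:R <= s * p & q <= Q].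
  (* the critical exponent when there is one, any exponent above [p] and [q]
     otherwise *)
  have [spn|nsp] := ltP (s * p) n%:R.
    have d0 : 0 < n%:R - s * p by rewrite subr_gt0.
    have dn : n%:R - s * p != 0 by rewrite gt_eqF.
    exists (n%:R * p / (n%:R - s * p)), (s * p / n%:R); split.
    - rewrite ltr_pdivlMr// mulrC ltr_pM2r// gtrBl.
      exact: lt_trans ltr01 sp1.
    - by field; rewrite dn gt_eqF.
    - by rewrite divfK ?gt_eqF.
    - exact: qs.
  pose Q := Num.max q p + 1.
  have pQ : p < Q by rewrite ltr_pwDr// le_max lexx orbT.
  have Q0 : 0 < Q by exact: lt_trans pQ.
  exists Q, (1 - p / Q); split => //.
  - by rewrite mulrBl mul1r divfK// gt_eqF.
  - apply: le_trans nsp; rewrite ler_piMl ?(ltW n0')// gerBl.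
    by rewrite divr_ge0// ltW.
  - by rewrite ler_wpDr// le_max lexx.
have [C1 C10 H] := lp_mass_capacity (n := n) s p Q a q n0 s0 s1 p1 pQ aQ asp q1 qQ.
pose C := (C1 * n%:R ^+ n) `^ q^-1.
have C1n0 : 0 < C1 * n%:R ^+ n by rewrite mulr_gt0// exprn_gt0.
have C0 : 0 < C by rewrite powR_gt0.
exists C; split; first exact: C0.
move=> x0 r u E r0 B halfB [mu_ Lu Gu] qu [eps eps0 [oE EB _ cu]].
cbv zeta; set capZ := cap s p _ B.
case: ifPn => [_|cap0].
  by rewrite mulry gtr0_sg// mul1e leey.
have [cK Ku] := compact_zero_set x0 r u E r0 oE cu.
rewrite -/B -/halfB in cK Ku.
have capE0 : capZ = cap_compact s p B (zero_set B u E `&` halfB).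
  by rewrite /capZ /cap; case: asboolP.
have mB : measurable (B : set (Rn R n)) by exact: measurable_eball.
have [C3 C30 H3] := cap_compact_le_radius (n := n) s p n0 s0 s1 p1.
have capE : capZ = (fine capZ)%:E.
  have cap_ge0 : (0 <= capZ)%E by rewrite capE0; exact: cap_compact_ge0.
  rewrite fineK// ge0_fin_numE// capE0.
  apply: (le_lt_trans (H3 x0 r _ r0 cK (fun x Kx => (Ku x Kx).1))).
  by rewrite ltry.
have c0 : 0 < fine capZ.
  rewrite lt_neqAle fine_ge0 ?andbT; last by rewrite capE0; exact: cap_compact_ge0.
  by rewrite eq_sym; apply: contra cap0 => /eqP c0; rewrite capE c0.
move: capE c0; set c := fine _ => capE c0.
have gE : gagliardo s p B u = (fine (gagliardo s p B u))%:E.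
  by rewrite fineK// ge0_fin_numE// -energy_gagliardo energy_ge0.
have g0 : 0 <= fine (gagliardo s p B u).
  by apply: fine_ge0; rewrite -energy_gagliardo energy_ge0.
move: gE g0; set g := fine _ => gE g0.
(* [u] is measurable on the ball only *)
pose v : Rn R n -> R := patch (fun=> 0) B u.
have vu x : B x -> v x = u x by move=> Bx; rewrite /v patchE mem_set.
have mv : measurable_fun setT v by apply/(measurable_restrictT _ _).1.
have vuB : {in B, v =1 u} by move=> x /set_mem; exact: vu.
have Ev : energy s p B v = g%:E by rewrite (eq_energy s p B v u vuB) energy_gagliardo.
have qv : quasi_continuous s p B v.
  move=> e e0; have [E' [oE' EB' cE' cu']] := qu e e0; exists E'; split => //.
  apply: (subspace_eq_continuous _ cu') => x /set_mem[Bx _].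
  exact/esym/vu.
have Kv x : (zero_set B u E `&` halfB) x -> edist x x0 <= r / 2 /\ v x = 0.
  move=> Kx; have [xr ux] := Ku x Kx; split => //; rewrite vu//.
  by case: Kx => -[[]].
have Hk (k : R) : g < k -> (lp_mass q B u <= (C1 * r ^+ n * (k / c) `^ (q / p))%:E)%E.
  move=> gk; have := H x0 r v _ k c r0 mv qv cK Kv _ _ c0.
  by rewrite -/B Ev lte_fin -capE0 capE (eq_lp_mass q B v u vuB); apply.
have L0 := lp_mass_ge0 q B u.
have LE : lp_mass q B u = (fine (lp_mass q B u))%:E.
  rewrite fineK// ge0_fin_numE//; have := Hk (g + 1); rewrite ltrDl => /(_ ltr01).
  by move=> /le_lt_trans; apply; rewrite ltry.
have l0 : 0 <= fine (lp_mass q B u) by exact: fine_ge0.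
move: LE l0; set l := fine _ => LE l0.
have vB_ge := eball_volume_ge x0 r n0 r0.
have vB_le := eball_volume_le x0 r (ltW r0).
have vE : lebesgue_rV B = (fine (lebesgue_rV (B : set (Rn R n))))%:E.
  by rewrite fineK// ge0_fin_numE ?measure_ge0// (le_lt_trans vB_le)// ltry.
move: vB_ge vE; set vB := fine _ => vB_ge vE.
rewrite vE lee_fin in vB_ge.
have vB0 : 0 < vB by apply: lt_le_trans vB_ge; rewrite exprn_gt0// divr_gt0.
have rv : r ^+ n <= n%:R ^+ n * vB.
  by rewrite -ler_pdivrMl ?exprn_gt0// mulrC -expr_div_n.
pose X := l / vB.
have X0 : 0 <= X by rewrite divr_ge0// ltW.
have bound k : g < k -> X <= C1 * n%:R ^+ n * (k / c) `^ (q / p).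
  move=> gk; rewrite /X ler_pdivrMr//.
  have := Hk k gk; rewrite LE lee_fin => /le_trans; apply.
  rewrite -!mulrA ler_pM2l// [X in _ <= X]mulrCA (mulrC (r ^+ n)).
  by rewrite ler_wpM2l ?powR_ge0.
have bound1 k : g < k -> (X `^ q^-1 / C) `^ p * c <= k.
  move=> gk; have k0 : 0 < k by exact: le_lt_trans gk.
  have kc : 0 <= k / c by rewrite divr_ge0 ?ltW.
  have XC : X `^ q^-1 / C <= (k / c) `^ p^-1.
    rewrite ler_pdivrMr// mulrC.
    have := bound k gk => h.
    have := @ge0_ler_powR _ q^-1 _ X (C1 * n%:R ^+ n * (k / c) `^ (q / p)).
    rewrite ?nnegrE invr_ge0 ?(ltW q0) X0 mulr_ge0 ?powR_ge0 ?(ltW C1n0)//.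
    move=> /(_ isT isT isT h) /le_trans; apply.
    rewrite powRM ?powR_ge0 ?(ltW C1n0)// -/C -powRrM.
    by rewrite (_ : q / p * q^-1 = p^-1)//; field; rewrite !gt_eqF.
  have XC0 : 0 <= X `^ q^-1 / C by rewrite divr_ge0 ?powR_ge0.
  rewrite -ler_pdivlMr//.
  apply: (le_trans (@ge0_ler_powR _ p (ltW p0) _ _ _ _ XC)); rewrite ?nnegrE ?powR_ge0//.
  by rewrite -powRrM mulVf ?gt_eqF// powRr1.
have bound2 : (X `^ q^-1 / C) `^ p * c <= g by apply/ler_addgt0Pr => e e0; apply: bound1; rewrite ltrDl.
rewrite -lp_massE vE LE inver gt_eqF// -EFinM poweR_EFin gE capE inver gt_eqF//.
suff H0 : (vB^-1 * l) `^ q^-1 <= C * (c^-1 * g) `^ p^-1 by exact: H0.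
have -> : vB^-1 * l = X by rewrite mulrC.
have -> : c^-1 * g = g / c by rewrite mulrC.
rewrite [leRHS]mulrC -ler_pdivrMr//.
rewrite -ler_pdivlMr// in bound2.
have pi0 : 0 <= p^-1 by rewrite invr_ge0 ltW.
have gc0 : 0 <= g / c by rewrite divr_ge0// ltW.
have XC0 : 0 <= X `^ q^-1 / C by rewrite divr_ge0 ?powR_ge0.
have := @ge0_ler_powR _ p^-1 pi0 _ _ (powR_ge0 _ _) gc0 bound2.
by rewrite -powRrM mulfV ?gt_eqF// powRr1.
Qed.
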